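(* Suppose $A$ is an $n\times n$ real matrix and $\Gamma\subset\mathbb{R}^n$ is a full rank lattice. If $A$ is strictly expansive with respect to $\Gamma$, then there exists an $(A,\Gamma)$-MRA of multiplicity $1$ whose scaling function $\varphi$ belongs to the Schwartz class. Moreover, $\widehat\varphi$ is $C^\infty$ with compact support.
   Context: A real $n\times n$ matrix $A$ is expansive if all its eigenvalues $\lambda$ satisfy $|\lambda|>1$. The dual lattice of $\Gamma$ is $\Gamma^*=\{k\in\mathbb{R}^n:\langle k,\gamma\rangle\in\mathbb{Z}\text{ for all }\gamma\in\Gamma\}$. An expansive matrix $A$ is strictly expansive with respect to a full rank lattice $\Gamma\subset\mathbb{R}^n$ if there exists a compact set $K\subset\mathbb{R}^n$ such that $\sum_{k\in\Gamma^*}\mathbf 1_K(\xi+k)=1$ for a.e. $\xi\in\mathbb{R}^n$, and $K\subset BK^\circ$, where $B=A^\top$ and $K^\circ$ is the interior of $K$. Let $T_yf(x)=f(x-y)$ and $\widehat f(\xi)=\int_{\mathbb{R}^n} f(x)e^{-2\pi i\langle x,\xi\rangle}dx$. An $(A,\Gamma)$-MRA of multiplicity $1$ is a sequence $\{V_j\}_{j\in\mathbb{Z}}$ of closed subspaces of $L^2(\mathbb{R}^n)$ such that: (M1) $V_j\subset V_{j+1}$ for all $j$; (M2) $\bigcap_jV_j=\{0\}$; (M3) $\overline{\bigcup_jV_j}=L^2(\mathbb{R}^n)$; (M4) $f\in V_0\iff f(A^j\cdot)\in V_j$ for all $j\in\mathbb{Z}$; (M5) there exists $\varphi\in V_0$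 (the scaling function) such that $\{T_\gamma\varphi:\gamma\in\Gamma\}$ is an orthonormal basis of $V_0$. *)

(* Defs.v *)
From HB Require Import structures.
From mathcomp Require Import all_boot all_order all_algebra.
From mathcomp Require Import all_classical all_reals all_analysis.
From mathcomp Require Import complex.

Set Implicit Arguments.
Unset Strict Implicit.
Unset Printing Implicit Defensive.
Import Order.TTheory GRing.Theory Num.Theory.
Import numFieldNormedType.Exports.

Local Open Scope classical_set_scope.
Local Open Scope complex_scope.
Local Open Scope ring_scope.

Local Notation normc := (@Normc.normc _).

(** * Lebesgue measure on R^n *)

(** Vectors of R^n are column vectors ['cV[R]_n], with the product
    sigma-algebra (the same construction as the library's for tuples). *)

Definition measure_cV_display : measure_display -> measure_display.
Proof. exact. Qed.

Section measurable_cV.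
Context {d} {T : sigmaRingType d} {n : nat}.

Definition cV_coord (i : 'I_n) (x : 'cV[T]_n) : T := x i 0.

Let cV_set0 : g_sigma_preimage cV_coord set0.
Proof. exact: sigma_algebra0. Qed.

Let cV_setC A : g_sigma_preimage cV_coord A -> g_sigma_preimage cV_coord (~` A).
Proof. exact: sigma_algebraC. Qed.

Let cV_bigcup (F : _^nat) : (forall i, g_sigma_preimage cV_coord (F i)) ->
  g_sigma_preimage cV_coord (\bigcup_i (F i)).
Proof. exact: sigma_algebra_bigcup. Qed.

HB.instance Definition _ := @isMeasurable.Build (measure_cV_display d)
  'cV[T]_n (g_sigma_preimage cV_coord) cV_set0 cV_setC cV_bigcup.

End measurable_cV.

Lemma measurable_cV_coord d (T : sigmaRingType d) n (i : 'I_n) :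
  measurable_fun [set: 'cV[T]_n] (cV_coord i).
Proof.
move=> _ Y mY; rewrite setTI; apply: sub_sigma_algebra => /=.
rewrite -bigcup_seq/=; exists i => /=; first by rewrite mem_index_enum.
by exists Y => //; rewrite setTI.
Qed.

Lemma measurable_fun_cVP d1 d2 (T1 : measurableType d1) (T2 : measurableType d2)
    n (f : T1 -> 'cV[T2]_n) :
  (forall i, measurable_fun [set: T1] (fun x => f x i 0)) ->
  measurable_fun [set: T1] f.
Proof.
move=> mf _ B; rewrite setTI => mB.
suff : g_sigma_preimage (@cV_coord _ T2 n) `<=` [set B | measurable (f @^-1` B)].
  exact.
apply: smallest_sub.
  split=> /=; first by rewrite preimage_set0.
  - by move=> A; rewrite setTD preimage_setC; exact: measurableC.
  - by move=> F mF; rewrite preimage_bigcup; exact: bigcup_measurable.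
move=> A /=; rewrite -bigcup_seq => -[i _ [Y mY <-]].
by rewrite setTI /=; have := mf i measurableT _ mY; rewrite setTI.
Qed.

Section lebesgue_cV.
Context {R : realType}.

Section step.
Context {n : nat}.

Definition cV_cons (p : measurableTypeR R * 'cV[R]_n) : 'cV[R]_n.+1 :=
  col_mx (const_mx p.1 : 'cV[R]_1) p.2.

Definition cV_uncons (x : 'cV[R]_n.+1) : measurableTypeR R * 'cV[R]_n :=
  (x ord0 0, \col_i x (lift ord0 i) 0).

Lemma cV_consE0 p : cV_cons p ord0 0 = p.1.
Proof.
rewrite /cV_cons (_ : ord0 = lshift n (ord0 : 'I_1)); last exact/val_inj.
by rewrite (col_mxEu (const_mx p.1 : 'cV[R]_1)) mxE.
Qed.

Lemma cV_consES p i : cV_cons p (lift ord0 i) 0 = p.2 i 0.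
Proof.
rewrite /cV_cons (_ : lift ord0 i = rshift 1 i); last exact/val_inj.
by rewrite (col_mxEd (const_mx p.1 : 'cV[R]_1)).
Qed.

Lemma cV_consK : cancel cV_cons cV_uncons.
Proof.
move=> p; rewrite /cV_uncons cV_consE0 [RHS]surjective_pairing; congr pair.
by apply/matrixP => i j; rewrite [LHS]mxE ord1 cV_consES.
Qed.

Lemma measurable_cV_cons : measurable_fun [set: _] cV_cons.
Proof.
apply: measurable_fun_cVP => i; case: (unliftP ord0 i) => [j ->|->].
  under eq_fun do rewrite cV_consES.
  exact: (measurableT_comp (measurable_cV_coord j) measurable_snd).
under eq_fun do rewrite cV_consE0.
exact: measurable_fst.
Qed.

Lemma measurable_cV_uncons : measurable_fun [set: _] cV_uncons.
Proof.
apply/measurable_fun_pairP; split => /=; first exact: measurable_cV_coord.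
apply: measurable_fun_cVP => i; under eq_fun do rewrite /= mxE.
exact: measurable_cV_coord.
Qed.

End step.

Section push.
Context {n : nat} (mu : {sigma_finite_measure set 'cV[R]_n -> \bar R}).

Definition lebesgue_cV_step : set 'cV[R]_n.+1 -> \bar R :=
  pushforward (lebesgue_measure \x mu)%E cV_cons.

Let step0 : lebesgue_cV_step set0 = 0%E.
Proof. by rewrite /lebesgue_cV_step /pushforward preimage_set0 measure0. Qed.

Let step_ge0 A : (0 <= lebesgue_cV_step A)%E.
Proof. by rewrite /lebesgue_cV_step /pushforward; exact: measure_ge0. Qed.

Let step_sigma_additive : semi_sigma_additive lebesgue_cV_step.
Proof.
move=> F mF tF mUF; rewrite /lebesgue_cV_step /pushforward preimage_bigcup.
apply: measure_semi_sigma_additive.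
- by move=> k; rewrite -[X in measurable X]setTI; exact: measurable_cV_cons.
- apply/trivIsetP => /= i j _ _ ij; rewrite -preimage_setI.
  by move/trivIsetP : tF => /(_ _ _ _ _ ij) ->//; rewrite preimage_set0.
- rewrite -preimage_bigcup -[X in measurable X]setTI.
  exact: measurable_cV_cons.
Qed.

HB.instance Definition _ := isMeasure.Build _ _ _
  lebesgue_cV_step step0 step_ge0 step_sigma_additive.

Let step_sigma_finite : sigma_finite setT lebesgue_cV_step.
Proof.
have /sigma_finiteP[F [FT ndF Foo]] := sigma_finiteT (@lebesgue_measure R).
have /sigma_finiteP[G [GT ndG Goo]] := sigma_finiteT mu.
exists (fun k => cV_uncons @^-1` (F k `*` G k)).
  apply/esym/seteqP; split=> // x _.
  have : [set: measurableTypeR R] (cV_uncons x).1 by [].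
  rewrite FT => -[i _ Fi].
  have : [set: 'cV[R]_n] (cV_uncons x).2 by [].
  rewrite GT => -[j _ Gj].
  exists (maxn i j) => //; split.
  - by move: Fi; exact/subsetPset/ndF/leq_maxl.
  - by move: Gj; exact/subsetPset/ndG/leq_maxr.
move=> k; have [mF Fk] := Foo k; have [mG Gk] := Goo k; split.
  rewrite -[X in measurable X]setTI; apply: measurable_cV_uncons => //.
  exact: measurableX.
rewrite /lebesgue_cV_step /pushforward -comp_preimage.
rewrite (_ : cV_uncons \o cV_cons = id); last first.
  by apply/funext => p /=; rewrite cV_consK.
by rewrite preimage_id product_measure1E// lte_mul_pinfty// ge0_fin_numE.
Qed.

HB.instance Definition _ := Measure_isSigmaFinite.Build _ _ _
  lebesgue_cV_step step_sigma_finite.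

End push.

(** [lebesgue_cV n] is Lebesgue measure on R^n: the unit mass on the one-point
    space R^0, and the image of the product of Lebesgue measure on R with that
    on R^n under (t, x) |-> (t, x_0, ..., x_{n-1}) on R^(n+1). *)
Fixpoint lebesgue_cV (n : nat) : {sigma_finite_measure set 'cV[R]_n -> \bar R} :=
  match n return {sigma_finite_measure set 'cV[R]_n -> \bar R} with
  | 0 => [the sigma_finite_measure _ _ of dirac (0 : 'cV[R]_0)]
  | m.+1 => [the sigma_finite_measure _ _ of lebesgue_cV_step (lebesgue_cV m)]
  end.

Lemma lebesgue_cV_box n (a b : 'I_n -> R) : (forall i, a i <= b i) ->
  lebesgue_cV n [set x : 'cV[R]_n | forall i, x i 0 \in `[a i, b i]] =
  (\prod_(i < n) (b i - a i))%:E.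
Proof.
elim: n a b => [|n IHn] a b ab.
  by rewrite /= diracE mem_set ?big_ord0// => -[].
rewrite /= /lebesgue_cV_step /pushforward.
set B := [set x : 'cV[R]_n | forall i,
  x i 0 \in `[a (lift ord0 i), b (lift ord0 i)]].
have mB : measurable B.
  rewrite (_ : B = \bigcap_(i in [set: 'I_n])
      (cV_coord i @^-1` `[a (lift ord0 i), b (lift ord0 i)])); last first.
    by apply/seteqP; split=> x /= Bx i; [move=> _|]; exact: Bx.
  apply: fin_bigcap_measurable => // i _.
  rewrite -[X in measurable X]setTI.
  exact: (measurable_cV_coord i measurableT (measurable_itv _)).
rewrite (_ : _ @^-1` _ = `[a ord0, b ord0] `*` B); last first.
  apply/seteqP; split=> [p px|p [/= p1 p2] i]; first split => /=.
  - by have := px ord0; rewrite cV_consE0.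
  - by move=> i; have := px (lift ord0 i); rewrite cV_consES.
  - case: (unliftP ord0 i) => [j ->|->]; first by rewrite cV_consES; exact: p2.
    by rewrite cV_consE0.
rewrite product_measure1E//.
transitivity ((b ord0 - a ord0)%:E * lebesgue_cV n B)%E.
  congr (_ * _)%E; rewrite [LHS]lebesgue_measure_itv /= lte_fin EFinB.
  by case: ltgtP (ab ord0) => // -> _; rewrite subee.
rewrite big_ord_recl EFinM; congr (_ * _)%E.
by apply: (IHn (a \o lift ord0) (b \o lift ord0)) => i; exact: ab.
Qed.

End lebesgue_cV.

Definition dotp {R : realType} {n : nat} (x y : 'cV[R]_n) : R :=
  \sum_(i < n) x i 0 * y i 0.

(** * Lattices and expansive matrices *)

Section lattices.
Context {R : realType} {n : nat}.

Definition full_rank_lattice (G : set 'cV[R]_n) : Prop :=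
  exists2 P : 'M[R]_n, P \in unitmx &
    G = [set P *m map_mx intr m | m in [set: 'cV[int]_n]].

Definition dual_lattice (G : set 'cV[R]_n) : set 'cV[R]_n :=
  [set k | forall g, G g -> dotp k g \is a Num.int].

(** The eigenvalues of a real matrix are its complex ones. *)
Definition expansive (A : 'M[R]_n) : Prop :=
  forall l : R[i], eigenvalue (map_mx (real_complex R) A) l -> 1 < `|l|.

Definition strictly_expansive (A : 'M[R]_n) (G : set 'cV[R]_n) : Prop :=
  expansive A /\
  exists K : set 'cV[R]_n,
    [/\ compact K,
        {ae lebesgue_cV n, forall x,
          (\esum_(k in dual_lattice G) (\1_K (x + k) : R)%:E = 1)%E} &
        K `<=` [set A^T *m y | y in K^°]].

End lattices.

(** * The Hilbert space L^2(R^n) of complex-valued functions *)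

(** An element of L^2(R^n) is represented by any of the Borel functions in its
    class, and a subset of L^2(R^n) by a set of functions; the sets considered
    below are stable under a.e. equality, since [L2closure] is. *)

Section L2.
Context {R : realType} {n : nat}.
Local Notation C := R[i].
Local Notation mu := (lebesgue_cV n).
Implicit Types (f g : 'cV[R]_n -> C) (V : set ('cV[R]_n -> C)).

Definition cintegral f : C :=
  (\int[mu]_x complex.Re (f x)) +i* (\int[mu]_x complex.Im (f x)).

Definition cmeasurable f : Prop :=
  measurable_fun setT (fun x => complex.Re (f x)) /\
  measurable_fun setT (fun x => complex.Im (f x)).

Definition L2norm f : \bar R := 'N[mu]_2%:E[EFin \o (normc \o f)]%E.

Definition L2 : set ('cV[R]_n -> C) :=
  [set f | cmeasurable f /\ (L2norm f < +oo)%E].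

Definition L2dot f g : C := cintegral (fun x => f x * (g x)^*).

Definition L2closure V : set ('cV[R]_n -> C) :=
  [set f | L2 f /\ forall e : R, 0 < e ->
    exists2 g, V g & (L2norm (fun x => f x - g x)%R < e%:E)%E].

Record closed_subspace V : Prop := {
  closed_subspace_L2 : V `<=` L2 ;
  closed_subspace0 : V (cst 0) ;
  closed_subspaceP : forall (a : C) f g,
    V f -> V g -> V (fun x => a * f x + g x) ;
  closed_subspace_closed : L2closure V `<=` V }.

Definition lspan (I : Type) (D : set I) (e : I -> 'cV[R]_n -> C) :
    set ('cV[R]_n -> C) :=
  [set f | exists m (s : 'I_m -> I) (c : 'I_m -> C),
    (forall i, D (s i)) /\ f = (fun x => \sum_(i < m) c i * e (s i) x)].

Definition orthonormal_basis (I : eqType) (D : set I)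
    (e : I -> 'cV[R]_n -> C) V : Prop :=
  [/\ forall i, D i -> V (e i),
      forall i j, D i -> D j -> L2dot (e i) (e j) = (i == j)%:R &
      V `<=` L2closure (lspan D e)].

Definition translate (y : 'cV[R]_n) f : 'cV[R]_n -> C := fun x => f (x - y).

End L2.

(** * Multiresolution analyses of multiplicity 1 *)

Section MRA.
Context {R : realType} {n : nat}.
Local Notation fn := ('cV[R]_n.+1 -> R[i]).

Definition scaling_function (G : set 'cV[R]_n.+1) (V0 : set fn) (phi : fn) :=
  V0 phi /\ orthonormal_basis G (fun y => translate y phi) V0.

Record MRA (A : 'M[R]_n.+1) (G : set 'cV[R]_n.+1) (V : int -> set fn) :
    Prop := {
  MRA_closed_subspace : forall j, closed_subspace (V j) ;
  MRA_nested : forall j, V j `<=` V (j + 1) ;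
  MRA_bigcap : \bigcap_j V j =
    [set f | L2 f /\ {ae lebesgue_cV n.+1, forall x, f x = 0}] ;
  MRA_bigcup : L2closure (\bigcup_j V j) = L2 ;
  MRA_dilation : forall (j : int) f,
    L2 f -> (V 0 f <-> V j (fun x => f (A ^ j *m x))) ;
  MRA_scaling_function : exists phi, scaling_function G (V 0) phi }.

End MRA.

(** * Smooth and Schwartz functions, Fourier transform *)

Section smooth.
Context {R : realType} {n : nat}.

Definition partials (s : seq 'I_n) (f : 'cV[R]_n -> R) : 'cV[R]_n -> R :=
  foldr (fun i g => 'D_(delta_mx i 0) g) f s.

(** [derive] is a total operator: the existence of the partial derivatives has
    to be required separately. *)
Definition smooth (f : 'cV[R]_n -> R) : Prop :=
  forall s : seq 'I_n, continuous (partials s f) /\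
    forall i x, derivable (partials s f) x (delta_mx i 0).

Definition csmooth (f : 'cV[R]_n -> R[i]) : Prop :=
  smooth (fun x => complex.Re (f x)) /\ smooth (fun x => complex.Im (f x)).

Definition cpartials (s : seq 'I_n) (f : 'cV[R]_n -> R[i]) (x : 'cV[R]_n) :
    R[i] :=
  partials s (fun x => complex.Re (f x)) x +i*
  partials s (fun x => complex.Im (f x)) x.

Definition schwartz (f : 'cV[R]_n -> R[i]) : Prop :=
  csmooth f /\
  forall (a : 'I_n -> nat) (s : seq 'I_n), exists M : R, forall x : 'cV[R]_n,
    `|\prod_(i < n) x i 0 ^+ a i| * normc (cpartials s f x) <= M.

Definition compactly_supported (f : 'cV[R]_n -> R[i]) : Prop :=
  compact (closure [set x | f x != 0]).

Definition cexpi (t : R) : R[i] := cos t +i* sin t.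

Definition fourier (f : 'cV[R]_n -> R[i]) (xi : 'cV[R]_n) : R[i] :=
  cintegral (fun x => f x * cexpi (- (2 * pi * dotp x xi))).

End smooth.

(* Main.v *)
Require Import Defs.
From mathcomp Require Import all_boot all_order all_algebra.
From mathcomp Require Import all_classical all_reals all_analysis.
From mathcomp Require Import measurable_realfun complex.
From mathcomp Require Import ring lra zify.

(** Let [L] be the dual lattice and [B = A^T]. Strict expansiveness gives a
    compact tile [K] for [L] with [K] inside [B K^°], hence a smooth function
    [Phi] with compact support such that [Phi ^+ 2] has periodization [1], which
    equals [1] on a set [V] avoiding the other translates of its support,
    and such that [Phi (B x) != 0] only for [x] in [V]. The scaling function is
    the inverse Fourier transform of a multiple of [Phi]: its translates are
    orthonormal because [Phi ^+ 2] is a partition of unity, and their closed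
    span [V0] contains the inverse Fourier transform of every smooth function
    supported in [V], by approximation of its periodization by trigonometric
    polynomials. In particular [V0] contains the functions
    [x |-> phi (A^-1 x - g)], whose Fourier transforms live on [B^-1 supp Phi],
    so that the dilates of [V0] are nested. Their union is dense because [V]
    contains a neighbourhood of [0], and their intersection is trivial because
    [|f|^2 <= c |f|_2^2] pointwise on [V0].

    No determinant and no normalisation constant of the Fourier transform is
    computed: [lscale M] and [fconst] are the constants in the linear change of
    variables and in the inversion formula. *)

Set Implicit Arguments.
Unset Strict Implicit.
Unset Printing Implicit Defensive.
Import Order.TTheory GRing.Theory Num.Theory.
Import numFieldNormedType.Exports.

Local Open Scope classical_set_scope.
Local Open Scope ring_scope.

Local Notation Re := complex.Re.
Local Notation Im := complex.Im.
Local Notation normc := (@Normc.normc _).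

(** * Lebesgue measure and linear maps *)

Section borel.
Context {R : realType}.

(** The matrix [A] need not map the lattice into itself, so a two-scale equation for the scaling
    function alone would not nest the dilates: each translate of the dilated function has to be
    treated. A translation only multiplies the Fourier transform by a character and keeps its
    support, so a criterion on supports settles all translates at once. The criterion holds because
    a smooth function supported in [V] is [Phi] times its own periodization: [Phi] is 1 on [V], and
    the nontrivial translates of [V] miss the support of [Phi]. The tiling condition holds only
    almost everywhere, so [K] may contain points interior to another of its translates. A symbol
    positive on all of [K] could then fail to be 1 well inside [K]; this is why [core] discards such
    points. The Fourier transform is only ever applied to integrals against test functions. [V0] is
    a closed span of functions of the space variable, and membership in it is proved for smooth
    functions and then passed to the closure, without extending the transform to L^2. *)

Definition box n (a b : 'I_n -> R) : set 'cV[R]_n :=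
  [set x | forall i, x i 0 \in `[a i, b i]].

Lemma measurable_box n (a b : 'I_n -> R) : measurable (box a b).
Proof.
rewrite (_ : box a b = \bigcap_(i in [set: 'I_n])
    (cV_coord i @^-1` `[a i, b i])); last first.
  by apply/seteqP; split=> x /= Bx i; [move=> _|]; exact: Bx.
apply: fin_bigcap_measurable => // i _.
rewrite -[X in measurable X]setTI.
exact: (measurable_cV_coord i measurableT (measurable_itv _)).
Qed.

Lemma measurable_coord n (i : 'I_n) :
  measurable_fun [set: 'cV[R]_n] (fun x => x i 0).
Proof. exact: measurable_cV_coord. Qed.

(** Empty boxes, with [b i < a i] for some [i], are allowed, which makes the family closed under
    intersection: it is the pi-system used for uniqueness of measures and for Dynkin's argument. *)
Definition boxes n : set (set 'cV[R]_n) := [set A | exists a b, A = box a b].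

Lemma setI_closed_boxes n : setI_closed (@boxes n).
Proof.
move=> _ _ [a [b ->]] [a' [b' ->]].
exists (fun i => Num.max (a i) (a' i)), (fun i => Num.min (b i) (b' i)).
apply/seteqP; split=> x /=.
- by move=> [xa xb] i; move: (xa i) (xb i);
    rewrite !in_itv/= ge_max le_min => /andP[H1 H2] /andP[H3 H4];
    rewrite H1 H2 H3 H4.
- by move=> xab; split=> i; move: (xab i);
    rewrite !in_itv/= ge_max le_min => /andP[/andP[H1 H2] /andP[H3 H4]];
    rewrite ?H1 ?H2 ?H3 ?H4.
Qed.

Lemma mx_norm_coord m n (x : 'M[R]_(m, n)) i j : `|x i j| <= `|x|.
Proof.
rewrite [leRHS]/Num.norm/= mx_normrE.
exact: (le_bigmax _ (fun ij : 'I_m * 'I_n => `|x ij.1 ij.2|) (i, j)).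
Qed.

Lemma cV_norm_le n (x : 'cV[R]_n) (e : R) : 0 <= e ->
  (forall i, `|x i 0| <= e) -> `|x| <= e.
Proof.
move=> e0 xe; rewrite [leLHS]/Num.norm/= mx_normrE.
by apply: bigmax_le => // -[i j] _ /=; rewrite ord1.
Qed.

Lemma cV_norm_lt n (x : 'cV[R]_n) (e : R) : 0 < e ->
  (forall i, `|x i 0| < e) -> `|x| < e.
Proof.
move=> e0 xe; rewrite [ltLHS]/Num.norm/= mx_normrE.
by apply: bigmax_lt => // -[i j] _ /=; rewrite ord1.
Qed.

Lemma measurable_boxesE n : measurable = <<s @boxes n >>.
Proof.
apply/seteqP; split; last first.
  apply: smallest_sub; first exact: sigma_algebra_measurable.
  by move=> _ [a [b ->]]; exact: measurable_box.
apply: smallest_sub; first exact: smallest_sigma_algebra.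
move=> A /=; rewrite -bigcup_seq => -[i _ [Y mY <-]]; rewrite setTI.
suff : (@ocitv R).-sigma.-measurable `<=`
    [set Y | <<s @boxes n >> (cV_coord i @^-1` Y)] by exact.
rewrite RGenCInfty.measurableE.
have sB := smallest_sigma_algebra [set: 'cV[R]_n] (@boxes n).
apply: smallest_sub.
  split=> /=; first by rewrite preimage_set0; case: sB.
  - by move=> B; rewrite setTD preimage_setC -setTD; case: sB => _ + _; exact.
  - by move=> F mF; rewrite preimage_bigcup; case: sB => _ _; exact.
move=> _ [x ->] /=.
(* The half-space [x <= y i 0] is exhausted by growing cubes whose lower bound in direction [i] is
   replaced by [x]. *)
rewrite (_ : _ @^-1` _ = \bigcup_k
    box (fun j => if j == i then x else - k%:R) (fun=> k%:R)).
  case: sB => _ _; apply => k; apply: sub_sigma_algebra; eexists; eexists.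
  by [].
apply/seteqP; split=> [y|y [k _ yk]] /=; rewrite in_itv/= andbT.
  move=> xy; exists (Num.truncn `|y|).+1 => //= j; rewrite in_itv/=.
  have := mx_norm_coord y j 0; have := truncnS_gt `|y|.
  move=> H1 H2; have {H1 H2} := le_lt_trans H2 H1.
  rewrite ltr_norml => /andP[H1 H2]; rewrite (ltW H2) andbT.
  by case: eqP => [->//|_]; exact: ltW.
by have := yk i; rewrite eqxx in_itv/= => /andP[].
Qed.

(** The sigma-algebra is generated by the coordinates, not by the open sets. So [f] is written as
    the limit of [f \o D k], where [D k] rounds each coordinate down to a multiple of [1/(k+1)] and
    takes countably many values, each on a product of half-open intervals. *)
Lemma measurable_fun_continuous n (f : 'cV[R]_n -> R) :
  continuous f -> measurable_fun setT f.
Proof.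
move=> cf.
pose D (k : nat) (x : 'cV[R]_n) : 'cV[R]_n :=
  \col_i ((Num.floor (x i 0 * k.+1%:R))%:~R / k.+1%:R).
have Dx k x : `|x - D k x| <= k.+1%:R^-1.
  apply: cV_norm_le => [|i]; first by rewrite invr_ge0.
  rewrite !mxE -[x in x - _](@mulfK _ k.+1%:R) ?pnatr_eq0// -mulrBl normrM.
  rewrite (@ger0_norm _ k.+1%:R^-1) ?invr_ge0// ler_piMl ?invr_ge0//.
  have /andP[H1 H2] := floor_itv (x i 0 * k.+1%:R).
  rewrite ger0_norm ?subr_ge0// lerBlDl ltW//.
  by move: H2; rewrite intrD.
apply: (@measurable_fun_cvg _ _ _ _ (fun k => f \o D k)) => [k|x _].
  move=> _ Y mY; rewrite setTI.
  have -> : (f \o D k) @^-1` Y = \bigcup_(m in [set: 'cV[int]_n])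
     [set x : 'cV[R]_n | (forall i, Num.floor (x i 0 * k.+1%:R) = m i 0) /\
              Y (f (\col_i ((m i 0)%:~R / k.+1%:R)))].
    apply/seteqP; split=> [x /= Yx|x [m _ [/= xm Yx]]].
      exists (\col_i Num.floor (x i 0 * k.+1%:R)) => //=; split=> [i|].
        by rewrite mxE.
      rewrite (_ : \col_i _ = D k x)//.
      by apply/matrixP => i j; rewrite !mxE.
    rewrite /= (_ : D k x = \col_i ((m i 0)%:~R / k.+1%:R))//.
    by apply/matrixP => i j; rewrite !mxE xm.
  apply: countable_bigcupT_measurable => // m.
  have [Ym|nYm] := pselect (Y (f (\col_i ((m i 0)%:~R / k.+1%:R)))); last first.
    by rewrite (_ : mkset _ = set0)//; apply/seteqP; split=> x //= [].
  rewrite (_ : mkset _ = \bigcap_(i in [set: 'I_n])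
    ((fun x : 'cV[R]_n => x i 0 * k.+1%:R) @^-1`
       `[(m i 0)%:~R, (m i 0 + 1)%:~R[)); last first.
    apply/seteqP; split=> x /=.
      by move=> [xm _] i _ /=; rewrite in_itv/= -xm; exact: floor_itv.
    move=> H; split=> // i; apply: floor_def.
    by have := H i Logic.I; rewrite /= in_itv.
  apply: fin_bigcap_measurable => // i _; rewrite -[X in measurable X]setTI.
  apply: (measurable_funM (measurable_coord i) (measurable_cst _)) => //.
apply: (continuous_cvg _ (cf x)).
apply/cvgrPdist_le => e e0; near=> k.
apply: le_trans (Dx k x) _; near: k.
by apply: filterS (near_infty_natSinv_lt (PosNum e0)) => j /ltW.
Unshelve. all: by end_near. Qed.


Lemma measurable_fun_mulmx n p (M : 'M[R]_(n, p)) :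
  measurable_fun [set: 'cV[R]_p] (fun x => M *m x).
Proof.
apply: measurable_fun_cVP => i; under eq_fun do rewrite mxE.
apply: measurable_sum => j; apply: measurable_funM => //.
exact: measurable_coord.
Qed.

Lemma measurable_fun_addcV d (T : measurableType d) n (f g : T -> 'cV[R]_n) :
  measurable_fun setT f -> measurable_fun setT g ->
  measurable_fun setT (fun x => f x + g x).
Proof.
move=> mf mg; apply: measurable_fun_cVP => i; under eq_fun do rewrite mxE.
by apply: measurable_funD; exact: (measurableT_comp (measurable_coord i)).
Qed.

Lemma measurable_fun_oppcV d (T : measurableType d) n (f : T -> 'cV[R]_n) :
  measurable_fun setT f -> measurable_fun setT (fun x => - f x).
Proof.
move=> mf; apply: measurable_fun_cVP => i; under eq_fun do rewrite mxE.
by apply: measurable_funN; exact: (measurableT_comp (measurable_coord i)).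
Qed.

Local Notation mu := (lebesgue_cV _).

Lemma lebesgue_box_lty n (a b : 'I_n -> R) : (lebesgue_cV n (box a b) < +oo)%E.
Proof.
have [ab|ab] := pselect (forall i, a i <= b i).
  by rewrite (lebesgue_cV_box ab) ltry.
move/existsNP: ab => [i /negP]; rewrite -ltNge => ba.
  rewrite (_ : box a b = set0) ?measure0//.
apply/seteqP; split=> x //= /(_ i); rewrite in_itv/= => /andP[ax xb].
by have := lt_le_trans ba (le_trans ax xb); rewrite ltxx.
Qed.

(** Both measures agree on boxes, which have finite measure, generate the sigma-algebra and exhaust
    the space. *)
Lemma lebesgue_transl n (v : 'cV[R]_n) (A : set 'cV[R]_n) : measurable A ->
  lebesgue_cV n ((fun x => x + v) @^-1` A) = lebesgue_cV n A.
Proof.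
move=> mA.
have mv : measurable_fun [set: 'cV[R]_n] (fun x => x + v).
  by apply: measurable_fun_addcV => //; exact: measurable_id.
pose nu : {measure set 'cV[R]_n -> \bar R} :=
  measure_function_pushforward__canonical__measure_function_Measure
    (lebesgue_cV n) mv.
apply/esym/(@measure_unique _ _ _ (@boxes n)
  (fun k => box (fun=> - k%:R) (fun=> k%:R)) _ _ _ _ _ nu) => //.
- exact: measurable_boxesE.
- exact: setI_closed_boxes.
- by move=> k; eexists; eexists.
- apply/seteqP; split=> // y _; exists (Num.truncn `|y|).+1 => //= j.
  rewrite in_itv/= -ler_norml.
  by apply/ltW; apply: le_lt_trans (truncnS_gt `|y|); exact: mx_norm_coord.
- move=> _ [a [b ->]]; rewrite /nu/= /pushforward.
  rewrite (_ : _ @^-1` _ = box (fun i => a i - v i 0) (fun i => b i - v i 0)).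
    have [ab|ab] := pselect (forall i, a i <= b i).
      rewrite (lebesgue_cV_box ab) lebesgue_cV_box => [|i]; last exact: lerB.
      by congr EFin; apply: eq_bigr => i _; rewrite opprB addrA subrK.
    move/existsNP: ab => [i /negP]; rewrite -ltNge => ba.
  rewrite (_ : box a b = set0) ?measure0//.
      rewrite (_ : box _ _ = set0) ?measure0//.
      apply/seteqP; split=> x //= /(_ i); rewrite in_itv/= => /andP[ax xb].
      by have := le_trans ax xb; rewrite lerD2r leNgt ba.
    apply/seteqP; split=> x //= /(_ i); rewrite in_itv/= => /andP[ax xb].
    by have := lt_le_trans ba (le_trans ax xb); rewrite ltxx.
  by apply/seteqP; split=> x /= xab i; move: (xab i);
    rewrite !in_itv/= ?mxE lerBlDr lerBrDr.
- by move=> k; exact: lebesgue_box_lty.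
Qed.

Lemma ge0_integral_transl n (v : 'cV[R]_n) (f : 'cV[R]_n -> \bar R) :
  measurable_fun setT f -> (forall x, 0 <= f x)%E ->
  (\int[lebesgue_cV n]_x f (x + v)%R = \int[lebesgue_cV n]_x f x)%E.
Proof.
move=> mf f0.
have mv : measurable_fun [set: 'cV[R]_n] (fun x => x + v).
  by apply: measurable_fun_addcV => //; exact: measurable_id.
rewrite -[LHS]/(\int[_]_(x in (fun x => x + v)%R @^-1` setT)
  (f \o (fun x => x + v)%R) x)%E.
rewrite -(ge0_integral_pushforward mv)//.
pose nu : {measure set 'cV[R]_n -> \bar R} :=
  measure_function_pushforward__canonical__measure_function_Measure
    (lebesgue_cV n) mv.
apply: (@eq_measure_integral _ _ _ _ (lebesgue_cV n) nu) => A mA _.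
exact: lebesgue_transl.
Qed.

Lemma mulmx_bound m n (M : 'M[R]_(m, n)) :
  exists2 C : R, 0 < C & forall x : 'cV[R]_n, `|M *m x| <= C * `|x|.
Proof.
exists (1 + \sum_i \sum_j `|M i j|).
  rewrite ltr_pwDl// sumr_ge0// => i _; exact: sumr_ge0.
have S0 : 0 <= \sum_i \sum_j `|M i j|.
  by rewrite sumr_ge0// => i _; exact: sumr_ge0.
move=> x; apply: cV_norm_le => [|i]; first by rewrite mulr_ge0// addr_ge0.
rewrite mxE; apply: (le_trans (ler_norm_sum _ _ _)).
apply: (@le_trans _ _ (\sum_j `|M i j| * `|x|)).
  by apply: ler_sum => j _; rewrite normrM ler_wpM2l//; exact: mx_norm_coord.
rewrite -mulr_suml ler_wpM2r// (bigD1 i)//= addrCA lerDl addr_ge0//.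
by rewrite sumr_ge0// => k _; exact: sumr_ge0.
Qed.

Section linear_change.
Variable n : nat.
Local Notation mu := (lebesgue_cV n).

(* Exchanging [f] and [g] by translation invariance and Tonelli is what makes
   the image of Lebesgue measure under [M] proportional to Lebesgue measure. *)
Lemma ge0_integral_linear_swap (M : 'M[R]_n) (f g : 'cV[R]_n -> \bar R) :
  M \in unitmx ->
  measurable_fun setT f -> measurable_fun setT g ->
  (forall x, 0 <= f x)%E -> (forall x, 0 <= g x)%E ->
  (\int[mu]_x f (M *m x)%R * \int[mu]_x g x =
   \int[mu]_x g (M *m x)%R * \int[mu]_x f (- x)%R)%E.
Proof.
move=> uM mf mg f0 g0.
have mM : measurable_fun setT (fun x : 'cV[R]_n => M *m x).
  exact: measurable_fun_mulmx.
have mN : measurable_fun setT (fun x : 'cV[R]_n => - x).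
  by apply: measurable_fun_oppcV; exact: measurable_id.
have m1 : measurable_fun setT (fun z : 'cV[R]_n * 'cV[R]_n => M *m z.1).
  exact: (measurableT_comp mM).
have mfM : measurable_fun setT (fun x : 'cV[R]_n => f (M *m x)).
  exact: (measurableT_comp mf).
have mgM : measurable_fun setT (fun x : 'cV[R]_n => g (M *m x)).
  exact: (measurableT_comp mg).
have mfN : measurable_fun setT (fun x : 'cV[R]_n => f (- x)).
  exact: (measurableT_comp mf).
rewrite -(ge0_integralZr _ _ _)//; last by apply: integral_ge0.
transitivity (\int[mu]_x \int[mu]_y (f (M *m x)%R * g (y + M *m x)%R))%E.
  apply: eq_integral => x _; rewrite ge0_integralZl//.
    by congr (_ * _)%E; rewrite ge0_integral_transl.
  by apply: (measurableT_comp mg); apply: measurable_fun_addcV.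
rewrite (@fubini_tonelli _ _ _ _ _ mu mu
    (fun z => f (M *m z.1)%R * g (z.2 + M *m z.1)%R)%E); last 2 first.
- apply: emeasurable_funM; first exact: (measurableT_comp mf).
  apply: (measurableT_comp mg); apply: measurable_fun_addcV => //.
- by move=> z; rewrite mule_ge0.
transitivity (\int[mu]_y \int[mu]_x (f (M *m x - y)%R * g (M *m x)%R))%E.
  apply: eq_integral => y _ /=.
  (* Shifting [x] by [invmx M *m y] moves the translation by [y] from [g] to [f]. *)
  rewrite -(@ge0_integral_transl _ (invmx M *m y)
     (fun x => f (M *m x - y)%R * g (M *m x)%R)%E); last 2 first.
  - apply: emeasurable_funM => //; apply: (measurableT_comp mf).
    by apply: measurable_fun_addcV.
  - by move=> x; rewrite mule_ge0.
  apply: eq_integral => x _; rewrite mulmxDr mulKVmx// addrK.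
  by rewrite addrC.
rewrite (@fubini_tonelli _ _ _ _ _ mu mu
    (fun z => f (M *m z.2 - z.1)%R * g (M *m z.2)%R)%E); last 2 first.
- apply: emeasurable_funM; last first.
    apply: (measurableT_comp mg); exact: (measurableT_comp mM).
  apply: (measurableT_comp mf); apply: measurable_fun_addcV.
    exact: (measurableT_comp mM).
  exact: measurable_fun_oppcV.
- by move=> z; rewrite mule_ge0.
rewrite -(ge0_integralZr _ _ _)//; last by apply: integral_ge0.
apply: eq_integral => x _ /=.
rewrite ge0_integralZr//; last first.
  apply: (measurableT_comp mf); apply: measurable_fun_addcV => //.
rewrite muleC; congr (_ * _)%E.
rewrite -(@ge0_integral_transl _ (- (M *m x)) (fun y => f (- y)))//.
by apply: eq_integral => y _; rewrite opprD opprK addrC.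
Qed.

Let Q : set 'cV[R]_n := box (fun=> 0) (fun=> 1).

Let muQ : mu Q = 1%E.
Proof. by rewrite lebesgue_cV_box// big1// => i _; rewrite subr0. Qed.

Let indicQ : (\int[mu]_x (\1_Q x)%:E = 1)%E.
Proof. by rewrite integral_indic ?setIT//; exact: measurable_box. Qed.

Let mindicQ : measurable_fun setT (fun x => (\1_Q x : R)%:E).
Proof. by apply/measurable_EFinP/measurable_indic; exact: measurable_box. Qed.

(** The exchange lemma for [M = 1], with [g] the indicator of the unit cube, whose integral is 1. *)
Lemma ge0_integral_opp (f : 'cV[R]_n -> \bar R) :
  measurable_fun setT f -> (forall x, 0 <= f x)%E ->
  (\int[mu]_x f (- x)%R = \int[mu]_x f x)%E.
Proof.
move=> mf f0.
have indicQ0 x : (0 <= (\1_Q x : R)%:E)%E by rewrite lee_fin.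
have := ge0_integral_linear_swap (unitmx1 _ _) mf mindicQ f0 indicQ0.
have E (h : 'cV[R]_n -> \bar R) :
    (\int[mu]_x h (1%:M *m x)%R = \int[mu]_x h x)%E.
  by apply: eq_integral => x _; rewrite mul1mx.
by rewrite (E f) (E (fun x => (\1_Q x)%:E)) indicQ mule1 mul1e => ->.
Qed.

(** The factor is the measure of the preimage of the unit cube. It is finite because this preimage
    lies in a box, and nonzero because otherwise the case of the constant 1 would make the whole
    space null. *)
Lemma ge0_integral_linear (M : 'M[R]_n) : M \in unitmx ->
  exists2 s : R, 0 < s & forall f : 'cV[R]_n -> \bar R,
    measurable_fun setT f -> (forall x, 0 <= f x)%E ->
    (\int[mu]_x f (M *m x)%R = s%:E * \int[mu]_x f x)%E.
Proof.
move=> uM.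
have indicQ0 x : (0 <= (\1_Q x : R)%:E)%E by rewrite lee_fin.
pose J := (\int[mu]_x (\1_Q (M *m x)%R : R)%:E)%E.
have swap f : measurable_fun setT f -> (forall x, 0 <= f x)%E ->
    (\int[mu]_x f (M *m x)%R = J * \int[mu]_x f x)%E.
  move=> mf f0; have := ge0_integral_linear_swap uM mf mindicQ f0 indicQ0.
  by rewrite indicQ mule1 ge0_integral_opp.
have J0 : (0 <= J)%E by apply: integral_ge0.
have Jy : (J < +oo)%E.
  have [C C0 HC] := mulmx_bound (invmx M).
  apply: (@le_lt_trans _ _ (mu (box (fun=> - C) (fun=> C)))); last first.
    exact: lebesgue_box_lty.
  have mMQ : measurable ((fun x : 'cV[R]_n => M *m x) @^-1` Q).
    rewrite -[X in measurable X]setTI.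
    by apply: measurable_fun_mulmx => //; exact: measurable_box.
  rewrite (_ : J = mu ((fun x : 'cV[R]_n => M *m x) @^-1` Q)); last first.
    transitivity (\int[mu]_x (\1_((fun x => M *m x) @^-1` Q) x : R)%:E)%E.
      apply: eq_integral => x _; rewrite !indicE; congr ((nat_of_bool _)%:R%:E).
    by rewrite integral_indic// setIT.
  apply: le_measure; rewrite ?inE//; first exact: measurable_box.
  move=> x /= Qx i; rewrite in_itv/= -ler_norml.
  apply: le_trans (mx_norm_coord _ _ _) _.
  rewrite -[x](mulKmx uM); apply: le_trans (HC _) _.
  rewrite ler_piMr ?(ltW C0)//; apply: cV_norm_le => // j.
  have := Qx j; rewrite in_itv/= => /andP[H1 H2].
  by rewrite ger0_norm.
exists (fine J); last first.
  by move=> f mf f0; rewrite swap// fineK// ge0_fin_numE.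
rewrite fine_gt0// Jy andbT lt_def J0 andbT; apply/eqP => J0'.
have := swap (fun=> 1%E) (measurable_cst _) (fun=> lee01).
rewrite J0' mul0e integral_cst// mul1e => muT.
have : (mu Q <= mu setT)%E.
  by apply: le_measure; rewrite ?inE//; exact: measurable_box.
by rewrite muQ muT leNgt lte01.
Qed.

End linear_change.

Lemma ball_box n (x : 'cV[R]_n) (e : R) : 0 <= e ->
  box (fun i => x i 0 - e) (fun i => x i 0 + e) = [set y | `|x - y| <= e].
Proof.
move=> e0; apply/seteqP; split=> y /= xy.
  apply: cV_norm_le => // i; have := xy i.
  by rewrite !mxE in_itv/= ler_distlC.
move=> i; rewrite in_itv/= -ler_distlC.
by have := mx_norm_coord (x - y) i 0; rewrite !mxE => /le_trans; apply.
Qed.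

Lemma ball_not_negligible n (x : 'cV[R]_n) (e : R) : 0 < e ->
  ~ (lebesgue_cV n).-negligible (ball x e).
Proof.
move=> e0 [A [mA A0 xA]].
pose b := box (fun i => x i 0 - e / 2) (fun i => x i 0 + e / 2).
have bA : b `<=` A.
  rewrite /b ball_box ?divr_ge0 ?ltW// => y /= xy; apply: xA.
  rewrite -ball_normE /=; apply: le_lt_trans xy _.
  by rewrite ltr_pdivrMr// ltr_pMr// ltr1n.
have : (lebesgue_cV n b <= lebesgue_cV n A)%E.
  by apply: le_measure; rewrite ?inE//; exact: measurable_box.
rewrite A0 lebesgue_cV_box => [|i]; last first.
  by rewrite lerD2l ge0_cp// divr_ge0// ltW.
apply/negP; rewrite -ltNge lte_fin prodr_gt0// => i _.
by rewrite opprD opprK addrACA subrr add0r -splitr.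
Qed.

End borel.

(** * Complex numbers, the exponential and the inner product *)

Section complex_arith.
Context {R : rcfType}.
Implicit Types z w : R[i].

Lemma cReD z w : Re (z + w) = Re z + Re w. Proof. by case: z; case: w. Qed.
Lemma cImD z w : Im (z + w) = Im z + Im w. Proof. by case: z; case: w. Qed.
Lemma cReB z w : Re (z - w) = Re z - Re w. Proof. by case: z; case: w. Qed.
Lemma cImB z w : Im (z - w) = Im z - Im w. Proof. by case: z; case: w. Qed.
Lemma cReM z w : Re (z * w) = Re z * Re w - Im z * Im w.
Proof. by case: z; case: w. Qed.
Lemma cImM z w : Im (z * w) = Re z * Im w + Im z * Re w.
Proof. by case: z; case: w. Qed.
Lemma cReJ z : Re (z^*) = Re z. Proof. by case: z. Qed.
Lemma cImJ z : Im (z^*) = - Im z. Proof. by case: z. Qed.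
Lemma cRe0 : Re (0 : R[i]) = 0. Proof. by []. Qed.
Lemma cIm0 : Im (0 : R[i]) = 0. Proof. by []. Qed.
Lemma cRe_sum I (s : seq I) (P : pred I) (F : I -> R[i]) :
  Re (\sum_(i <- s | P i) F i) = \sum_(i <- s | P i) Re (F i).
Proof. by rewrite (big_morph (@complex.Re R) cReD cRe0). Qed.

Lemma cIm_sum I (s : seq I) (P : pred I) (F : I -> R[i]) :
  Im (\sum_(i <- s | P i) F i) = \sum_(i <- s | P i) Im (F i).
Proof. by rewrite (big_morph (@complex.Im R) cImD cIm0). Qed.

Lemma complexP z w : Re z = Re w -> Im z = Im w -> z = w.
Proof. by case: z => a b; case: w => c d /= -> ->. Qed.

Lemma normc_sqr z : normc z ^+ 2 = Re z ^+ 2 + Im z ^+ 2.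
Proof. by case: z => a b; rewrite sqr_sqrtr// addr_ge0// sqr_ge0. Qed.

Lemma normc_ge0 z : 0 <= normc z.
Proof. by case: z => a b; exact: sqrtr_ge0. Qed.

Lemma le_Re_normc z : `|Re z| <= normc z.
Proof. by case: z => a b; rewrite -sqrtr_sqr ler_sqrt ?addr_ge0 ?sqr_ge0// lerDl sqr_ge0. Qed.

Lemma le_Im_normc z : `|Im z| <= normc z.
Proof. by case: z => a b; rewrite -sqrtr_sqr ler_sqrt ?addr_ge0 ?sqr_ge0// lerDr sqr_ge0. Qed.

Lemma normc_le_ReIm z : normc z <= `|Re z| + `|Im z|.
Proof.
rewrite -ler_sqr ?nnegrE ?normc_ge0 ?addr_ge0// normc_sqr.
rewrite sqrrD !real_normK ?num_real// -subr_ge0.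
rewrite (_ : _ - _ = (`|Re z| * `|Im z|) *+ 2); last by ring.
by rewrite mulrn_wge0// mulr_ge0.
Qed.

Lemma normc_real (x : R) : normc (x +i* 0)%C = `|x|.
Proof. by rewrite /= expr0n addr0 sqrtr_sqr. Qed.

Lemma mulJz z : z * z^* = (normc z ^+ 2 +i* 0)%C.
Proof.
by apply: complexP; rewrite ?cReM ?cImM cReJ cImJ ?normc_sqr/=; ring.
Qed.

Lemma normcJ z : normc (z^*) = normc z.
Proof. by case: z => a b /=; rewrite sqrrN. Qed.

Lemma normcM z w : normc (z * w) = normc z * normc w.
Proof. exact: Normc.normcM. Qed.

Lemma normcD z w : normc (z + w) <= normc z + normc w.
Proof. exact: le_normcD. Qed.

Lemma normc0_eq0 z : normc z = 0 -> z = 0.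
Proof. exact: Normc.eq0_normc. Qed.

Lemma normc0 : normc (0 : R[i]) = 0. Proof. exact: Normc.normc0. Qed.

Lemma normcN z : normc (- z) = normc z.
Proof. by case: z => a b /=; rewrite !sqrrN. Qed.

(* The parallelogram law, used instead of Minkowski's inequality. *)
Lemma normcD_sqr z w : normc (z + w) ^+ 2 <= 2 * normc z ^+ 2 + 2 * normc w ^+ 2.
Proof.
rewrite !normc_sqr cReD cImD -subr_ge0.
rewrite (_ : _ - _ = (Re z - Re w) ^+ 2 + (Im z - Im w) ^+ 2); last by ring.
by rewrite addr_ge0// sqr_ge0.
Qed.

End complex_arith.

Section cexpi.
Context {R : realType}.

Lemma cexpiD (a b : R) : cexpi (a + b) = cexpi a * cexpi b.
Proof.
by apply: complexP; rewrite ?cReM ?cImM/= ?cosD ?sinD//; ring.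
Qed.

Lemma cexpi0 : cexpi (0 : R) = 1.
Proof. by rewrite /cexpi cos0 sin0. Qed.

Lemma cexpiN (a : R) : cexpi (- a) = (cexpi a)^*.
Proof. by apply: complexP; rewrite ?cReJ ?cImJ/= ?cosN ?sinN. Qed.

Lemma normc_cexpi (a : R) : normc (cexpi a) = 1.
Proof. by rewrite /= cos2Dsin2 sqrtr1. Qed.

End cexpi.

Section dotp.
Context {R : realType} {n : nat}.
Implicit Types x y z : 'cV[R]_n.

Lemma dotpC x y : dotp x y = dotp y x.
Proof. by apply: eq_bigr => i _; rewrite mulrC. Qed.

Lemma dotpDl x y z : dotp (x + y) z = dotp x z + dotp y z.
Proof. by rewrite -big_split; apply: eq_bigr => i _; rewrite mxE mulrDl. Qed.

Lemma dotpDr x y z : dotp x (y + z) = dotp x y + dotp x z.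
Proof. by rewrite dotpC dotpDl !(dotpC _ x). Qed.

Lemma dotpZl a x y : dotp (a *: x) y = a * dotp x y.
Proof. by rewrite /dotp mulr_sumr; apply: eq_bigr => i _; rewrite mxE mulrA. Qed.

Lemma dotpZr a x y : dotp x (a *: y) = a * dotp x y.
Proof. by rewrite dotpC dotpZl dotpC. Qed.

Lemma dotpNl x y : dotp (- x) y = - dotp x y.
Proof. by rewrite -scaleN1r dotpZl mulN1r. Qed.

Lemma dotpNr x y : dotp x (- y) = - dotp x y.
Proof. by rewrite dotpC dotpNl dotpC. Qed.

Lemma dotpBl x y z : dotp (x - y) z = dotp x z - dotp y z.
Proof. by rewrite dotpDl dotpNl. Qed.

Lemma dotpBr x y z : dotp x (y - z) = dotp x y - dotp x z.
Proof. by rewrite dotpDr dotpNr. Qed.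

Lemma dotp0l x : dotp 0 x = 0.
Proof. by rewrite -(scale0r (0 : 'cV_n)) dotpZl mul0r. Qed.

Lemma dotp_delta x i : dotp x (delta_mx i 0) = x i 0.
Proof.
rewrite /dotp (bigD1 i)//= big1 ?addr0 => [|j ji].
  by rewrite mxE !eqxx mulr1.
by rewrite mxE (negbTE ji) mulr0.
Qed.

Lemma dotp_norm x y : `|dotp x y| <= n%:R * (`|x| * `|y|).
Proof.
apply: (le_trans (ler_norm_sum _ _ _)).
apply: (@le_trans _ _ (\sum_(i < n) `|x| * `|y|)).
  by apply: ler_sum => i _; rewrite normrM ler_pM//; exact: mx_norm_coord.
by rewrite sumr_const card_ord mulr_natl.
Qed.

Lemma continuous_dotpr x : continuous (dotp x).
Proof.
apply: continuous_big => [|i _ y]; first exact: add_continuous.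
apply: (@cvgM _ _ (nbhs y) _ (cst (x i 0)) (fun y : 'cV[R]_n => y i 0)).
  exact: cvg_cst.
exact: coord_continuous.
Qed.

Lemma continuous_dotpl x : continuous (fun y => dotp y x).
Proof. by under eq_fun do rewrite dotpC; exact: continuous_dotpr. Qed.

End dotp.

Lemma dotp_mulmx (R : realType) m n (M : 'M[R]_(m, n)) x y :
  dotp (M *m x) y = dotp x (M^T *m y).
Proof.
rewrite /dotp; under eq_bigr do rewrite mxE mulr_suml.
rewrite exchange_big; apply: eq_bigr => j _; rewrite mxE mulr_sumr.
by apply: eq_bigr => i _; rewrite mxE mulrCA mulrA.
Qed.

Section scale.
Context {R : realType} {n : nat}.
Local Notation mu := (lebesgue_cV n).

Local Notation scaleP M := [set s : R | 0 < s /\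
  forall f : 'cV[R]_n -> \bar R,
    measurable_fun setT f -> (forall x, 0 <= f x)%E ->
    (\int[mu]_x f (M *m x)%R = s%:E * \int[mu]_x f x)%E].

(** This is [1 / |det M|], accessible only through the change of variables that characterises it. *)
Definition lscale (M : 'M[R]_n) : R := get (scaleP M).

Let lscaleP M : M \in unitmx -> scaleP M (lscale M).
Proof.
move=> /ge0_integral_linear[s s0 sE].
by apply: (@getPex _ (scaleP M)); exists s.
Qed.

Lemma lscale_gt0 M : M \in unitmx -> 0 < lscale M.
Proof. by case/lscaleP. Qed.

Lemma ge0_integral_lscale M (f : 'cV[R]_n -> \bar R) : M \in unitmx ->
  measurable_fun setT f -> (forall x, 0 <= f x)%E ->
  (\int[mu]_x f (M *m x)%R = (lscale M)%:E * \int[mu]_x f x)%E.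
Proof. by case/lscaleP => _; apply. Qed.

Local Notation rint f := (mu.-integrable setT (EFin \o f)).

Lemma integrable_lscale M (f : 'cV[R]_n -> R) : M \in unitmx ->
  rint f -> rint (fun x => f (M *m x)).
Proof.
move=> uM /integrableP[mf foo]; apply/integrableP; split.
  exact: (measurableT_comp mf (measurable_fun_mulmx M)).
rewrite (ge0_integral_lscale (f := fun x => `|(f x)%:E|%E))//.
- by rewrite lte_mul_pinfty// lee_fin ltW// lscale_gt0.
- exact: measurableT_comp.
Qed.

Lemma Rintegral_lscale M (f : 'cV[R]_n -> R) : M \in unitmx ->
  rint f -> \int[mu]_x f (M *m x) = lscale M * \int[mu]_x f x.
Proof.
move=> uM intf; have mf := measurable_int _ intf.
have intfM := integrable_lscale uM intf.
rewrite /Rintegral integralE [in RHS]integralE.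
transitivity (fine (\int[mu]_x (EFin \o f)^\+%E (M *m x)%R -
                    \int[mu]_x (EFin \o f)^\-%E (M *m x)%R)%E).
  by congr (fine (_ - _)%E); apply: eq_integral => x _;
    rewrite ?(funepos_comp (EFin \o f) (mulmx M))
            ?(funeneg_comp (EFin \o f) (mulmx M)).
rewrite (ge0_integral_lscale (f := (EFin \o f)^\+)%E)//; last first.
  exact: measurable_funepos.
rewrite (ge0_integral_lscale (f := (EFin \o f)^\-)%E)//; last first.
  exact: measurable_funeneg.
have fp := integrable_pos_fin_num measurableT intf.
have fn := integrable_neg_fin_num measurableT intf.
move: fp fn; set a := (\int[mu]_x _)%E; set b := (\int[mu]_x _)%E.
by move: a b => [a||] [b||]//= _ _; rewrite mulrBr.
Qed.

Lemma integrable_transl v (f : 'cV[R]_n -> R) :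
  rint f -> rint (fun x => f (x + v)).
Proof.
have mv : measurable_fun [set: 'cV[R]_n] (fun x => x + v).
  by apply: measurable_fun_addcV => //; exact: measurable_id.
move=> /integrableP[mf foo]; apply/integrableP; split.
  exact: (measurableT_comp mf mv).
rewrite (ge0_integral_transl _ (f := fun x => `|(f x)%:E|%E))//.
exact: measurableT_comp.
Qed.

Lemma Rintegral_transl v (f : 'cV[R]_n -> R) :
  rint f -> \int[mu]_x f (x + v) = \int[mu]_x f x.
Proof.
move=> intf; have mf := measurable_int _ intf.
rewrite /Rintegral integralE [in RHS]integralE.
transitivity (fine (\int[mu]_x (EFin \o f)^\+%E (x + v)%R -
                    \int[mu]_x (EFin \o f)^\-%E (x + v)%R)%E).
  by congr (fine (_ - _)%E); apply: eq_integral => x _;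
    rewrite ?(funepos_comp (EFin \o f) (+%R^~ v))
            ?(funeneg_comp (EFin \o f) (+%R^~ v)).
rewrite (ge0_integral_transl _ (f := (EFin \o f)^\+)%E)//; last first.
  exact: measurable_funepos.
rewrite (ge0_integral_transl _ (f := (EFin \o f)^\-)%E)//.
exact: measurable_funeneg.
Qed.

Lemma lscale_inv M : M \in unitmx -> lscale M * lscale (invmx M) = 1.
Proof.
move=> uM; pose Q : set 'cV[R]_n := box (fun=> 0) (fun=> 1).
have mQ : measurable_fun setT (fun x => (\1_Q x : R)%:E).
  by apply/measurable_EFinP/measurable_indic; exact: measurable_box.
have iQ : (\int[mu]_x (\1_Q x)%:E = 1)%E.
  rewrite integral_indic ?setIT//; last exact: measurable_box.
  rewrite [LHS](@lebesgue_cV_box R n (fun=> 0) (fun=> 1) (fun=> ler01)).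
  by rewrite big1// => i _; rewrite subr0.
have uV : invmx M \in unitmx by rewrite unitmx_inv.
have mQV : measurable_fun setT (fun x => (\1_Q (invmx M *m x) : R)%:E).
  exact: (measurableT_comp mQ (measurable_fun_mulmx _)).
have Q0 x : (0 <= (\1_Q x : R)%:E)%E by rewrite lee_fin.
have := ge0_integral_lscale uM mQV (fun x => Q0 _).
rewrite (ge0_integral_lscale (f := fun x => (\1_Q x)%:E))// iQ mule1 -EFinM.
move=> H; apply/esym/EFin_inj; rewrite -H -iQ.
by apply: eq_integral => x _; rewrite mulKmx.
Qed.

End scale.

(** * Integration of complex-valued functions *)

Section real_integral.
Context d (T : measurableType d) (R : realType) (mu : {measure set T -> \bar R}).
Local Notation rint f := (mu.-integrable setT (EFin \o f)).
Implicit Types f g h : T -> R.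

Lemma rint_measurable f : rint f -> measurable_fun setT f.
Proof. by move=> /integrableP[/measurable_EFinP]. Qed.

Lemma rint_le f g : measurable_fun setT f -> rint g ->
  (forall x, `|f x| <= g x) -> rint f.
Proof.
move=> mf ig fg; apply: le_integrable ig => //; first exact/measurable_EFinP.
by move=> x _ /=; rewrite lee_fin (le_trans (fg x))// ler_norm.
Qed.

Lemma rintD f g : rint f -> rint g -> rint (fun x => f x + g x).
Proof.
move=> fi gi; rewrite (_ : _ \o _ = (EFin \o f) \+ (EFin \o g))%E//.
exact: integrableD.
Qed.

Lemma rintZ a f : rint f -> rint (fun x => a * f x).
Proof.
move=> fi; rewrite (_ : _ \o _ = (fun x => a%:E * (EFin \o f) x))%E//.
exact: integrableZl.
Qed.

Lemma rintN f : rint f -> rint (fun x => - f x).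
Proof. by move=> /(rintZ (-1)); under eq_fun do rewrite mulN1r. Qed.

Lemma rintB f g : rint f -> rint g -> rint (fun x => f x - g x).
Proof. by move=> fi /rintN; exact: rintD. Qed.

Lemma rint_norm f : rint f -> rint (fun x => `|f x|).
Proof. exact: integrable_norm. Qed.

Lemma rint_ge0P f : measurable_fun setT f -> (forall x, 0 <= f x) ->
  (\int[mu]_x (f x)%:E < +oo)%E -> rint f.
Proof.
move=> mf f0 foo; apply/integrableP; split; first exact/measurable_EFinP.
by under eq_integral do rewrite /= ger0_norm//.
Qed.

Lemma EFin_Rintegral f : rint f -> (\int[mu]_x f x)%:E = (\int[mu]_x (f x)%:E)%E.
Proof. by move=> fi; rewrite fineK//; exact: integrable_fin_num. Qed.

Lemma rint_dominated (f_ : nat -> T -> R) f g :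
  (forall k, measurable_fun setT (f_ k)) ->
  (forall x, f_ k x @[k --> \oo] --> f x) ->
  rint g -> (forall k x, `|f_ k x| <= g x) ->
  rint f /\ \int[mu]_x f_ k x @[k --> \oo] --> \int[mu]_x f x.
Proof.
move=> mf cf ig fg.
have mf' : measurable_fun setT f by apply: (measurable_fun_cvg mf) => x _.
have rf : rint f.
  apply: rint_le ig _ => // x.
  have : (`|f_ k x|) @[k --> \oo] --> `|f x| by apply: cvg_norm.
  move=> nf; rewrite -(cvg_lim _ nf)//; apply: limr_le; first by apply/cvg_ex; eexists; exact: nf.
  by apply: nearW => k; exact: fg.
split=> //; apply: fine_cvg; rewrite -/(Rintegral _ _ _) EFin_Rintegral//.
apply: (@dominated_cvg _ _ _ mu setT measurableT (fun k => EFin \o f_ k) _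
  (EFin \o g)) => //.
- by move=> k; exact/measurable_EFinP.
- by move=> x _; apply: cvg_EFin; [exact: nearW|exact: cf].
- by move=> k x _ /=; rewrite lee_fin.
Qed.

End real_integral.

Section real_fubini.
Context d1 d2 (T1 : measurableType d1) (T2 : measurableType d2) (R : realType).
Variables (m1 : {sigma_finite_measure set T1 -> \bar R}).
Variables (m2 : {sigma_finite_measure set T2 -> \bar R}).

(** The product majorant makes every section integrable, and not only almost every one, so that no
    exceptional sets appear in the iterated integrals. *)
Lemma Rintegral_fubini (k : T1 -> T2 -> R) (a : T1 -> R) (b : T2 -> R) :
  measurable_fun setT (fun z : T1 * T2 => k z.1 z.2) ->
  m1.-integrable setT (EFin \o a) -> m2.-integrable setT (EFin \o b) ->
  (forall x y, `|k x y| <= a x * b y) ->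
  [/\ m1.-integrable setT (EFin \o (fun x => \int[m2]_y k x y)),
      forall y, m1.-integrable setT (EFin \o k ^~ y) &
      \int[m1]_x \int[m2]_y k x y = \int[m2]_y \int[m1]_x k x y].
Proof.
move=> mk ia ib kab.
have mk1 x : measurable_fun setT (k x).
  exact: (measurableT_comp mk (measurable_pair1 x)).
have mk2 y : measurable_fun setT (k ^~ y).
  exact: (measurableT_comp mk (measurable_pair2 y)).
have ik1 x : m2.-integrable setT (EFin \o k x).
  by apply: rint_le (rintZ (a x) ib) _ => //.
have ik2 y : m1.-integrable setT (EFin \o k ^~ y).
  by apply: rint_le (rintZ (b y) ia) _ => // x; rewrite mulrC.
have ikk : (m1 \x m2)%E.-integrable setT (EFin \o (fun z => k z.1 z.2)).
  apply/integrable12ltyP; first exact/measurable_EFinP.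
  have ma := rint_measurable ia; have mb := rint_measurable ib.
  apply: (@le_lt_trans _ _ (\int[m1]_x \int[m2]_y (`|a x| * `|b y|)%:E)%E).
    apply: ge0_le_integral => //.
    - by move=> x _; apply: integral_ge0.
    - apply: (@measurable_fun_fubini_tonelli_F _ _ _ _ _ m2
        (fun z => `|(k z.1 z.2)%:E|)%E) => //.
      exact/measurable_EFinP/measurableT_comp.
    - apply: (@measurable_fun_fubini_tonelli_F _ _ _ _ _ m2
        (fun z => (`|a z.1| * `|b z.2|)%:E)) => //=.
      + apply/measurable_EFinP/measurable_funM.
          apply: measurableT_comp => //; exact: (measurableT_comp ma).
        apply: measurableT_comp => //; exact: (measurableT_comp mb).
    - move=> x _; apply: ge0_le_integral => //.
      + by apply: measurableT_comp => //; apply/measurable_EFinP; exact: mk1.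
      + apply/measurable_EFinP/measurable_funM => //.
        exact: measurableT_comp.
      + move=> y _; rewrite lee_fin (le_trans (kab x y))//.
        by rewrite -normrM ler_norm.
  have oo := integrable_fin_num measurableT (rint_norm ib).
  rewrite (eq_integral (fun x => `|a x|%:E * \int[m2]_y `|b y|%:E)%E).
    rewrite ge0_integralZr//=.
    - rewrite -[X in (_ * X)%E](fineK oo) lte_mul_pinfty//.
      + by apply: integral_ge0 => x _; rewrite lee_fin.
      + exact: (integrable_fin_num measurableT (rint_norm ia)).
      + exact: ltry.
    - exact/measurable_EFinP/measurableT_comp.
    - by apply: integral_ge0 => y _; rewrite lee_fin.
  move=> x _; rewrite -ge0_integralZl//.
  exact/measurable_EFinP/measurableT_comp.
split.
- rewrite (_ : _ \o _ = fubini_F m2 (EFin \o (fun z => k z.1 z.2))); last first.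
    by apply/funext => x /=; rewrite EFin_Rintegral.
  exact: integrable_fubini_F.
- exact: ik2.
- rewrite /Rintegral; congr fine.
  under eq_integral do rewrite -/(Rintegral _ _ _) EFin_Rintegral//.
  under [RHS]eq_integral do rewrite -/(Rintegral _ _ _) EFin_Rintegral//.
  exact: (Fubini ikk).
Qed.

End real_fubini.

Section complex_integral.
Context {R : realType} {n : nat}.
Local Notation mu := (lebesgue_cV n).
Local Notation rint f := (mu.-integrable setT (EFin \o f)).
Local Notation C := R[i].
Implicit Types (f g : 'cV[R]_n -> C).

Lemma cmeasurableD f g : cmeasurable f -> cmeasurable g ->
  cmeasurable (fun x => f x + g x).
Proof.
move=> [f1 f2] [g1 g2]; split.
  by under eq_fun do rewrite cReD; exact: measurable_funD.
by under eq_fun do rewrite cImD; exact: measurable_funD.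
Qed.

Lemma cmeasurableM f g : cmeasurable f -> cmeasurable g ->
  cmeasurable (fun x => f x * g x).
Proof.
move=> [f1 f2] [g1 g2]; split.
  under eq_fun do rewrite cReM.
  by apply: measurable_funB; exact: measurable_funM.
under eq_fun do rewrite cImM.
by apply: measurable_funD; exact: measurable_funM.
Qed.

Lemma cmeasurable_cst (a : C) : cmeasurable (fun _ : 'cV[R]_n => a).
Proof. by split; exact: measurable_cst. Qed.

Lemma cmeasurableZ a f : cmeasurable f -> cmeasurable (fun x => a * f x).
Proof. by move=> mf; apply: cmeasurableM => //; exact: cmeasurable_cst. Qed.

Lemma cmeasurableN f : cmeasurable f -> cmeasurable (fun x => - f x).
Proof.
by move=> /(cmeasurableZ (-1)); under eq_fun do rewrite mulN1r.
Qed.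

Lemma cmeasurableB f g : cmeasurable f -> cmeasurable g ->
  cmeasurable (fun x => f x - g x).
Proof. by move=> mf /cmeasurableN; exact: cmeasurableD. Qed.

Lemma cmeasurableJ f : cmeasurable f -> cmeasurable (fun x => (f x)^*).
Proof.
move=> [f1 f2]; split.
  by under eq_fun do rewrite cReJ.
by under eq_fun do rewrite cImJ; exact: measurable_funN.
Qed.

Lemma cmeasurable_comp f (h : 'cV[R]_n -> 'cV[R]_n) : measurable_fun setT h ->
  cmeasurable f -> cmeasurable (fun x => f (h x)).
Proof.
by move=> mh [f1 f2]; split; [exact: (measurableT_comp f1)|
  exact: (measurableT_comp f2)].
Qed.

Lemma cmeasurable_cexpi (h : 'cV[R]_n -> R) : measurable_fun setT h ->
  cmeasurable (fun x => cexpi (h x)).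
Proof.
move=> mh; split.
  apply: (measurableT_comp _ mh).
  by apply: continuous_measurable_fun; exact: continuous_cos.
apply: (measurableT_comp _ mh).
by apply: continuous_measurable_fun; exact: continuous_sin.
Qed.

Lemma measurable_normc f : cmeasurable f ->
  measurable_fun setT (fun x => normc (f x)).
Proof.
move=> [f1 f2].
rewrite (_ : (fun _ => _) = fun x => Num.sqrt (Re (f x) ^+ 2 + Im (f x) ^+ 2)).
  apply: (measurableT_comp (continuous_measurable_fun (@sqrt_continuous R))).
  by apply: measurable_funD; exact: measurable_funX.
by apply/funext => x; case: (f x).
Qed.

Definition cintegrable f : Prop :=
  rint (fun x => Re (f x)) /\ rint (fun x => Im (f x)).

Lemma cintegrable_measurable f : cintegrable f -> cmeasurable f.
Proof. by move=> [/rint_measurable ? /rint_measurable]. Qed.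

Lemma cintegrable_le f (g : 'cV[R]_n -> R) : cmeasurable f -> rint g ->
  (forall x, normc (f x) <= g x) -> cintegrable f.
Proof.
move=> [f1 f2] ig fg; split; apply: rint_le ig _ => // x.
  exact: le_trans (le_Re_normc _) (fg x).
exact: le_trans (le_Im_normc _) (fg x).
Qed.

Lemma rint_normc f : cintegrable f -> rint (fun x => normc (f x)).
Proof.
move=> fi; have [f1 f2] := fi.
apply: rint_le (rintD (rint_norm f1) (rint_norm f2)) _ => [|x].
  by apply: measurable_normc; exact: cintegrable_measurable.
by rewrite ger0_norm ?normc_ge0// normc_le_ReIm.
Qed.

Lemma cintegrableD f g : cintegrable f -> cintegrable g ->
  cintegrable (fun x => f x + g x).
Proof.
move=> [f1 f2] [g1 g2]; split.
  by under eq_fun do rewrite cReD; exact: rintD.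
by under eq_fun do rewrite cImD; exact: rintD.
Qed.

Lemma cintegrableM f g (M : R) : cintegrable f -> cmeasurable g ->
  (forall x, normc (g x) <= M) -> cintegrable (fun x => f x * g x).
Proof.
move=> fi mg gM; apply: (cintegrable_le _ (rintZ M (rint_normc fi))).
  exact: cmeasurableM (cintegrable_measurable fi) mg.
by move=> x; rewrite normcM mulrC ler_wpM2r ?normc_ge0.
Qed.

Lemma cintegrableZ a f : cintegrable f -> cintegrable (fun x => a * f x).
Proof.
move=> fi; under eq_fun do rewrite mulrC.
apply: (@cintegrableM f (fun=> a) (normc a)) => //; exact: cmeasurable_cst.
Qed.

Lemma cintegrableJ f : cintegrable f -> cintegrable (fun x => (f x)^*).
Proof.
move=> [f1 f2]; split.
  by under eq_fun do rewrite cReJ.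
by under eq_fun do rewrite cImJ; exact: rintN.
Qed.

Lemma cintegrable_lscale M f : M \in unitmx ->
  cintegrable f -> cintegrable (fun x => f (M *m x)).
Proof.
move=> uM [f1 f2]; split.
  exact: (integrable_lscale uM (f := fun x => Re (f x))).
exact: (integrable_lscale uM (f := fun x => Im (f x))).
Qed.

Lemma eq_cintegral f g : f =1 g -> cintegral f = cintegral g.
Proof. by move=> /funext ->. Qed.

Lemma cintegralD f g : cintegrable f -> cintegrable g ->
  cintegral (fun x => f x + g x) = cintegral f + cintegral g.
Proof.
move=> [f1 f2] [g1 g2]; apply: complexP; rewrite ?cReD ?cImD/=.
  by rewrite -RintegralD//; apply: eq_Rintegral => x _; rewrite cReD.
by rewrite -RintegralD//; apply: eq_Rintegral => x _; rewrite cImD.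
Qed.

Lemma cintegralZ a f : cintegrable f ->
  cintegral (fun x => a * f x) = a * cintegral f.
Proof.
move=> [f1 f2]; apply: complexP; rewrite ?cReM ?cImM/=.
  rewrite -!RintegralZl// -RintegralB//; [|exact: rintZ..].
  by apply: eq_Rintegral => x _; rewrite cReM.
rewrite -!RintegralZl// -RintegralD//; [|exact: rintZ..].
by apply: eq_Rintegral => x _; rewrite cImM.
Qed.

Lemma cintegralZr a f : cintegrable f ->
  cintegral (fun x => f x * a) = cintegral f * a.
Proof.
by move=> fi; rewrite mulrC -cintegralZ//; apply: eq_cintegral => x; rewrite mulrC.
Qed.

Lemma cintegral0 : cintegral (fun _ : 'cV[R]_n => 0 : C) = 0.
Proof. by apply: complexP; rewrite /= /Rintegral integral0. Qed.

Lemma cintegrable0 : cintegrable (fun _ : 'cV[R]_n => 0 : C).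
Proof.
by split; apply: (eq_integrable measurableT (cst 0%E)) => //; exact: integrable0.
Qed.

Lemma cintegrable_sum I (s : seq I) (F : I -> 'cV[R]_n -> C) :
  (forall i, cintegrable (F i)) -> cintegrable (fun x => \sum_(i <- s) F i x).
Proof.
move=> iF; elim: s => [|i s IHs].
  by under eq_fun do rewrite big_nil; exact: cintegrable0.
by under eq_fun do rewrite big_cons; exact: cintegrableD.
Qed.

Lemma cintegral_sum I (s : seq I) (F : I -> 'cV[R]_n -> C) :
  (forall i, cintegrable (F i)) ->
  cintegral (fun x => \sum_(i <- s) F i x) = \sum_(i <- s) cintegral (F i).
Proof.
move=> iF; elim: s => [|i s IHs].
  by rewrite big_nil -[RHS]cintegral0; apply: eq_cintegral => x; rewrite big_nil.
rewrite big_cons -IHs -cintegralD//; last exact: cintegrable_sum.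
by apply: eq_cintegral => x; rewrite big_cons.
Qed.

Lemma cintegralJ f : cintegrable f ->
  cintegral (fun x => (f x)^*) = (cintegral f)^*.
Proof.
move=> [f1 f2]; apply: complexP; rewrite ?cReJ ?cImJ/=.
  by apply: eq_Rintegral => x _; rewrite cReJ.
rewrite -mulN1r -RintegralZl//.
by apply: eq_Rintegral => x _; rewrite cImJ mulN1r.
Qed.

Lemma cintegral_transl v f : cintegrable f ->
  cintegral (fun x => f (x + v)) = cintegral f.
Proof.
move=> [f1 f2]; apply: complexP => /=.
  exact: (Rintegral_transl v (f := fun x => Re (f x))).
exact: (Rintegral_transl v (f := fun x => Im (f x))).
Qed.

Lemma cintegral_lscale M f : M \in unitmx -> cintegrable f ->
  cintegral (fun x => f (M *m x)) = (lscale M +i* 0)%C * cintegral f.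
Proof.
move=> uM [f1 f2]; apply: complexP; rewrite ?cReM ?cImM/=.
  rewrite mul0r subr0.
  exact: (Rintegral_lscale uM (f := fun x => Re (f x))).
rewrite mul0r addr0.
exact: (Rintegral_lscale uM (f := fun x => Im (f x))).
Qed.

(** The factor 2 comes from bounding the real and imaginary parts separately; the later estimates
    only need some constant. *)
Lemma normc_cintegral_le f : cintegrable f ->
  normc (cintegral f) <= 2 * \int[mu]_x normc (f x).
Proof.
move=> fi; have [f1 f2] := fi; have fn := rint_normc fi.
apply: le_trans (normc_le_ReIm _) _; rewrite mulrDl mul1r lerD//=.
  apply: le_trans (le_normr_Rintegral _ f1) _ => //.
  apply: le_Rintegral => //; first exact: rint_norm.
  by move=> x _; exact: le_Re_normc.
apply: le_trans (le_normr_Rintegral _ f2) _ => //.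
apply: le_Rintegral => //; first exact: rint_norm.
by move=> x _; exact: le_Im_normc.
Qed.

Definition ccvg (u : nat -> C) (l : C) : Prop :=
  Re (u k) @[k --> \oo] --> Re l /\ Im (u k) @[k --> \oo] --> Im l.

Lemma ccvg_unique u l l' : ccvg u l -> ccvg u l' -> l = l'.
Proof.
move=> [u1 u2] [u1' u2']; apply: complexP.
  exact: (cvg_unique _ u1 u1').
exact: (cvg_unique _ u2 u2').
Qed.

Lemma ccvg_cst l : ccvg (fun=> l) l.
Proof. by split; exact: cvg_cst. Qed.

Lemma ccvgM u v l m : ccvg u l -> ccvg v m -> ccvg (fun k => u k * v k) (l * m).
Proof.
move=> [u1 u2] [v1 v2]; split.
  by rewrite cReM; under eq_fun do rewrite cReM; apply: cvgB; exact: cvgM.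
by rewrite cImM; under eq_fun do rewrite cImM; apply: cvgD; exact: cvgM.
Qed.

Lemma ccvg_normc u l : ccvg u l ->
  normc (u k - l) ^+ 2 @[k --> \oo] --> (0 : R).
Proof.
move=> [u1 u2]; under eq_fun do rewrite normc_sqr cReB cImB !expr2.
rewrite (_ : 0 = (Re l - Re l) * (Re l - Re l) + (Im l - Im l) * (Im l - Im l)).
  by apply: cvgD; apply: cvgM; apply: cvgB => //; exact: cvg_cst.
by rewrite !subrr !mulr0 addr0.
Qed.

Lemma cintegral_dominated (f_ : nat -> 'cV[R]_n -> C) f (g : 'cV[R]_n -> R) :
  (forall k, cmeasurable (f_ k)) -> (forall x, ccvg (f_ ^~ x) (f x)) ->
  rint g -> (forall k x, normc (f_ k x) <= g x) ->
  cintegrable f /\ ccvg (fun k => cintegral (f_ k)) (cintegral f).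
Proof.
move=> mf cf ig fg.
have [r1 c1] := @rint_dominated _ _ _ mu (fun k x => Re (f_ k x))
  (fun x => Re (f x)) g (fun k => (mf k).1) (fun x => (cf x).1) ig
  (fun k x => le_trans (le_Re_normc _) (fg k x)).
have [r2 c2] := @rint_dominated _ _ _ mu (fun k x => Im (f_ k x))
  (fun x => Im (f x)) g (fun k => (mf k).2) (fun x => (cf x).2) ig
  (fun k x => le_trans (le_Im_normc _) (fg k x)).
by [].
Qed.

Lemma cintegral_fubini (K : 'cV[R]_n -> 'cV[R]_n -> C) (a b : 'cV[R]_n -> R) :
  measurable_fun setT (fun z : 'cV[R]_n * 'cV[R]_n => Re (K z.1 z.2)) ->
  measurable_fun setT (fun z : 'cV[R]_n * 'cV[R]_n => Im (K z.1 z.2)) ->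
  rint a -> rint b -> (forall x y, normc (K x y) <= a x * b y) ->
  cintegral (fun x => cintegral (K x)) =
  cintegral (fun y => cintegral (K ^~ y)).
Proof.
move=> m1 m2 ia ib Kab.
have [_ _ E1] := @Rintegral_fubini _ _ _ _ _ mu mu (fun x y => Re (K x y)) a b
  m1 ia ib (fun x y => le_trans (le_Re_normc _) (Kab x y)).
have [_ _ E2] := @Rintegral_fubini _ _ _ _ _ mu mu (fun x y => Im (K x y)) a b
  m2 ia ib (fun x y => le_trans (le_Im_normc _) (Kab x y)).
exact: complexP.
Qed.

End complex_integral.

(** * The space L^2 *)

Lemma lte_mul2D (R : realDomainType) (x y : \bar R) (a b : R) :
  (x < a%:E -> y < b%:E -> 2%:E * x + 2%:E * y < (2 * a + 2 * b)%:E)%E.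
Proof.
by move=> xa yb; rewrite (EFinD (2 * a)) (EFinM 2 a) (EFinM 2 b) lteD// lte_pmul2l.
Qed.

Section L2_theory.
Context {R : realType} {n : nat}.
Local Notation mu := (lebesgue_cV n).
Local Notation rint f := (mu.-integrable setT (EFin \o f)).
Local Notation C := R[i].
Implicit Types (f g h : 'cV[R]_n -> C) (V W : set ('cV[R]_n -> C)).

(** The squared norm, on which linear changes of variables and the parallelogram bound act without
    square roots. *)
Definition sqn f : \bar R := (\int[mu]_x (normc (f x) ^+ 2)%:E)%E.

Lemma sqn_ge0 f : (0 <= sqn f)%E.
Proof. by apply: integral_ge0 => x _; rewrite lee_fin sqr_ge0. Qed.

Lemma L2norm_ge0 f : (0 <= L2norm f)%E.
Proof. exact: Lnorm_ge0. Qed.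

Lemma L2norm_sqn f : (L2norm f `^ 2 = sqn f)%E.
Proof.
rewrite /L2norm powR_Lnorm//; apply: eq_integral => x _ /=.
by rewrite powR_mulrn ?normr_ge0// ger0_norm ?normc_ge0.
Qed.

Lemma L2norm_lt f (e : R) : 0 <= e -> (L2norm f < e%:E)%E = (sqn f < (e ^+ 2)%:E)%E.
Proof.
move=> e0; rewrite -L2norm_sqn; have := L2norm_ge0 f.
case: (L2norm f) => [r|//|//]; rewrite ?lee_fin => r0.
  by rewrite poweR_EFin powR_mulrn// !lte_fin ltr_sqr.
by rewrite poweRyr ?pnatr_eq0// ltNge leey ltNge leey.
Qed.

Lemma L2norm_lty f : (L2norm f < +oo)%E = (sqn f < +oo)%E.
Proof.
rewrite -L2norm_sqn; have := L2norm_ge0 f.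
case: (L2norm f) => [r|//|//]; rewrite ?lee_fin => r0.
  by rewrite poweR_EFin !ltry.
by rewrite poweRyr ?pnatr_eq0.
Qed.

Lemma L2P f : L2 f <-> cmeasurable f /\ (sqn f < +oo)%E.
Proof. by rewrite /L2/= L2norm_lty. Qed.

Lemma measurable_normc_sqr f : cmeasurable f ->
  measurable_fun setT (fun x => normc (f x) ^+ 2).
Proof. by move=> /measurable_normc mf; exact: measurable_funX. Qed.

Lemma measurable_sqn f : cmeasurable f ->
  measurable_fun setT (fun x => (normc (f x) ^+ 2)%:E).
Proof. by move=> /measurable_normc_sqr mf; exact/measurable_EFinP. Qed.

Lemma L2_rint f : L2 f -> rint (fun x => normc (f x) ^+ 2).
Proof.
move=> /L2P[mf foo]; apply: rint_ge0P => //; first exact: measurable_normc_sqr.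
by move=> x; exact: sqr_ge0.
Qed.

Lemma rint_L2 f : cmeasurable f -> rint (fun x => normc (f x) ^+ 2) -> L2 f.
Proof.
by move=> mf ri; apply/L2P; split=> //; rewrite /sqn -EFin_Rintegral// ltry.
Qed.

Lemma sqnE f : L2 f -> sqn f = (\int[mu]_x (normc (f x) ^+ 2))%:E.
Proof. by move=> /L2_rint ri; rewrite EFin_Rintegral. Qed.

Lemma le_sqn f (G : 'cV[R]_n -> R) : cmeasurable f -> measurable_fun setT G ->
  (forall x, normc (f x) ^+ 2 <= G x) -> (sqn f <= \int[mu]_x (G x)%:E)%E.
Proof.
move=> mf mG fG; apply: ge0_le_integral => //.
- by move=> x _; rewrite lee_fin sqr_ge0.
- exact: measurable_sqn.
- exact/measurable_EFinP.
- by move=> x _; rewrite lee_fin.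
Qed.

Lemma sqnD f g : cmeasurable f -> cmeasurable g ->
  (sqn (fun x => f x + g x)%R <= 2%:E * sqn f + 2%:E * sqn g)%E.
Proof.
move=> mf mg.
have m1 := measurable_normc_sqr mf; have m2 := measurable_normc_sqr mg.
apply: le_trans (le_sqn (G := fun x => 2 * normc (f x) ^+ 2 + 2 * normc (g x) ^+ 2)
  _ _ _) _.
- exact: cmeasurableD.
- by apply: measurable_funD; exact: measurable_funM.
- by move=> x; exact: normcD_sqr.
have F0 h x : (0 <= (2 * normc (h x) ^+ 2)%:E)%E by rewrite lee_fin mulr_ge0// sqr_ge0.
have G0 h x : (0 <= (normc (h x) ^+ 2)%:E)%E by rewrite lee_fin sqr_ge0.
rewrite (eq_integral (fun x => (2 * normc (f x) ^+ 2)%:E + (2 * normc (g x) ^+ 2)%:E)%E)//.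
rewrite ge0_integralD//; try exact/measurable_EFinP/measurable_funM.
rewrite -!ge0_integralZl ?lee_fin//; exact/measurable_EFinP.
Qed.

Lemma sqnZ a f : cmeasurable f ->
  (sqn (fun x => a * f x)%R = (normc a ^+ 2)%:E * sqn f)%E.
Proof.
move=> mf; rewrite -ge0_integralZl ?lee_fin ?sqr_ge0//; last 2 first.
- exact: measurable_sqn.
- by move=> x _; rewrite lee_fin sqr_ge0.
by apply: eq_integral => x _; rewrite normcM exprMn.
Qed.

Lemma sqnN f : sqn (fun x => - f x) = sqn f.
Proof. by apply: eq_integral => x _; rewrite normcN. Qed.

Lemma sqnB_sym f g : sqn (fun x => f x - g x) = sqn (fun x => g x - f x).
Proof. by rewrite -sqnN; apply: eq_integral => x _; rewrite opprB. Qed.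

Lemma sqn_lscale M f : M \in unitmx -> cmeasurable f ->
  (sqn (fun x => f (M *m x)%R) = (lscale M)%:E * sqn f)%E.
Proof.
move=> uM mf.
apply: (ge0_integral_lscale (f := fun x => (normc (f x) ^+ 2)%:E)) => //.
  exact: measurable_sqn.
by move=> x; rewrite lee_fin sqr_ge0.
Qed.

Lemma L2D f g : L2 f -> L2 g -> L2 (fun x => f x + g x).
Proof.
move=> /L2P[mf foo] /L2P[mg goo]; apply/L2P; split; first exact: cmeasurableD.
apply: le_lt_trans (sqnD mf mg) _.
by rewrite lte_add_pinfty// lte_mul_pinfty.
Qed.

Lemma L2Z a f : L2 f -> L2 (fun x => a * f x).
Proof.
move=> /L2P[mf foo]; apply/L2P; split; first exact: cmeasurableZ.
by rewrite sqnZ// lte_mul_pinfty// lee_fin sqr_ge0.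
Qed.

Lemma L2B f g : L2 f -> L2 g -> L2 (fun x => f x - g x).
Proof.
move=> Lf Lg; rewrite (_ : (fun _ => _) = fun x => f x + (-1) * g x).
  by apply: L2D => //; exact: L2Z.
by apply/funext => x; rewrite mulN1r.
Qed.

Lemma L2_lscale M f : M \in unitmx -> L2 f -> L2 (fun x => f (M *m x)).
Proof.
move=> uM /L2P[mf foo]; apply/L2P; split.
  exact: (cmeasurable_comp (measurable_fun_mulmx M)).
by rewrite sqn_lscale// lte_mul_pinfty// lee_fin ltW// lscale_gt0.
Qed.

Lemma measurable_transl (v : 'cV[R]_n) :
  measurable_fun [set: 'cV[R]_n] (fun x => x + v).
Proof. by apply: measurable_fun_addcV => //; exact: measurable_id. Qed.

Lemma L2closureP V f : L2closure V f <->
  L2 f /\ forall e : R, 0 < e ->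
    exists2 g, V g & (sqn (fun x => f x - g x)%R < e%:E)%E.
Proof.
split=> -[Lf Vf]; split=> // e e0.
  have [|g Vg] := Vf (Num.sqrt e); first by rewrite sqrtr_gt0.
  rewrite L2norm_lt ?sqrtr_ge0// sqr_sqrtr ?ltW// => fg.
  by exists g.
have [|g Vg fg] := Vf (e ^+ 2); first by rewrite exprn_gt0.
by exists g => //; rewrite L2norm_lt ?ltW.
Qed.

Lemma sub_L2closure V : V `<=` L2 -> V `<=` L2closure V.
Proof.
move=> VL f Vf; apply/L2closureP; split; first exact: VL.
move=> e e0; exists f => //; rewrite (_ : sqn _ = 0%E) ?lte_fin//.
rewrite /sqn integral0_eq// => x _.
by rewrite subrr normc0 expr0n.
Qed.

Lemma L2closure_idem V W : V `<=` L2 -> W `<=` L2closure V ->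
  L2closure W `<=` L2closure V.
Proof.
move=> VL WV f /L2closureP[Lf Wf]; apply/L2closureP; split=> // e e0.
(* The parallelogram bound doubles each of the two squared errors. *)
have e4 : 0 < e / 4 by rewrite divr_gt0.
have [g /WV/L2closureP[Lg Vg] fg] := Wf _ e4.
have [h Vh gh] := Vg _ e4; exists h => //.
rewrite (_ : (fun x => f x - h x) = fun x => (f x - g x) + (g x - h x)); last first.
  by apply/funext => x; rewrite addrA subrK.
have [mf _] := (L2P f).1 Lf; have [mg _] := (L2P g).1 Lg.
have [mh _] := (L2P h).1 (VL _ Vh).
apply: le_lt_trans (sqnD _ _) _; [exact: cmeasurableB..|].
rewrite (_ : e = 2 * (e / 4) + 2 * (e / 4)); last by field.
exact: lte_mul2D.
Qed.

Lemma L2closure_linear V (a : C) f g : V `<=` L2 ->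
  (forall (a : C) f g, V f -> V g -> V (fun x => a * f x + g x)) ->
  L2closure V f -> L2closure V g -> L2closure V (fun x => a * f x + g x).
Proof.
move=> VL Vlin /L2closureP[Lf Vf] /L2closureP[Lg Vg]; apply/L2closureP; split.
  by apply: L2D => //; exact: L2Z.
(* The added 1 keeps the divisor positive when [a = 0]. *)
move=> e e0; pose A := normc a ^+ 2 + 1.
have A0 : 0 < A by rewrite ltr_wpDl// sqr_ge0.
have [|f' Vf' ff'] := Vf (e / (4 * A)); first by rewrite divr_gt0// mulr_gt0.
have [|g' Vg' gg'] := Vg (e / 4); first by rewrite divr_gt0.
exists (fun x => a * f' x + g' x); first exact: Vlin.
rewrite (_ : (fun x => _ - _) = fun x => a * (f x - f' x) + (g x - g' x)); last first.
  by apply/funext => x; ring.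
have [mf _] := (L2P f).1 Lf; have [mg _] := (L2P g).1 Lg.
have [mf' _] := (L2P f').1 (VL _ Vf'); have [mg' _] := (L2P g').1 (VL _ Vg').
apply: le_lt_trans (sqnD _ _) _.
- exact/cmeasurableZ/cmeasurableB.
- exact: cmeasurableB.
rewrite sqnZ; last exact: cmeasurableB.
rewrite (_ : e = 2 * (A * (e / (4 * A))) + 2 * (e / 4)); last first.
  by field; rewrite lt0r_neq0.
apply: lte_mul2D => //.
apply: (@le_lt_trans _ _ (A%:E * sqn (fun x => (f x - f' x)%R))%E).
  by apply: lee_wpmul2r; [exact: sqn_ge0|rewrite lee_fin lerDl].
by rewrite EFinM lte_pmul2l.
Qed.

Lemma closed_subspace_L2closure V : V `<=` L2 -> V (cst 0) ->
  (forall (a : C) f g, V f -> V g -> V (fun x => a * f x + g x)) ->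
  closed_subspace (L2closure V).
Proof.
move=> VL V0 Vlin; split.
- by move=> f [].
- exact: sub_L2closure.
- by move=> a f g; exact: L2closure_linear.
- exact: L2closure_idem.
Qed.

Lemma L2closure_comp V W M f : M \in unitmx -> V `<=` L2 -> W `<=` L2 ->
  (forall g, V g -> L2closure W (fun x => g (M *m x))) ->
  L2closure V f -> L2closure W (fun x => f (M *m x)).
Proof.
move=> uM VL WL VW /L2closureP[Lf Vf].
apply: (L2closure_idem (W := L2closure W)) => //; apply/L2closureP; split.
  exact: L2_lscale.
move=> e e0; have s0 := lscale_gt0 uM.
have [|g Vg fg] := Vf (e / lscale M); first by rewrite divr_gt0.
exists (fun x => g (M *m x)); first exact: VW.
rewrite (sqn_lscale (f := fun x => f x - g x))//; last first.
  have [mf _] := (L2P f).1 Lf; have [mg _] := (L2P g).1 (VL _ Vg).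
  exact: cmeasurableB.
rewrite (_ : e = lscale M * (e / lscale M)); last by field; rewrite lt0r_neq0.
by rewrite EFinM lte_pmul2l.
Qed.

Lemma sqn_dominated (f_ : nat -> 'cV[R]_n -> C) f (G : 'cV[R]_n -> R) :
  (forall k, cmeasurable (f_ k)) -> (forall x, ccvg (f_ ^~ x) (f x)) ->
  rint G -> (forall k x, normc (f_ k x) ^+ 2 <= G x) ->
  L2 f /\ forall e : R, 0 < e ->
    exists k, (sqn (fun x => f x - f_ k x)%R < e%:E)%E.
Proof.
move=> mf cf iG fG.
have fG' x : normc (f x) ^+ 2 <= G x.
  rewrite normc_sqr.
  have H : (Re (f_ k x) ^+ 2 + Im (f_ k x) ^+ 2) @[k --> \oo] -->
           Re (f x) ^+ 2 + Im (f x) ^+ 2.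
    by apply: cvgD; rewrite expr2; apply: cvgM; case: (cf x).
  rewrite -(cvg_lim _ H)//; apply: limr_le; first by apply/cvg_ex; eexists; exact: H.
  by apply: nearW => k; rewrite -normc_sqr.
have mf' : cmeasurable f.
  split; [apply: (measurable_fun_cvg (fun k => (mf k).1))|
    apply: (measurable_fun_cvg (fun k => (mf k).2))] => x _; by case: (cf x).
have Lf : L2 f.
  apply: rint_L2 => //; apply: rint_le iG _; first exact: measurable_normc_sqr.
  by move=> x; rewrite ger0_norm ?sqr_ge0.
split=> // e e0.
have mfk k : cmeasurable (fun x => f_ k x - f x) by exact: cmeasurableB.
have [] := @rint_dominated _ _ _ mu (fun k x => normc (f_ k x - f x) ^+ 2)
  (fun=> 0) (fun x => 4 * G x).
- by move=> k; exact: measurable_normc_sqr.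
- by move=> x; exact: ccvg_normc.
- exact: rintZ.
- move=> k x; rewrite ger0_norm ?sqr_ge0//.
  apply: le_trans (normcD_sqr _ _) _; rewrite normcN.
  by have := fG k x; have := fG' x; lra.
move=> _; rewrite [X in _ --> X](_ : _ = 0); last by rewrite /Rintegral integral0.
move=> /cvgrPdist_lt/(_ _ e0)[N _ /(_ N (leqnn _))].
rewrite sub0r normrN => HN; exists N; rewrite sqnB_sym sqnE; last first.
  apply: L2B => //; apply: rint_L2 => //.
  apply: rint_le iG _; first exact: measurable_normc_sqr.
  by move=> x; rewrite ger0_norm ?sqr_ge0.
by rewrite lte_fin (le_lt_trans (ler_norm _)).
Qed.

(** The form in which limits enter a closed subspace later on: pointwise convergence everywhere,
    under an integrable majorant of the squares. *)
Lemma L2closure_dominated V (f_ : nat -> 'cV[R]_n -> C) f (G : 'cV[R]_n -> R) :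
  V `<=` L2 -> (forall k, L2closure V (f_ k)) ->
  (forall x, ccvg (f_ ^~ x) (f x)) ->
  rint G -> (forall k x, normc (f_ k x) ^+ 2 <= G x) -> L2closure V f.
Proof.
move=> VL Vf cf iG fG.
have mf k : cmeasurable (f_ k) by have [/L2P[]] := Vf k.
have [Lf H] := sqn_dominated mf cf iG fG.
apply: (L2closure_idem (W := L2closure V)) => //; apply/L2closureP; split=> //.
by move=> e /H[k fk]; exists (f_ k).
Qed.

End L2_theory.

(** * Smooth functions *)

Section Ck.
Context {R : realType} {n : nat}.
Implicit Types f g : 'cV[R]_n -> R.

(* All directional derivatives, and not only the partial ones, are required to
   exist: this makes the class stable under linear changes of variables. *)
Fixpoint Ck (k : nat) f : Prop :=
  continuous f /\
  if k is k'.+1 then forall v, (forall x, derivable f x v) /\ Ck k' ('D_v f)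
  else True.

Definition Cinf f := forall k, Ck k f.

Lemma Ck_continuous k f : Ck k f -> continuous f.
Proof. by case: k => [|k] []. Qed.

Lemma CkS k f : Ck k.+1 f -> Ck k f.
Proof.
elim: k f => [|k IHk] f [cf Cf]; split=> // v.
by have [df Cdf] := Cf v; split=> //; exact: IHk.
Qed.

Lemma Ck_D k f v : Ck k.+1 f -> Ck k ('D_v f).
Proof. by case=> _ /(_ v)[]. Qed.

Lemma Ck_derivable k f x v : Ck k.+1 f -> derivable f x v.
Proof. by case=> _ /(_ v)[]. Qed.

Lemma Cinf_continuous f : Cinf f -> continuous f.
Proof. by move=> /(_ 0%N)[]. Qed.

Lemma Cinf_D f v : Cinf f -> Cinf ('D_v f).
Proof. by move=> Cf k; exact: Ck_D (Cf k.+1). Qed.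

Lemma Cinf_derivable f x v : Cinf f -> derivable f x v.
Proof. by move=> Cf; exact: Ck_derivable (Cf 1%N). Qed.

Lemma Ck_cst k a : Ck k (fun _ => a).
Proof.
elim: k a => [|k IHk] a; split; [exact: cst_continuous|by []|
  exact: cst_continuous|move=> v; split].
  by move=> x; exact: derivable_cst.
rewrite (_ : 'D_v _ = fun=> 0); first exact: IHk.
by apply/funext => x; rewrite (derive_cst a).
Qed.

Lemma CkDf k f g : Ck k f -> Ck k g -> Ck k (fun x => f x + g x).
Proof.
elim: k f g => [|k IHk] f g [cf Cf] [cg Cg];
  (split; first by move=> x; exact: (cvgD (cf x) (cg x))) => //.
move=> v; have [df Cdf] := Cf v; have [dg Cdg] := Cg v; split.
  by move=> x; exact: (derivableD (df x) (dg x)).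
rewrite (_ : 'D_v _ = fun x => 'D_v f x + 'D_v g x); first exact: IHk.
by apply/funext => x; rewrite (deriveD (df x) (dg x)).
Qed.

Lemma CkM k f g : Ck k f -> Ck k g -> Ck k (fun x => f x * g x).
Proof.
elim: k f g => [|k IHk] f g Hf Hg; have [cf Cf] := Hf; have [cg Cg] := Hg;
  (split; first by move=> x; exact: (cvgM (cf x) (cg x))) => //.
move=> v; have [df Cdf] := Cf v; have [dg Cdg] := Cg v; split.
  by move=> x; exact: (derivableM (df x) (dg x)).
rewrite (_ : 'D_v _ = fun x => f x * 'D_v g x + g x * 'D_v f x).
  by apply: CkDf; apply: IHk => //; exact: CkS.
by apply/funext => x; rewrite (deriveM (df x) (dg x)).
Qed.

Lemma Ck_sum k I (s : seq I) (P : pred I) (F : I -> 'cV[R]_n -> R) :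
  (forall i, Ck k (F i)) -> Ck k (fun x => \sum_(i <- s | P i) F i x).
Proof.
move=> CF; elim: s => [|i s IHs].
  by under eq_fun do rewrite big_nil; exact: Ck_cst.
by under eq_fun do rewrite big_cons; case: (P i) => //; exact: CkDf.
Qed.

Lemma Ck_prod k I (s : seq I) (P : pred I) (F : I -> 'cV[R]_n -> R) :
  (forall i, Ck k (F i)) -> Ck k (fun x => \prod_(i <- s | P i) F i x).
Proof.
move=> CF; elim: s => [|i s IHs].
  by under eq_fun do rewrite big_nil; exact: Ck_cst.
by under eq_fun do rewrite big_cons; case: (P i) => //; exact: CkM.
Qed.

Lemma is_derive_dotp v a (x w : 'cV[R]_n) :
  is_derive x w (fun x => dotp x v + a) (dotp w v).
Proof.
have H : h^-1 *: ((dotp (h *: w + x) v + a) - (dotp x v + a)) @[h --> 0^'] -->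
    dotp w v.
  apply: (@cvg_trans _ ((fun _ : R => dotp w v) @ 0^')); last exact: cvg_cst.
  apply: near_eq_cvg; near=> h.
  rewrite !dotpDl dotpZl opprD addrACA subrr addr0 addrK.
  rewrite /= -[RHS]/(h^-1 * (h * dotp w v)) mulKf//.
  by near: h; exact: nbhs_dnbhs_neq.
by apply: DeriveDef; [apply/cvg_ex; exists (dotp w v)|exact: cvg_lim].
Unshelve. all: by end_near. Qed.

Lemma Ck_dotp k v a : Ck k (fun x => dotp x v + a).
Proof.
have c : continuous (fun x => dotp x v + a).
  move=> x; apply: (@cvgD _ _ _ (nbhs x) _ (dotp^~ v) (cst a)).
    exact: continuous_dotpl.
  exact: cvg_cst.
case: k => [|k]; split=> // w; split.
  by move=> x; have [] := is_derive_dotp v a x w.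
rewrite (_ : 'D_w _ = fun=> dotp w v); first exact: Ck_cst.
by apply/funext => x; have [] := is_derive_dotp v a x w.
Qed.

(** Only directional derivatives of [f] are available, so the one-variable chain rule is applied
    along the line [h |-> h *: v + x]. *)
Lemma is_derive_comp1 (g : R -> R) (dg : R) f x v :
  is_derive (f x) 1 g dg -> derivable f x v ->
  is_derive x v (g \o f) (dg * 'D_v f x).
Proof.
move=> dgx /derivable1P dl.
have fx : f x = f (0 *: v + x) by rewrite scale0r add0r.
have H : is_derive (0 : R) 1 (g \o (fun h => f (h *: v + x))) (dg * 'D_v f x).
  apply: is_derive1_comp; first by rewrite -fx.
  by apply: DeriveDef => //; rewrite -derive1E /derive1 /derive;
    under eq_fun do rewrite scale0r add0r addr0.
have [d1 d2] := H; apply: DeriveDef; first exact/derivable1P.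
rewrite -d2 -derive1E /derive1 /derive.
by under [in RHS]eq_fun do rewrite /= scale0r add0r addr0.
Qed.

(* One-variable functions are given by a family [G] closed under derivation on
   a set of values [D]. *)
Lemma Ck_comp (G : set (R -> R)) (D : set R) :
  (forall g : R -> R, G g -> exists2 g' : R -> R, G g' &
     forall y, D y -> is_derive y 1 g (g' y)) ->
  forall k (g : R -> R) f, G g -> (forall x, D (f x)) -> Ck k f -> Ck k (g \o f).
Proof.
move=> GD; elim=> [|k IHk] g f Gg fD Cf.
  split=> // x; apply: continuous_comp; first exact: (Ck_continuous Cf).
  have [g' _ /(_ _ (fD x))[dg _]] := GD _ Gg.
  by apply: differentiable_continuous; exact/derivable1_diffP.
have [g' Gg' dg] := GD _ Gg.
have C1 : continuous (g \o f).
  move=> x; apply: continuous_comp; first exact: (Ck_continuous Cf).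
  have [dgx _] := dg _ (fD x).
  by apply: differentiable_continuous; exact/derivable1_diffP.
split=> // v.
have dgf x : is_derive x v (g \o f) (g' (f x) * 'D_v f x).
  by apply: is_derive_comp1; [exact: dg|exact: (@Ck_derivable _ _ x v Cf)].
split; first by move=> x; have [] := dgf x.
rewrite (_ : 'D_v _ = fun x => (g' \o f) x * 'D_v f x); last first.
  by apply/funext => x; have [_ ->] := dgf x.
by apply: CkM; [apply: IHk => //; exact: CkS|exact: Ck_D].
Qed.

(** Needed for periodizations, which coincide with a fixed finite sum only near each point. *)
Lemma Ck_local k f :
  (forall x : 'cV[R]_n, exists2 g, Ck k g & \forall y \near x, f y = g y) -> Ck k f.
Proof.
elim: k f => [|k IHk] f fg.
  split=> // x; have [g [cg _] fgx] := fg x.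
  rewrite /continuous_at (nbhs_singleton fgx).
  apply: cvg_trans (cg x).
  have fgx' : \forall y \near x, g y = f y by apply: filterS fgx => y /= ->.
  exact: (@near_eq_cvg _ _ (nbhs x) _ g f fgx').
have cf : continuous f.
  move=> x; have [g [cg _] fgx] := fg x.
  rewrite /continuous_at (nbhs_singleton fgx).
  apply: cvg_trans (cg x).
  have fgx' : \forall y \near x, g y = f y by apply: filterS fgx => y /= ->.
  exact: (@near_eq_cvg _ _ (nbhs x) _ g f fgx').
split=> // v; split=> [x|].
  have [g Cg fgx] := fg x.
  apply: (@near_eq_derivable _ _ _ g) => //; last exact: (@Ck_derivable _ _ x v Cg).
  have fgx' : \forall y \near x, g y = f y by apply: filterS fgx => y /= ->.
  exact: fgx'.
apply: IHk => x; have [g Cg fgx] := fg x; exists ('D_v g); first exact: Ck_D.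
apply: filterS (nbhs_interior fgx) => y fgy.
exact: near_eq_derive.
Qed.

End Ck.

Section Ck_examples.
Context {R : realType}.

Lemma derive_affine m n (M : 'M[R]_(n, m)) (c : 'cV[R]_n) (f : 'cV[R]_n -> R)
    (x v : 'cV[R]_m) :
  'D_v (fun x => f (M *m x + c)) x = 'D_(M *m v) f (M *m x + c).
Proof.
rewrite /derive.
rewrite (_ : (fun h => h^-1 *: ((f \o shift (M *m x + c)) (h *: (M *m v)) - _)) =
  fun h => h^-1 *: (((fun x => f (M *m x + c)) \o shift x) (h *: v) -
                    f (M *m x + c)))//.
by apply/funext => h /=; rewrite mulmxDr -scalemxAr addrA.
Qed.

Lemma derivable_affine m n (M : 'M[R]_(n, m)) (c : 'cV[R]_n) (f : 'cV[R]_n -> R)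
    (x v : 'cV[R]_m) :
  derivable f (M *m x + c) (M *m v) -> derivable (fun x => f (M *m x + c)) x v.
Proof.
rewrite /derivable.
rewrite (_ : (fun h => h^-1 *: ((f \o shift (M *m x + c)) (h *: (M *m v)) - _)) =
  fun h => h^-1 *: (((fun x => f (M *m x + c)) \o shift x) (h *: v) -
                    f (M *m x + c)))//.
by apply/funext => h /=; rewrite mulmxDr -scalemxAr addrA.
Qed.

Lemma continuous_mulmx m n (M : 'M[R]_(n, m)) :
  continuous (fun x : 'cV[R]_m => M *m x).
Proof.
have [C C0 HC] := mulmx_bound M.
move=> x; apply/(@cvgrPdist_le _ _ _ (nbhs x)) => e e0; apply/nbhs_ballP.
exists (C^-1 * e) => [|y]; first by rewrite /= mulr_gt0// invr_gt0.
rewrite -ball_normE /= => xy; rewrite -mulmxBr; apply: le_trans (HC _) _.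
by rewrite -ler_pdivlMl// ltW.
Qed.

Lemma continuous_affine m n (M : 'M[R]_(n, m)) (c : 'cV[R]_n) :
  continuous (fun x : 'cV[R]_m => M *m x + c).
Proof.
move=> x; apply: (@cvgD _ _ _ (nbhs x) _ (mulmx M) (cst c)).
  exact: continuous_mulmx.
exact: cvg_cst.
Qed.

Lemma Ck_affine m n (M : 'M[R]_(n, m)) (c : 'cV[R]_n) k (f : 'cV[R]_n -> R) :
  Ck k f -> Ck k (fun x => f (M *m x + c)).
Proof.
elim: k f => [|k IHk] f Cf.
  split=> // x; apply: continuous_comp; first exact: continuous_affine.
  exact: (Ck_continuous Cf).
split=> [x|v].
  apply: continuous_comp; first exact: continuous_affine.
  exact: (Ck_continuous Cf).
split=> [x|]; first by apply: derivable_affine; exact: (Ck_derivable Cf).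
rewrite (_ : 'D_v _ = fun x => 'D_(M *m v) f (M *m x + c)); last first.
  by apply/funext => x; exact: derive_affine.
by have := IHk _ (@Ck_D _ _ _ _ (M *m v) Cf).
Qed.

Lemma Ck_transl n (c : 'cV[R]_n) k (f : 'cV[R]_n -> R) :
  Ck k f -> Ck k (fun x => f (x + c)).
Proof.
by move=> /(Ck_affine 1%:M c); under eq_fun do rewrite mul1mx.
Qed.

Lemma Ck_cos n k (f : 'cV[R]_n -> R) : Ck k f -> Ck k (fun x => cos (f x)).
Proof.
move=> Cf; rewrite (_ : (fun _ => _) =
    (fun t => 1 * cos (t + 0) : R) \o f); last first.
  by apply/funext => x /=; rewrite mul1r addr0.
(* This family is stable under derivation because deriving a cosine adds [pi / 2] to its phase. *)
apply: (@Ck_comp _ _ [set g | exists a t0, g = fun t : R => a * cos (t + t0)] setT)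
  => //; last by exists 1, 0.
move=> _ [a [t0 ->]]; exists (fun t => a * cos (t + (t0 + pi / 2))).
  by exists a, (t0 + pi / 2).
move=> y _; rewrite addrA cosDpihalf.
have H : is_derive y 1 (fun t : R => t + t0) 1 by exact: is_derive_shift.
have := is_deriveZ a (@is_derive1_comp _ cos (fun t => t + t0) y _ _
  (is_derive_cos (y + t0)) H).
by rewrite mulr1.
Qed.

Lemma Ck_sin n k (f : 'cV[R]_n -> R) : Ck k f -> Ck k (fun x => sin (f x)).
Proof.
move=> Cf; rewrite (_ : (fun _ => _) = fun x => cos (f x + (- (pi / 2)))).
  by apply: Ck_cos; apply: CkDf => //; exact: Ck_cst.
by apply/funext => x; rewrite cosBpihalf.
Qed.

Lemma Ck_invsqrt n k (f : 'cV[R]_n -> R) : (forall x, 0 < f x) ->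
  Ck k f -> Ck k (fun x => (Num.sqrt (f x))^-1).
Proof.
move=> f0 Cf; rewrite (_ : (fun _ => _) =
    (fun t => 1 * (Num.sqrt t)^-1 ^+ 1 : R) \o f); last first.
  by apply/funext => x /=; rewrite mul1r expr1.
(* Deriving a power of [1 / sqrt t] raises its exponent by 2, so the multiples of these powers form
   a stable family on the positive reals. *)
apply: (@Ck_comp _ _ [set g | exists a m, g = fun t : R => a * (Num.sqrt t)^-1 ^+ m]
  [set t | 0 < t]) => //; last by exists 1, 1%N.
move=> _ [a [m ->]].
exists (fun t => - (a * m%:R / 2) * (Num.sqrt t)^-1 ^+ m.+2).
  by exists (- (a * m%:R / 2)), m.+2.
move=> y /= y0.
have s0 : Num.sqrt y != 0 by rewrite lt0r_neq0// sqrtr_gt0.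
have H1 := is_derive1_sqrt y0.
have H2 : is_derive y 1 (fun t : R => (Num.sqrt t)^-1) (- (Num.sqrt y) ^- 2 *: (2 * Num.sqrt y)^-1).
  exact: is_deriveV.
have H3 := is_deriveZ a (is_deriveX m H2).
rewrite (_ : (fun t => _) = a \*: (fun t : R => (Num.sqrt t)^-1) ^+ m); last first.
  by apply/funext => t /=; rewrite exprfctE.
apply: (is_derive_eq H3); rewrite /GRing.scale/=.
case: m H3 => [|m] _; first by rewrite !(mulr0, mul0r, oppr0).
by rewrite /= -mulr_natr !exprVn !exprS; field; rewrite s0 expf_neq0.
Qed.

End Ck_examples.

(** * Flat functions and smooth bumps *)

Section flat.
Context {R : realType}.
Implicit Types (p : {poly R}).

(** The classical flat function [exp (-1/x)] is not alone closed under derivation; with an arbitrary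
    polynomial in [1/x] as a factor the family is, as [Ck_comp] requires. *)
Definition flatp p (x : R) : R := if 0 < x then p.[x^-1] * expR (- x^-1) else 0.

(** With [y = 1/x], each monomial satisfies [y^i exp(-y) = x y^(i+1) exp(-y) <= x (i+1)!], by the
    exponential series. A linear bound is what the derivative at 0 needs. *)
Lemma flatp_bound p : exists2 C : R, 0 <= C &
  forall x, `|flatp p x| <= C * `|x|.
Proof.
exists (\sum_(i < size p) `|p`_i| * (i.+1)`!%:R).
  by apply: sumr_ge0 => i _; rewrite mulr_ge0.
move=> x; rewrite /flatp; case: ifPn => [x0|_]; last first.
  by rewrite normr0 mulr_ge0// sumr_ge0// => i _; rewrite mulr_ge0.
rewrite normrM (ger0_norm (expR_ge0 _)) (gtr0_norm x0) horner_coef mulr_suml.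
apply: (@le_trans _ _ ((\sum_(i < size p) `|p`_i * x^-1 ^+ i|) * expR (- x^-1))).
  by rewrite ler_wpM2r ?expR_ge0// ler_norm_sum.
rewrite mulr_suml; apply: ler_sum => i _.
have y0 : 0 <= x^-1 by rewrite invr_ge0 ltW.
rewrite normrM -!mulrA ler_wpM2l//.
rewrite (ger0_norm (exprn_ge0 i y0)) expRN ler_pdivrMr ?expR_gt0//.
rewrite (_ : x^-1 ^+ i = x * x^-1 ^+ i.+1); last first.
  by rewrite exprS mulVKf// gt_eqF.
rewrite (mulrC _ x) -mulrA; apply: ler_wpM2l; first exact: ltW.
rewrite -ler_pdivrMl ?ltr0n ?fact_gt0// mulrC.
by apply: le_trans (expR_ge1Dxn i y0); rewrite lerDr.
Qed.

Lemma is_derive_flatp p (y : R) :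
  is_derive y 1 (flatp p) (flatp ('X^2 * (p - p^`())) y).
Proof.
have [y0|y0|<-] := ltgtP 0 y.
- have yN0 : y != 0 by rewrite gt_eqF.
  apply: (@near_eq_is_derive _ _ _ (fun x : R => p.[x^-1] * expR (- x^-1))).
    have : \forall x \near y, 0 < x by exact: lt_nbhsr.
    by apply: filterS => x x0; rewrite /flatp x0.
  have D1 : is_derive y 1 (fun x : R => x^-1) (- y ^- 2 *: (1 : R)).
    exact: is_deriveV.
  have D2 : is_derive y 1 (fun x : R => p.[x^-1]) (p^`().[y^-1] * (- y ^- 2 *: 1)).
    exact: (@is_derive1_comp _ (horner p) (fun x => x^-1)).
  have D3 : is_derive y 1 (fun x : R => expR (- x^-1))
      (expR (- y^-1) * (- (- y ^- 2 *: 1))).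
    exact: (@is_derive1_comp _ expR (fun x => - x^-1) y _ _ (is_derive_expR _)
      (is_deriveN D1)).
  apply: (is_derive_eq (is_deriveM D2 D3)).
  rewrite /flatp y0 !hornerE/= /GRing.scale/=.
  by field.
- apply: (@near_eq_is_derive _ _ _ (cst 0)).
    have : \forall x \near y, x < 0 by exact: lt_nbhsl.
    by apply: filterS => x x0; rewrite /flatp ltNge (ltW x0).
  by rewrite /flatp ltNge (ltW y0)/=; exact: is_derive_cst.
- have H : h^-1 *: ((flatp p \o shift 0) (h *: 1) - flatp p 0) @[h --> 0^'] --> (0 : R).
    have [C C0 HC] := flatp_bound ('X * p).
    apply/cvgrPdist_le => e e0; near=> h.
    have h0 : h != 0 by near: h; exact: nbhs_dnbhs_neq.
    rewrite sub0r normrN /= addr0 /GRing.scale/= mulr1.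
    rewrite {2}/flatp ltxx subr0.
    (* The difference quotient at 0 is again a flat function, hence tends to 0 by the linear
       bound. *)
    have -> : h^-1 * flatp p h = flatp ('X * p) h.
      by rewrite /flatp; case: ifP => _; rewrite ?mulr0// hornerM hornerX mulrA.
    apply: le_trans (HC _) _; apply: (@le_trans _ _ ((C + 1) * `|h|)).
      by rewrite ler_wpM2r// lerDl.
    rewrite -ler_pdivlMl ?ltr_wpDl//.
    have : ball 0 ((C + 1)^-1 * e) h.
      near: h; apply: nbhs_dnbhs; apply: nbhsx_ballx.
      by rewrite mulr_gt0// invr_gt0 ltr_wpDl.
    by rewrite -ball_normE /= sub0r normrN => /ltW.
  apply: DeriveDef; first by apply/cvg_ex; exists 0.
  by rewrite {2}/flatp ltxx; exact: cvg_lim.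
Unshelve. all: by end_near. Qed.

Lemma Ck_flatp n p k (f : 'cV[R]_n -> R) : Ck k f -> Ck k (fun x => flatp p (f x)).
Proof.
move=> Cf; apply: (@Ck_comp _ _ [set g : R -> R | exists p, g = flatp p] setT _ _ (flatp p)) => //.
  move=> _ [q ->]; exists (flatp ('X^2 * (q - q^`()))).
    by eexists.
  by move=> y _; exact: is_derive_flatp.
by exists p.
Qed.

Lemma flatp1_gt0 (x : R) : (0 < flatp 1 x) = (0 < x).
Proof.
by rewrite /flatp; case: ifPn => // _; rewrite ?ltxx// hornerC mul1r expR_gt0.
Qed.

Lemma flatp1_ge0 (x : R) : 0 <= flatp 1 x.
Proof.
by rewrite /flatp; case: ifPn => // _; rewrite hornerC mul1r expR_ge0.
Qed.

Definition bump1 (x : R) : R := flatp 1 (1 + x) * flatp 1 (1 - x).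

Lemma bump1_ge0 x : 0 <= bump1 x.
Proof. by rewrite mulr_ge0// flatp1_ge0. Qed.

Lemma bump1_gt0 x : (0 < bump1 x) = (`|x| < 1).
Proof.
have H1 : (-1 < x) = (0 < 1 + x) by rewrite -[LHS]subr_gt0 opprK addrC.
have H2 : (x < 1) = (0 < 1 - x) by rewrite subr_gt0.
rewrite ltr_norml H1 H2 -(flatp1_gt0 (1 + x)) -(flatp1_gt0 (1 - x)) /bump1.
have := flatp1_ge0 (1 + x); have := flatp1_ge0 (1 - x).
move: (flatp 1 (1 + x)) (flatp 1 (1 - x)) => a b b0 a0.
apply/idP/andP => [ab|[]]; last exact: mulr_gt0.
by split; rewrite lt_def ?a0 ?b0 andbT; apply: contraTneq ab => ->;
  rewrite ?mul0r ?mulr0 ltxx.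
Qed.

(** The norm of column vectors is the sup norm, so a product of one-variable bumps is positive
    exactly on a ball. *)
Definition bump n (c : 'cV[R]_n) (r : R) (x : 'cV[R]_n) : R :=
  \prod_(i < n) bump1 (r^-1 * (x - c) i 0).

Lemma bump_ge0 n (c : 'cV[R]_n) r x : 0 <= bump c r x.
Proof. by apply: prodr_ge0 => i _; exact: bump1_ge0. Qed.

Lemma bump_gt0 n (c : 'cV[R]_n) r x : 0 < r -> (0 < bump c r x) = (`|x - c| < r).
Proof.
move=> r0; apply/idP/idP => [b0|xc].
  apply: cV_norm_lt => // i; rewrite -[r]mulr1 -ltr_pdivrMl//.
  rewrite -[r^-1]gtr0_norm ?invr_gt0// -normrM -bump1_gt0.
  rewrite lt_def bump1_ge0 andbT; apply/eqP => bi.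
  by move: b0; rewrite /bump (bigD1 i)//= bi mul0r ltxx.
apply: prodr_gt0 => i _; rewrite bump1_gt0 normrM gtr0_norm ?invr_gt0//.
rewrite ltr_pdivrMl// mulr1; apply: le_lt_trans xc.
exact: mx_norm_coord.
Qed.

Lemma bump_eq0 n (c : 'cV[R]_n) r x : 0 < r -> r <= `|x - c| -> bump c r x = 0.
Proof.
move=> r0; rewrite leNgt -(bump_gt0 c x r0) -leNgt => b0.
by apply/eqP; rewrite eq_le b0 bump_ge0.
Qed.

Lemma Cinf_bump n (c : 'cV[R]_n) r : Cinf (bump c r).
Proof.
move=> k; apply: Ck_prod => i; apply: CkM; apply: Ck_flatp.
  apply: CkDf; first exact: Ck_cst.
  rewrite (_ : (fun x => _) = fun x => dotp x (r^-1 *: delta_mx i 0) - r^-1 * c i 0).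
    exact: Ck_dotp.
  by apply/funext => x; rewrite dotpZr dotp_delta !mxE mulrBr.
rewrite (_ : (fun x => _) = fun x => dotp x (- r^-1 *: delta_mx i 0) + (1 + r^-1 * c i 0)).
  exact: Ck_dotp.
by apply/funext => x; rewrite dotpZr dotp_delta !mxE; ring.
Qed.

End flat.

Section bounded_support.
Context {R : realType} {n : nat}.
Local Notation mu := (lebesgue_cV n).
Local Notation rint f := (mu.-integrable setT (EFin \o f)).
Implicit Types f g : 'cV[R]_n -> R.

Lemma Cinf_smooth f : Cinf f -> smooth f.
Proof.
move=> Cf s; have Cs : Cinf (partials s f).
  by elim: s => //= i s IHs; exact: Cinf_D.
by split; [exact: Cinf_continuous|move=> i x; exact: Cinf_derivable].
Qed.

Lemma compact_cV (A : set 'cV[R]_n) (r : R) : closed A ->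
  (forall x, A x -> `|x| <= r) -> compact A.
Proof.
move=> cA Ar; pose T (x : 'rV[R]_n) : 'cV[R]_n := x^T.
have cT : continuous T.
  move=> x; apply/(@cvgrPdist_le _ _ _ (nbhs x)) => e e0; apply/nbhs_ballP.
  exists e => // y; rewrite -ball_normE /= => xy.
  apply: cV_norm_le => [|i]; first exact: ltW.
  rewrite !mxE; apply: le_trans (ltW xy).
  by have := mx_norm_coord (x - y) 0 i; rewrite !mxE.
have -> : A = T @` (T @^-1` A).
  apply/seteqP; split=> [x Ax|_ [y Ay <-]//].
  by exists x^T; rewrite /T/= trmxK.
apply: continuous_compact; first exact: continuous_subspaceT.
apply: bounded_closed_compact; last by apply: preimage_closed.
exists r; split; first exact: num_real.
move=> s rs x Ax; apply: le_trans (ltW rs).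
rewrite -[x]trmxK; apply: le_trans (Ar _ Ax).
rewrite [leLHS]/Num.norm/= mx_normrE; apply: bigmax_le => // -[i j] _ /=.
by rewrite (ord1 i) mxE mx_norm_coord.
Qed.

Lemma closed_norm_le (r : R) : closed [set x : 'cV[R]_n | `|x| <= r].
Proof.
apply: (@preimage_closed 'cV[R]_n R (fun x => `|x|) [set y : R | y <= r]).
  by move=> x _; exact: norm_continuous.
exact: closed_le.
Qed.

Definition bsupp (T : zmodType) (F : 'cV[R]_n -> T) : Prop :=
  exists r : R, forall x, r < `|x| -> F x = 0.

Lemma bsupp_pos (T : zmodType) (F : 'cV[R]_n -> T) : bsupp F ->
  exists2 r : R, 0 < r & forall x, r < `|x| -> F x = 0.
Proof.
move=> [r rF]; exists (`|r| + 1) => [|x rx]; first by rewrite ltr_wpDl.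
by apply: rF; apply: le_lt_trans rx; rewrite (le_trans (ler_norm r))// lerDl.
Qed.

Lemma continuous_bsupp_bounded f : continuous f -> bsupp f ->
  exists2 M : R, 0 < M & forall x, `|f x| <= M.
Proof.
move=> cf [r rf].
have cB : compact [set x : 'cV[R]_n | `|x| <= r].
  by apply: (@compact_cV _ r) => //; exact: closed_norm_le.
have : compact (f @` [set x : 'cV[R]_n | `|x| <= r]).
  by apply: continuous_compact => //; exact: continuous_subspaceT.
move=> /compact_bounded[N [_ HN]].
exists (`|N| + 1) => [|x]; first by rewrite ltr_wpDl.
have [xr|rx] := leP `|x| r; last by rewrite rf// normr0 addr_ge0.
apply: HN; last by exists x.
by rewrite (le_lt_trans (ler_norm _))// ltrDl.
Qed.

Lemma rint_bsupp f (M : R) : measurable_fun setT f -> (forall x, `|f x| <= M) ->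
  bsupp f -> rint f.
Proof.
move=> mf fM /bsupp_pos[r r0 rf].
pose B : set 'cV[R]_n := box (fun=> - r) (fun=> r).
have M0 : 0 <= M by exact: le_trans (normr_ge0 _) (fM 0).
have iB : rint (fun x => M * \1_B x).
  apply: rintZ; apply: rint_ge0P => //.
    by apply: measurable_indic; exact: measurable_box.
  rewrite integral_indic ?setIT//; last exact: measurable_box.
  exact: lebesgue_box_lty.
apply: rint_le iB _ => // x; have [xB|xB] := boolP (x \in B).
  by rewrite indicE xB mulr1.
rewrite rf ?normr0 ?mulr_ge0// ltNge; apply: contra xB => xr.
rewrite inE => i; rewrite in_itv/= -ler_norml.
exact: le_trans (mx_norm_coord _ _ _) xr.
Qed.

Lemma rint_continuous_bsupp f : continuous f -> bsupp f -> rint f.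
Proof.
move=> cf bf; have [M _ fM] := continuous_bsupp_bounded cf bf.
by apply: (rint_bsupp _ fM bf); exact: measurable_fun_continuous.
Qed.

Lemma bsupp_D f v : bsupp f -> bsupp ('D_v f).
Proof.
move=> [r rf]; exists r => x rx.
rewrite (@near_eq_derive _ _ _ _ (cst 0)); first by rewrite derive_cst.
have op : open [set y : 'cV[R]_n | r < `|y|].
  apply: (@open_comp 'cV[R]_n R (fun x => `|x|) [set y : R | r < y]).
    by move=> y _; exact: norm_continuous.
  exact: open_gt.
have : nbhs x [set y : 'cV[R]_n | r < `|y|] by exact: open_nbhs_nbhs.
by apply: filterS => y /rf.
Qed.

End bounded_support.

(** * An integrable majorant on R^n *)

Section integrable_decay.
Context {R : realType}.

Lemma oneDsqrV_ge0 (t : R) : 0 <= (oneDsqr t)^-1.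
Proof. by rewrite invr_ge0 (le_trans ler01)// oneDsqr_ge1. Qed.

(** A product over the coordinates is preferred to a power of the norm: it integrates one coordinate
    at a time, and each factor is gained by two integrations by parts. *)
Definition dprod n (x : 'cV[R]_n) : R := \prod_(i < n) (oneDsqr (x i 0))^-1.

Lemma dprod_ge0 n (x : 'cV[R]_n) : 0 <= dprod x.
Proof. by apply: prodr_ge0 => i _; exact: oneDsqrV_ge0. Qed.

Lemma measurable_dprod n : measurable_fun setT (@dprod n).
Proof.
apply: measurable_prod => i _.
exact: (measurableT_comp (continuous_measurable_fun (@continuous_oneDsqrV R))
  (measurable_coord i)).
Qed.

Lemma integral_oneDsqrV_lty :
  (\int[@lebesgue_measure R]_x ((oneDsqr x)^-1)%:E < +oo)%E.
Proof.
rewrite ge0_symfun_integralT//=.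
- by rewrite -set_itvcy integral0y_oneDsqr -EFinM ltry.
- exact: continuous_oneDsqrV.
- by move=> x; rewrite /oneDsqr/= sqrrN.
Qed.

(** Tonelli splits off the first coordinate, following the recursive construction of
    [lebesgue_cV]. *)
Lemma rint_dprod n : (lebesgue_cV n).-integrable setT (EFin \o @dprod n).
Proof.
apply: rint_ge0P; [exact: measurable_dprod|exact: dprod_ge0|].
elim: n => [|n IHn].
  rewrite (eq_integral (cst 1%E)) => [|x _]; last by rewrite /dprod big_ord0.
  by rewrite integral_cst// mul1e /= diracT ltry.
have mc := @measurable_cV_cons R n.
have E p : dprod (@cV_cons R n p) = (oneDsqr p.1)^-1 * dprod p.2.
  rewrite /dprod big_ord_recl cV_consE0; congr (_ * _).
  by apply: eq_bigr => i _; rewrite cV_consES.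
rewrite [ltLHS](_ : _ = (\int[(@lebesgue_measure R \x lebesgue_cV n)%E]_p
    ((oneDsqr p.1)^-1 * dprod p.2)%:E)%E); last first.
  transitivity (\int[pushforward (@lebesgue_measure R \x lebesgue_cV n)%E
    (@cV_cons R n)]_x (dprod x)%:E)%E; first by [].
  rewrite (ge0_integral_pushforward mc)//.
  - by apply: eq_integral => p _; rewrite -E.
  - by apply/measurable_EFinP; exact: measurable_dprod.
  - by move=> x _; rewrite lee_fin dprod_ge0.
have m1 : measurable_fun setT (fun p : measurableTypeR R * 'cV[R]_n =>
    (oneDsqr p.1)^-1 : R).
  exact: (measurableT_comp (continuous_measurable_fun (@continuous_oneDsqrV R))
    measurable_fst).
pose k (p : measurableTypeR R * 'cV[R]_n) := ((oneDsqr p.1)^-1 * dprod p.2)%:E.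
have mk : measurable_fun setT k.
  apply/measurable_EFinP/measurable_funM => //.
  exact: (measurableT_comp (@measurable_dprod n) measurable_snd).
have k0 p : (0 <= k p)%E.
  rewrite lee_fin; apply: mulr_ge0; last exact: dprod_ge0.
  exact: oneDsqrV_ge0.
rewrite [ltLHS](_ : _ = \int[@lebesgue_measure R]_x \int[lebesgue_cV n]_y
    ((oneDsqr x)^-1 * dprod y)%:E)%E; last first.
  exact: (@fubini_tonelli1 _ _ _ _ _ (@lebesgue_measure R) (lebesgue_cV n) k mk k0).
have F0 y : (0 <= (@dprod n y)%:E)%E by rewrite lee_fin dprod_ge0.
have G0 (x : R) : (0 <= ((oneDsqr x)^-1)%:E)%E by rewrite lee_fin oneDsqrV_ge0.
have mF : measurable_fun setT (fun y => (@dprod n y)%:E).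
  by apply/measurable_EFinP; exact: measurable_dprod.
have mG : measurable_fun setT (fun x : measurableTypeR R => ((oneDsqr x)^-1)%:E).
  apply/measurable_EFinP.
  by apply: continuous_measurable_fun; exact: continuous_oneDsqrV.
rewrite [ltLHS](_ : _ = (\int[@lebesgue_measure R]_x ((oneDsqr x)^-1)%:E) *
   (\int[lebesgue_cV n]_y (dprod y)%:E))%E; last first.
  rewrite -ge0_integralZr//; last by apply: integral_ge0.
  by apply: eq_integral => x _; rewrite -ge0_integralZl.
have I0 : (0 <= \int[lebesgue_cV n]_y (dprod y)%:E)%E.
  by apply: integral_ge0 => x _; rewrite lee_fin dprod_ge0.
have J0 : (0 <= \int[@lebesgue_measure R]_x ((oneDsqr x)^-1)%:E)%E.
  by apply: integral_ge0 => x _; rewrite lee_fin oneDsqrV_ge0.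
rewrite -(fineK (x := \int[lebesgue_cV n]_y _)%E) ?ge0_fin_numE//.
rewrite -(fineK (x := \int[@lebesgue_measure R]_x _)%E) ?ge0_fin_numE//.
  by rewrite -EFinM ltry.
exact: integral_oneDsqrV_lty.
Qed.

End integrable_decay.

(** * The Fourier transform of test functions *)

Section real_fourier.
Context {R : realType} {n : nat}.
Local Notation mu := (lebesgue_cV n).
Local Notation rint f := (mu.-integrable setT (EFin \o f)).
Implicit Types (F H : 'cV[R]_n -> R).

Definition rtest F := Cinf F /\ bsupp F.

Lemma rtest_D F v : rtest F -> rtest ('D_v F).
Proof. by move=> [CF bF]; split; [exact: Cinf_D|exact: bsupp_D]. Qed.

Lemma rtestMl F H : rtest F -> Cinf H -> rtest (fun x => H x * F x).
Proof.
move=> [CF [r rF]] CH; split; first by move=> k; exact: CkM.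
by exists r => x rx; rewrite rF// mulr0.
Qed.

Lemma rtestMr F H : rtest F -> Cinf H -> rtest (fun x => F x * H x).
Proof. by move=> tF CH; under eq_fun do rewrite mulrC; exact: rtestMl. Qed.

Lemma rtestZ F a : rtest F -> rtest (fun x => a * F x).
Proof. by move=> tF; apply: rtestMl => // k; exact: Ck_cst. Qed.

Lemma rtestDf F H : rtest F -> rtest H -> rtest (fun x => F x + H x).
Proof.
move=> [CF [r rF]] [CH [s sH]]; split; first by move=> k; exact: CkDf.
exists (Num.max r s) => x; rewrite gt_max => /andP[rx sx].
by rewrite rF// sH// addr0.
Qed.

Lemma rtest_rint F : rtest F -> rint F.
Proof.
by move=> [CF bF]; apply: rint_continuous_bsupp => //; exact: Cinf_continuous.
Qed.

Lemma rtest_measurable F : rtest F -> measurable_fun setT F.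
Proof.
by move=> [CF _]; apply: measurable_fun_continuous; exact: Cinf_continuous.
Qed.

Lemma Cinf_dotp2 c v a : Cinf (fun x : 'cV[R]_n => c * dotp v x + a).
Proof.
move=> k; rewrite (_ : (fun _ => _) = fun x => dotp x (c *: v) + a).
  exact: Ck_dotp.
by apply/funext => x; rewrite dotpZr dotpC.
Qed.

Lemma Cinf_dotp0 c v : Cinf (fun x : 'cV[R]_n => c * dotp v x).
Proof. by have := Cinf_dotp2 c v 0; under eq_fun do rewrite addr0. Qed.

Lemma norm_cos_le1 (t : R) : `|cos t| <= 1.
Proof. by rewrite ler_norml cos_geN1 cos_le1. Qed.

Lemma norm_sin_le1 (t : R) : `|sin t| <= 1.
Proof. by rewrite ler_norml sin_geN1 sin_le1. Qed.

Lemma is_derive_cos_affine (a b c : R) (h : R) :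
  is_derive h 1 (fun h => a * cos (b * h + c))
    (a * (b * cos (b * h + (c + pi / 2)))).
Proof.
have H1 : is_derive h 1 (fun h : R => b * h + c) b.
  have -> : (fun h : R => b * h + c) = (b \*: id) + cst c by apply/funext.
  have := is_deriveD (is_deriveZ b (is_derive_id h (1 : R))) (is_derive_cst c h 1).
  by rewrite addr0 /GRing.scale/= mulr1.
have := is_deriveZ a (@is_derive1_comp _ cos (fun t => b * t + c) h _ _
  (is_derive_cos (b * h + c)) H1).
by move=> H; apply: (is_derive_eq H); rewrite addrA cosDpihalf /GRing.scale/=; ring.
Qed.

(** A real Fourier integral with a phase: [t = 0] gives the cosine transform and [t = - (pi / 2)]
    the sine transform. Deriving in [x] and multiplying by a coordinate both stay in the family and
    add [pi / 2] to the phase, so that no complex-valued calculus is needed. *)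
Definition vft F (t : R) (x : 'cV[R]_n) : R :=
  \int[mu]_xi (F xi * cos (2 * pi * dotp x xi + t)).

Lemma rtest_vft F t x : rtest F -> rtest (fun xi => F xi * cos (2 * pi * dotp x xi + t)).
Proof.
move=> tF; apply: rtestMr => // k.
by apply: Ck_cos; exact: Cinf_dotp2.
Qed.

Lemma is_derive_vft F t x w : rtest F ->
  is_derive x w (vft F t) (vft (fun xi => 2 * pi * dotp w xi * F xi) (t + pi / 2) x).
Proof.
move=> tF; pose f h xi := F xi * cos (2 * pi * dotp w xi * h + (2 * pi * dotp x xi + t)).
have fE h xi : f h xi = F xi * cos (2 * pi * dotp (h *: w + x) xi + t).
  by rewrite /f dotpDl dotpZl; congr (_ * cos _); ring.
pose G xi := `|2 * pi * dotp w xi * F xi|.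
have tG : rtest (fun xi => 2 * pi * dotp w xi * F xi).
  by apply: rtestMl => //; exact: Cinf_dotp0.
have df h xi := is_derive_cos_affine (F xi) (2 * pi * dotp w xi) (2 * pi * dotp x xi + t) h.
have C : h^-1 *: (\int[mu]_xi f (h + 0) xi - \int[mu]_xi f 0 xi) @[h --> 0^'] -->
    \int[mu]_xi (partial1of2 f) 0 xi.
  apply: (@cvg_differentiation_under_integral R _ _ mu f setT measurableT 0 (-1) 1 _ _ _ G).
  - by rewrite /= in_itv/= ltrN10 ltr01.
  - move=> h _; rewrite (funext (fE h)).
    by apply: rtest_rint; exact: rtest_vft.
  - by move=> h xi _ _; have [] := df h xi.
  - by move=> xi; exact: normr_ge0.
  - by apply: rint_norm; exact: rtest_rint.
  - move=> h xi _ _; rewrite partial1of2E; have [_ ->] := df h xi.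
    rewrite /G mulrA [X in `|X|]mulrC (mulrC (F xi)) normrM.
    by rewrite ler_piMl// norm_cos_le1.
have E0 : \int[mu]_xi (partial1of2 f) 0 xi =
    vft (fun xi => 2 * pi * dotp w xi * F xi) (t + pi / 2) x.
  apply: eq_Rintegral => xi _; rewrite partial1of2E; have [_ ->] := df 0 xi.
  by rewrite mulr0 add0r addrA mulrA (mulrC (F xi)).
have C' : h^-1 *: (vft F t (h *: w + x) - vft F t x) @[h --> 0^'] -->
    vft (fun xi => 2 * pi * dotp w xi * F xi) (t + pi / 2) x.
  rewrite -E0; apply: cvg_trans C; apply: near_eq_cvg; apply: nearW => h.
  rewrite addr0; congr (_ *: (_ - _)); apply: eq_Rintegral => xi _; rewrite fE//.
  by rewrite scale0r add0r.
by apply: DeriveDef; [apply/cvg_ex; eexists; exact: C'|exact: cvg_lim].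
Qed.

Lemma cos_lip (a b : R) : `|cos a - cos b| <= `|a - b|.
Proof.
wlog ab : a b / b <= a.
  by move=> H; have [/H//|/ltW/H] := leP b a; rewrite distrC (distrC b).
have [c _ ->] := @MVT_segment R cos (fun x => - sin x) b a ab
  (fun x _ => is_derive_cos x) (continuous_subspaceT (@continuous_cos R)).
by rewrite normrM ler_piMl// normrN norm_sin_le1.
Qed.

(** Existence of directional derivatives does not give continuity, whence this separate Lipschitz
    estimate, with the first absolute moment of [F] as constant up to a factor. *)
Lemma continuous_vft F t : rtest F -> continuous (vft F t).
Proof.
move=> tF x; pose D := \int[mu]_xi (2 * pi * n%:R * `|xi| * `|F xi|).
have [r rF] := tF.2.
have iD : rint (fun xi => 2 * pi * n%:R * `|xi| * `|F xi|).
  apply: rint_continuous_bsupp.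
    move=> y; apply: (@cvgM _ _ (nbhs y) _ (fun y => 2 * pi * n%:R * `|y|) (fun y => `|F y|)).
      apply: (@cvgM _ _ (nbhs y) _ (cst (2 * pi * n%:R)) (fun y : 'cV[R]_n => `|y|)).
        exact: cvg_cst.
      exact: norm_continuous.
    by apply: cvg_norm; exact: (Cinf_continuous tF.1).
  by exists r => y ry; rewrite rF// normr0 mulr0.
have D0 : 0 <= D.
  by apply: Rintegral_ge0 => xi _; rewrite !mulr_ge0// pi_ge0.
have lip y : `|vft F t x - vft F t y| <= D * `|x - y|.
  have i1 z := rtest_rint (rtest_vft t z tF).
  rewrite -RintegralB//.
  apply: le_trans (le_normr_Rintegral _ (rintB (i1 x) (i1 y))) _ => //.
  rewrite [leRHS]mulrC /D -RintegralZl//.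
  apply: le_Rintegral => //; [exact: (rint_norm (rintB (i1 x) (i1 y)))|exact: rintZ|].
  move=> xi _; rewrite -mulrBr normrM mulrC !mulrA ler_wpM2r//.
  apply: le_trans (cos_lip _ _) _.
  rewrite opprD addrACA subrr addr0 -mulrBr -dotpBl normrM ger0_norm ?mulr_ge0 ?pi_ge0//.
  rewrite (_ : `|x - y| * 2 * pi * n%:R * `|xi| = 2 * pi * (n%:R * (`|x - y| * `|xi|))); last by ring.
  by rewrite ler_wpM2l ?mulr_ge0 ?pi_ge0// dotp_norm.
apply/(@cvgrPdist_le _ _ _ (nbhs x)) => e e0; apply/nbhs_ballP.
have D1 : 0 < D + 1 by rewrite ltr_wpDl.
exists ((D + 1)^-1 * e) => [|y]; first by rewrite /= mulr_gt0// invr_gt0.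
rewrite -ball_normE /= => xy; apply: le_trans (lip y) _.
apply: (@le_trans _ _ ((D + 1) * `|x - y|)); first by rewrite ler_wpM2r// lerDl.
by rewrite -ler_pdivlMl// ltW.
Qed.

Lemma Cinf_vft F t : rtest F -> Cinf (vft F t).
Proof.
move=> tF k; elim: k F t tF => [|k IHk] F t tF; split=> //; try exact: continuous_vft.
move=> w; split=> [x|]; first by have [] := is_derive_vft t x w tF.
rewrite (_ : 'D_w _ = vft (fun xi => 2 * pi * dotp w xi * F xi) (t + pi / 2)); last first.
  by apply/funext => x; have [_ ->] := is_derive_vft t x w tF.
by apply: IHk; apply: rtestMl => //; exact: Cinf_dotp0.
Qed.

Lemma derive_vft F t w : rtest F ->
  'D_w (vft F t) = vft (fun xi => 2 * pi * dotp w xi * F xi) (t + pi / 2).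
Proof.
by move=> tF; apply/funext => x; have [_ ->] := is_derive_vft t x w tF.
Qed.

Lemma vft_bounded F t x : rtest F -> `|vft F t x| <= \int[mu]_xi `|F xi|.
Proof.
move=> tF; have i1 := rtest_rint (rtest_vft t x tF).
apply: le_trans (le_normr_Rintegral _ i1) _ => //.
apply: le_Rintegral => //; [exact: (rint_norm i1)|exact/rint_norm/rtest_rint|].
by move=> xi _; rewrite normrM ler_piMr// norm_cos_le1.
Qed.

(* The integral of [H] is invariant under translation by [h *: w], so that its
   derivative in [h] vanishes. *)
Lemma Rintegral_derive0 H w : rtest H -> \int[mu]_x 'D_w H x = 0.
Proof.
move=> tH; pose f h x := H (h *: w + x).
have df (h : R) x : is_derive h 1 (f ^~ x) ('D_w H (h *: w + x)).
  have D : derivable H (h *: w + x) w by exact: Cinf_derivable tH.1.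
  have E : (fun k => k^-1 *: ((H \o shift (h *: w + x)) (k *: w) - H (h *: w + x))) =
      (fun k => k^-1 *: ((f^~ x \o shift h) (k *: 1) - f h x)).
    apply/funext => k; rewrite /f /= scalerDl addrA [k *: 1]mulr1.
    by [].
  by apply: DeriveDef; [rewrite /derivable -E|rewrite /derive -E].
have [M M0 HM] := continuous_bsupp_bounded (Cinf_continuous (Cinf_D w tH.1)) (bsupp_D w tH.2).
have [r r0 rH] := bsupp_pos (bsupp_D w tH.2).
(* For [h] between -1 and 1 the support translated by [h *: w] stays in this box, which gives a
   majorant independent of [h]. *)
pose B : set 'cV[R]_n := box (fun=> - (r + `|w|)) (fun=> r + `|w|).
have iB : rint (fun x => M * \1_B x).
  apply: rintZ; apply: rint_ge0P => //.
    by apply: measurable_indic; exact: measurable_box.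
  by rewrite integral_indic ?setIT//; [exact: lebesgue_box_lty|exact: measurable_box].
have C : h^-1 *: (\int[mu]_x f (h + 0) x - \int[mu]_x f 0 x) @[h --> 0^'] -->
    \int[mu]_x (partial1of2 f) 0 x.
  apply: (@cvg_differentiation_under_integral R _ _ mu f setT measurableT 0 (-1) 1 _ _ _
    (fun x => M * \1_B x)).
  - by rewrite /= in_itv/= ltrN10 ltr01.
  - move=> h _; rewrite (_ : f h = fun x => H (x + h *: w)).
      exact: (integrable_transl (h *: w) (rtest_rint tH)).
    by apply/funext => x; rewrite /f addrC.
  - by move=> h x _ _; have [] := df h x.
  - by move=> x; rewrite mulr_ge0// ltW.
  - exact: iB.
  - move=> h x; rewrite /= in_itv/= => /andP[h1 h2] _.
    rewrite partial1of2E; have [_ ->] := df h x.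
    have [xB|xB] := boolP (x \in B); first by rewrite indicE xB mulr1.
    rewrite rH ?normr0 ?mulr_ge0 ?(ltW M0)// ltNge; apply: contra xB => xr.
    rewrite inE => i; rewrite in_itv/= -ler_norml.
    apply: le_trans (mx_norm_coord _ _ _) _.
    rewrite -[x](addKr (h *: w)) addrC; apply: le_trans (ler_normB _ _) _.
    rewrite lerD// normrZ ler_piMl// ler_norml.
    by rewrite !ltW.
have E0 : \int[mu]_x (partial1of2 f) 0 x = \int[mu]_x 'D_w H x.
  apply: eq_Rintegral => x _; rewrite partial1of2E; have [_ ->] := df 0 x.
  by rewrite scale0r add0r.
have K h : \int[mu]_x f h x = \int[mu]_x H x.
  rewrite -(Rintegral_transl (h *: w) (rtest_rint tH)).
  by apply: eq_Rintegral => x _; rewrite /f addrC.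
have C0 : h^-1 *: (\int[mu]_x f (h + 0) x - \int[mu]_x f 0 x) @[h --> 0^'] --> (0 : R).
  by under eq_cvg do rewrite !K subrr scaler0; exact: cvg_cst.
by rewrite -E0; exact: cvg_unique C C0.
Qed.

(** Integration by parts: the derivative of [F xi * sin (L xi)] has integral 0. The sine is chosen
    because its derivative restores the cosine of [vft], with [2 * pi * x i 0] as a factor. *)
Lemma mulr_vft F t (i : 'I_n) (x : 'cV[R]_n) : rtest F ->
  2 * pi * x i 0 * vft F t x = vft ('D_(delta_mx i 0) F) (t + pi / 2) x.
Proof.
move=> tF; set w : 'cV[R]_n := delta_mx i 0.
pose L xi := 2 * pi * dotp x xi + t.
pose H xi := F xi * sin (L xi).
have CL : Cinf L by exact: Cinf_dotp2.
have Csin : Cinf (fun xi => sin (L xi)) by move=> k; exact: Ck_sin.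
have tH : rtest H by exact: rtestMr.
have LE : L = fun xi => dotp xi (2 * pi *: x) + t.
  by apply/funext => xi; rewrite /L dotpZr dotpC.
have dH xi : 'D_w H xi =
    'D_w F xi * sin (L xi) + 2 * pi * x i 0 * (F xi * cos (L xi)).
  have dL := is_derive_dotp (2 * pi *: x) t xi w; rewrite -LE in dL.
  have ds := is_derive_comp1 (is_derive_sin (L xi)) (@ex_derive _ _ _ _ _ _ _ dL).
  have dF : derivable F xi w by exact: Cinf_derivable tF.1.
  have dS : derivable (sin \o L) xi w by have [] := ds.
  rewrite (_ : H = F * (sin \o L))//; rewrite (deriveM dF dS).
  have [_ ->] := ds; have [_ ->] := dL.
  by rewrite dotpC dotp_delta mxE /GRing.scale/=; ring.
have i1 : rint (fun xi => 'D_w F xi * sin (L xi)).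
  by apply: rtest_rint; apply: rtestMr => //; exact: rtest_D.
have i2 : rint (fun xi => F xi * cos (L xi)).
  by apply: rtest_rint; exact: rtest_vft.
have := Rintegral_derive0 w tH; rewrite (funext dH).
rewrite RintegralD//; last exact: rintZ.
rewrite RintegralZl// => /eqP; rewrite addrC addr_eq0 => /eqP ->.
rewrite -mulN1r -RintegralZl//; apply: eq_Rintegral => xi _.
by rewrite addrA cosDpihalf mulrN mulN1r.
Qed.

End real_fourier.

Section vft_decay.
Context {R : realType} {n : nat}.
Local Notation mu := (lebesgue_cV n).
Local Notation rint f := (mu.-integrable setT (EFin \o f)).
Implicit Types (F H : 'cV[R]_n -> R).

Lemma vftZ F a t x : rtest F -> a * vft F t x = vft (fun xi => a * F xi) t x.
Proof.
move=> tF; rewrite -RintegralZl//; last exact/rtest_rint/rtest_vft.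
by apply: eq_Rintegral => xi _; rewrite mulrA.
Qed.

Lemma vftD F H t x : rtest F -> rtest H ->
  vft F t x + vft H t x = vft (fun xi => F xi + H xi) t x.
Proof.
move=> tF tH; rewrite -RintegralD//; [|exact/rtest_rint/rtest_vft..].
by apply: eq_Rintegral => xi _; rewrite -mulrDl.
Qed.

Lemma mulx_vft F t (i : 'I_n) (x : 'cV[R]_n) : rtest F ->
  x i 0 * vft F t x =
  vft (fun xi => (2 * pi)^-1 * 'D_(delta_mx i 0) F xi) (t + pi / 2) x.
Proof.
move=> tF; rewrite -vftZ; last exact: rtest_D.
by rewrite -mulr_vft// -(mulrA (2 * pi)) mulKf// mulf_neq0// lt0r_neq0// pi_gt0.
Qed.

(** Multiplying twice by a coordinate shifts the phase by [pi], which is a change of sign; hence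
    [1 + x_i^2] acts within transforms of the same phase. One such factor per coordinate yields the
    decay by [dprod]. *)
Lemma oneDsqr_vft F (i : 'I_n) : rtest F -> exists2 F', rtest F' &
  forall t (x : 'cV[R]_n), oneDsqr (x i 0) * vft F t x = vft F' t x.
Proof.
move=> tF; pose w : 'cV[R]_n := delta_mx i 0.
pose F1 xi := (2 * pi)^-1 * 'D_w F xi; have tF1 : rtest F1 by exact/rtestZ/rtest_D.
pose F2 xi := (2 * pi)^-1 * 'D_w F1 xi; have tF2 : rtest F2 by exact/rtestZ/rtest_D.
exists (fun xi => F xi + -1 * F2 xi); first by apply: rtestDf => //; exact: rtestZ.
move=> t x; rewrite -vftD//; last exact: rtestZ.
rewrite /oneDsqr mulrDl mul1r expr2 -mulrA mulx_vft// mulx_vft//; congr (_ + _).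
apply: eq_Rintegral => xi _.
by rewrite !addrA !cosDpihalf sinDpihalf -[X in X * _ = _]/(F2 xi); ring.
Qed.

Lemma vft_decay F : rtest F -> exists2 M : R, 0 <= M &
  forall t x, `|vft F t x| <= M * dprod x.
Proof.
move=> tF.
have H (s : seq 'I_n) : exists2 F', rtest F' &
    forall t (x : 'cV[R]_n), \prod_(i <- s) oneDsqr (x i 0) * vft F t x = vft F' t x.
  elim: s => [|i s [F' tF' HF']].
    by exists F => // t x; rewrite big_nil mul1r.
  have [F2 tF2 HF2] := oneDsqr_vft i tF'; exists F2 => // t x.
  by rewrite big_cons -mulrA HF' HF2.
have [F' tF' HF'] := H (index_enum 'I_n).
exists (\int[mu]_xi `|F' xi|); first by apply: Rintegral_ge0.
move=> t x; have := vft_bounded t x tF'; rewrite -HF' normrM.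
have P0 : 0 < \prod_i oneDsqr (x i 0).
  by apply: prodr_gt0 => i _; exact: lt_le_trans ltr01 (oneDsqr_ge1 _).
by rewrite gtr0_norm// /dprod prodfV mulrC ler_pdivlMr.
Qed.

Lemma vft_schwartz F t (a : 'I_n -> nat) (s : seq 'I_n) : rtest F ->
  exists M : R, forall x : 'cV[R]_n, `|\prod_(i < n) x i 0 ^+ a i * partials s (vft F t) x| <= M.
Proof.
move=> tF.
(* With [F] and [t] left free, these functions are stable under partial derivatives and
   multiplication by coordinates, and each of them is bounded; this is all that the Schwartz
   seminorms ask for. *)
pose P (u : 'cV[R]_n -> R) := exists F t, rtest F /\ u = vft F t.
have P0 : P (partials s (vft F t)).
  elim: s => [|i s [F' [t' [tF' E]]]]; first by exists F, t.
  rewrite /= E derive_vft//; eexists; eexists; split; last reflexivity.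
  by apply: rtestMl => //; exact: Cinf_dotp0.
have PM u (i : 'I_n) : P u -> P (fun x : 'cV[R]_n => x i 0 * u x).
  move=> [F' [t' [tF' ->]]]; eexists; eexists; split; last first.
    by apply/funext => x; rewrite mulx_vft.
  exact/rtestZ/rtest_D.
have PX u (i : 'I_n) k : P u -> P (fun x : 'cV[R]_n => x i 0 ^+ k * u x).
  elim: k => [|k IHk] Pu; first by under eq_fun do rewrite expr0 mul1r.
  by under eq_fun do rewrite exprS -mulrA; exact/PM/IHk.
have PP r u : P u -> P (fun x : 'cV[R]_n => \prod_(i <- r) x i 0 ^+ a i * u x).
  move=> Pu; elim: r => [|i r IHr]; first by under eq_fun do rewrite big_nil mul1r.
  by under eq_fun do rewrite big_cons -mulrA; exact: PX.
have [F' [t' [tF' E]]] := PP (index_enum 'I_n) _ P0.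
exists (\int[mu]_xi `|F' xi|) => x.
by rewrite (_ : _ * _ = vft F' t' x) ?vft_bounded// -E.
Qed.

End vft_decay.

(** * Complex test functions and their inverse transforms *)

Section complex_fourier.
Context {R : realType} {n : nat}.
Local Notation mu := (lebesgue_cV n).
Local Notation rint f := (mu.-integrable setT (EFin \o f)).
Local Notation C := R[i].
Implicit Types (F G : 'cV[R]_n -> C).

Definition ctest F := rtest (fun x => Re (F x)) /\ rtest (fun x => Im (F x)).

Definition ift F (x : 'cV[R]_n) : C :=
  cintegral (fun xi => F xi * cexpi (2 * pi * dotp x xi)).

Lemma ctestD F G : ctest F -> ctest G -> ctest (fun x => F x + G x).
Proof.
move=> [F1 F2] [G1 G2]; split.
  by under eq_fun do rewrite cReD; exact: rtestDf.
by under eq_fun do rewrite cImD; exact: rtestDf.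
Qed.

Lemma ctestM F (g : 'cV[R]_n -> C) : ctest F -> Cinf (fun x => Re (g x)) ->
  Cinf (fun x => Im (g x)) -> ctest (fun x => F x * g x).
Proof.
move=> [F1 F2] g1 g2; split.
  under eq_fun do rewrite cReM -mulN1r.
  by apply: rtestDf; [|apply: rtestZ]; exact: rtestMr.
by under eq_fun do rewrite cImM; apply: rtestDf; exact: rtestMr.
Qed.

Lemma ctestZ F a : ctest F -> ctest (fun x => a * F x).
Proof.
move=> tF; under eq_fun do rewrite mulrC.
by apply: ctestM => // k; exact: Ck_cst.
Qed.

Lemma ctest_modulation F v : ctest F ->
  ctest (fun x => F x * cexpi (2 * pi * dotp v x)).
Proof.
by move=> tF; apply: ctestM => // k /=; [apply: Ck_cos|apply: Ck_sin];
  exact: Cinf_dotp0.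
Qed.

Lemma rtest_affine (M : 'M[R]_n) c (f : 'cV[R]_n -> R) : M \in unitmx ->
  rtest f -> rtest (fun x => f (M *m x + c)).
Proof.
move=> uM [Cf bf]; split; first by move=> k; exact: Ck_affine.
have [r r0 rf] := bsupp_pos bf; have [D D0 HD] := mulmx_bound (invmx M).
exists (D * (r + `|c|)) => x; rewrite -ltr_pdivlMl// => Hx; apply: rf.
have := HD (M *m x); rewrite mulKmx// -ler_pdivrMl// => H2.
have := lt_le_trans Hx H2; rewrite -ltrBrDr => /lt_le_trans; apply.
by rewrite lerBlDr -[in leLHS](addrK c (M *m x)) ler_normB.
Qed.

Lemma ctest_affine (M : 'M[R]_n) c F : M \in unitmx ->
  ctest F -> ctest (fun x => F (M *m x + c)).
Proof.
move=> uM [F1 F2]; split.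
  exact: (rtest_affine c uM (f := fun x => Re (F x))).
exact: (rtest_affine c uM (f := fun x => Im (F x))).
Qed.

Lemma ctest_real (f : 'cV[R]_n -> R) : rtest f -> ctest (fun x => (f x +i* 0)%C).
Proof.
move=> tf; split => //=; split; first by move=> k; exact: Ck_cst.
by exists 0.
Qed.

Lemma ctest_cintegrable F : ctest F -> cintegrable F.
Proof. by move=> [F1 F2]; split; exact: rtest_rint. Qed.

Lemma ctest_cmeasurable F : ctest F -> cmeasurable F.
Proof. by move=> [F1 F2]; split; exact: rtest_measurable. Qed.

Lemma ctest_bounded F : ctest F -> exists2 M : R, 0 < M & forall x, normc (F x) <= M.
Proof.
move=> [[C1 b1] [C2 b2]].
have [M1 M10 H1] := continuous_bsupp_bounded (Cinf_continuous C1) b1.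
have [M2 M20 H2] := continuous_bsupp_bounded (Cinf_continuous C2) b2.
exists (M1 + M2) => [|x]; first exact: addr_gt0.
by apply: le_trans (normc_le_ReIm _) _; exact: lerD.
Qed.

Lemma ctest_L2 F : ctest F -> L2 F.
Proof.
move=> tF; have [M M0 FM] := ctest_bounded tF.
have mF := ctest_cmeasurable tF; apply: rint_L2 => //.
apply: rint_le (rintZ M (rint_normc (ctest_cintegrable tF))) _.
  exact: measurable_normc_sqr.
by move=> x; rewrite ger0_norm ?sqr_ge0// expr2 ler_wpM2r ?normc_ge0.
Qed.

Lemma cosBpi2 (a : R) : cos (a + (- (pi / 2))) = sin a.
Proof. exact: cosBpihalf. Qed.

Lemma Re_ift F x : ctest F ->
  Re (ift F x) = vft (fun x => Re (F x)) 0 x - vft (fun x => Im (F x)) (- (pi / 2)) x.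
Proof.
move=> [F1 F2]; rewrite /= -RintegralB//; [|exact/rtest_rint/rtest_vft..].
by apply: eq_Rintegral => xi _; rewrite cReM/= addr0 cosBpi2.
Qed.

Lemma Im_ift F x : ctest F ->
  Im (ift F x) = vft (fun x => Re (F x)) (- (pi / 2)) x + vft (fun x => Im (F x)) 0 x.
Proof.
move=> [F1 F2]; rewrite /= -RintegralD//; [|exact/rtest_rint/rtest_vft..].
by apply: eq_Rintegral => xi _; rewrite cImM/= addr0 cosBpi2.
Qed.

Lemma ift_decay F : ctest F -> exists2 M : R, 0 <= M &
  forall x, normc (ift F x) <= M * dprod x.
Proof.
move=> tF; have [F1 F2] := tF.
have [M1 M10 H1] := vft_decay F1; have [M2 M20 H2] := vft_decay F2.
exists (2 * (M1 + M2)) => [|x]; first by rewrite mulr_ge0 ?addr_ge0.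
apply: le_trans (normc_le_ReIm _) _; rewrite Re_ift// Im_ift//.
apply: le_trans (lerD (ler_normB _ _) (ler_normD _ _)) _.
apply: le_trans (lerD (lerD (H1 _ _) (H2 _ _)) (lerD (H1 _ _) (H2 _ _))) _.
by rewrite le_eqVlt; apply/orP; left; apply/eqP; ring.
Qed.

Lemma Cinf_Re_ift F : ctest F -> Cinf (fun x => Re (ift F x)).
Proof.
move=> tF k; have [F1 F2] := tF; under eq_fun do rewrite Re_ift// -mulN1r.
by apply: CkDf; [|apply: CkM; first exact: Ck_cst]; exact: Cinf_vft.
Qed.

Lemma Cinf_Im_ift F : ctest F -> Cinf (fun x => Im (ift F x)).
Proof.
move=> tF k; have [F1 F2] := tF; under eq_fun do rewrite Im_ift//.
by apply: CkDf; exact: Cinf_vft.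
Qed.

Lemma cmeasurable_ift F : ctest F -> cmeasurable (ift F).
Proof.
by move=> tF; split; apply: measurable_fun_continuous; apply: Cinf_continuous;
  [exact: Cinf_Re_ift|exact: Cinf_Im_ift].
Qed.

Lemma cintegrable_ift F : ctest F -> cintegrable (ift F).
Proof.
move=> tF; have [M M0 HM] := ift_decay tF.
exact: cintegrable_le (cmeasurable_ift tF) (rintZ M (rint_dprod n)) HM.
Qed.

Lemma ift_bounded F : ctest F -> exists2 M : R, 0 <= M & forall x, normc (ift F x) <= M.
Proof.
move=> tF; exists (2 * \int[mu]_x normc (F x)) => [|x].
  by rewrite mulr_ge0// Rintegral_ge0// => x _; exact: normc_ge0.
have i1 : cintegrable (fun xi => F xi * cexpi (2 * pi * dotp x xi)).
  by apply/ctest_cintegrable/ctest_modulation.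
apply: le_trans (normc_cintegral_le i1) _.
rewrite ler_pM2l// le_eqVlt; apply/orP; left; apply/eqP.
by apply: eq_Rintegral => xi _; rewrite normcM normc_cexpi mulr1.
Qed.

Lemma L2_ift F : ctest F -> L2 (ift F).
Proof.
move=> tF; have [M M0 HM] := ift_bounded tF.
have mF := cmeasurable_ift tF; apply: rint_L2 => //.
apply: rint_le (rintZ M (rint_normc (cintegrable_ift tF))) _.
  exact: measurable_normc_sqr.
by move=> x; rewrite ger0_norm ?sqr_ge0// expr2 ler_wpM2r ?normc_ge0.
Qed.

Lemma schwartz_ift (f : 'cV[R]_n -> R) : rtest f ->
  schwartz (ift (fun x => (f x +i* 0)%C)).
Proof.
move=> tf; have tF := ctest_real tf.
have z t x : vft (fun _ : 'cV[R]_n => 0 : R) t x = 0.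
  by rewrite /vft; under eq_Rintegral do rewrite mul0r; rewrite /Rintegral integral0.
have E1 : (fun x => Re (ift (fun x => (f x +i* 0)%C) x)) = vft f 0.
  by apply/funext => x; rewrite Re_ift//= z subr0.
have E2 : (fun x => Im (ift (fun x => (f x +i* 0)%C) x)) = vft f (- (pi / 2)).
  by apply/funext => x; rewrite Im_ift//= z addr0.
split; first by split; apply: Cinf_smooth; [exact: Cinf_Re_ift|exact: Cinf_Im_ift].
move=> a s; rewrite /cpartials E1 E2.
have [M1 H1] := vft_schwartz 0 a s tf; have [M2 H2] := vft_schwartz (- (pi / 2)) a s tf.
exists (M1 + M2) => x; apply: (@le_trans _ _ (`|\prod_(i < n) x i 0 ^+ a i| *
  (`|partials s (vft f 0) x| + `|partials s (vft f (- (pi / 2))) x|))).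
  by rewrite ler_wpM2l// normc_le_ReIm.
by rewrite mulrDr -!normrM lerD.
Qed.

End complex_fourier.

Section cmeas.
Context {R : realType} d (T : measurableType d).
Implicit Types f g : T -> R[i].

Definition cmeas f := measurable_fun setT (fun z => Re (f z)) /\
  measurable_fun setT (fun z => Im (f z)).

Lemma cmeasM f g : cmeas f -> cmeas g -> cmeas (fun z => f z * g z).
Proof.
move=> [f1 f2] [g1 g2]; split.
  under eq_fun do rewrite cReM.
  by apply: measurable_funB; exact: measurable_funM.
under eq_fun do rewrite cImM.
by apply: measurable_funD; exact: measurable_funM.
Qed.

Lemma cmeas_comp n (f : 'cV[R]_n -> R[i]) (h : T -> 'cV[R]_n) : cmeasurable f ->
  measurable_fun setT h -> cmeas (fun z => f (h z)).
Proof.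
by move=> [f1 f2] mh; split; [exact: (measurableT_comp f1)|
  exact: (measurableT_comp f2)].
Qed.

Lemma cmeas_cexpi (h : T -> R) : measurable_fun setT h ->
  cmeas (fun z => cexpi (h z)).
Proof.
move=> mh; split.
  apply: (measurableT_comp _ mh).
  by apply: continuous_measurable_fun; exact: continuous_cos.
apply: (measurableT_comp _ mh).
by apply: continuous_measurable_fun; exact: continuous_sin.
Qed.

Lemma measurable_dotp n (h k : T -> 'cV[R]_n) :
  measurable_fun setT h -> measurable_fun setT k ->
  measurable_fun setT (fun z => dotp (h z) (k z)).
Proof.
move=> mh mk; apply: measurable_sum => i; apply: measurable_funM.
  exact: (measurableT_comp (measurable_coord i)).
exact: (measurableT_comp (measurable_coord i)).
Qed.

End cmeas.

(** * Fourier inversion and Parseval's identity *)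

Section inversion.
Context {R : realType} {n : nat}.
Local Notation mu := (lebesgue_cV n).
Local Notation rint f := (mu.-integrable setT (EFin \o f)).
Local Notation C := R[i].
Implicit Types (F G : 'cV[R]_n -> C).

Lemma Rintegral_gt0 (f : 'cV[R]_n -> R) x0 : continuous f ->
  (forall x, 0 <= f x) -> rint f -> 0 < f x0 -> 0 < \int[mu]_x f x.
Proof.
move=> cf f0 fi fx0.
have : \forall x \near x0, f x0 / 2 < f x.
  have := cf x0; move=> /(@cvgrPdist_lt _ _ _ (nbhs x0))/(_ (f x0 / 2)).
  rewrite divr_gt0// => /(_ isT); apply: filterS => x.
  by move=> /(le_lt_trans (ler_norm _)); lra.
move=> /nbhs_ballP[e /= e0 He].
pose b := box (fun i => x0 i 0 - e / 2) (fun i => x0 i 0 + e / 2).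
have mb : measurable b by exact: measurable_box.
have e20 : 0 < e / 2 by rewrite divr_gt0.
have ab i : x0 i 0 - e / 2 <= x0 i 0 + e / 2 by lra.
have fb x : f x0 / 2 * \1_b x <= f x.
  have [xb|xb] := boolP (x \in b); rewrite indicE ?xb ?(negbTE xb) ?mulr0// mulr1.
  apply/ltW/He; rewrite -ball_normE /=.
  move: xb; rewrite inE /b ball_box ?(ltW e20)//= => /le_lt_trans; apply.
  by lra.
have ib : rint (fun x => f x0 / 2 * \1_b x).
  apply: rint_le fi _; first by apply: measurable_funM => //; exact: measurable_indic.
  by move=> x; rewrite ger0_norm ?fb// mulr_ge0// ltW// divr_gt0.
have ib1 : rint (fun x => \1_b x : R).
  apply: rint_ge0P => //; first exact: measurable_indic.
  by rewrite integral_indic ?setIT//; exact: lebesgue_box_lty.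
apply: (@lt_le_trans _ _ (\int[mu]_x (f x0 / 2 * \1_b x))).
  rewrite RintegralZl//; apply: mulr_gt0; first by rewrite divr_gt0.
  rewrite /Rintegral integral_indic ?setIT//.
  rewrite [X in fine X](lebesgue_cV_box ab)/=; apply: prodr_gt0 => i _.
  by lra.
by apply: le_Rintegral => // x _; exact: fb.
Qed.

Let w : 'cV[R]_n -> R := bump 0 1.
Let wC (x : 'cV[R]_n) : C := (w x +i* 0)%C.

Lemma rtest_bump (c : 'cV[R]_n) r : 0 < r -> rtest (bump c r).
Proof.
move=> r0; split; first exact: Cinf_bump.
exists (`|c| + r) => x xr; apply: bump_eq0 => //.
by have := ler_normD (x - c) c; rewrite subrK; lra.
Qed.

Let tw : rtest w. Proof. exact: rtest_bump. Qed.
Let twC : ctest wC. Proof. exact: ctest_real. Qed.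
Let w0 : 0 < w 0. Proof. by rewrite /w bump_gt0// subrr normr0. Qed.

(** The numerator is the Fourier transform of [ift wC] at 0: the constant is read off from the
    inversion formula for one test function at one point. *)
Definition fconst : C := cintegral (ift wC) / (w 0 +i* 0)%C.

Let wC0 : (w 0 +i* 0)%C != 0 :> C.
Proof. by apply/eqP => -[] /eqP; rewrite (gt_eqF w0). Qed.


Let eps k : R := k.+1%:R^-1.

Let eps_gt0 k : 0 < eps k. Proof. by rewrite invr_gt0. Qed.

Lemma unitmx_scalar (a : R) : a != 0 -> (a%:M : 'M[R]_n) \in unitmx.
Proof. by move=> a0; rewrite unitmxE det_scalar unitrX// unitfE. Qed.

Lemma cvg_eps (v c : 'cV[R]_n) : eps k *: v + c @[k --> \oo] --> c.
Proof.
have H : eps k *: v @[k --> \oo] --> (0 : 'cV[R]_n).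
  by rewrite -(scale0r v); apply: cvgZr_tmp; exact: cvg_harmonic.
rewrite -[X in _ --> X]add0r; apply: cvgD H _; exact: cvg_cst.
Qed.

Lemma ctest_ccvg F (u : nat -> 'cV[R]_n) (x : 'cV[R]_n) : ctest F ->
  u k @[k --> \oo] --> x -> ccvg (fun k => F (u k)) (F x).
Proof.
move=> [[C1 _] [C2 _]] ux; split.
  exact: (cvg_comp u _ ux (@Cinf_continuous _ _ _ C1 x)).
exact: (cvg_comp u _ ux (@Cinf_continuous _ _ _ C2 x)).
Qed.

(* Fubini turns the regularised inversion integral into a convolution of [F]
   with an approximate identity. *)
Lemma fourier_ift_regularised F xi k : ctest F ->
  cintegral (fun x => ift F x * (wC (eps k *: x) * cexpi (- (2 * pi * dotp x xi)))) =
  cintegral (fun u => F (eps k *: u + xi) * ift wC u).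
Proof.
move=> tF; pose M : 'M[R]_n := (eps k)%:M.
have uM : M \in unitmx by apply: unitmx_scalar; rewrite gt_eqF.
have ME x : M *m x = eps k *: x by rewrite mul_scalar_mx.
have VE x : invmx M *m x = (eps k)^-1 *: x by rewrite invmx_scalar mul_scalar_mx.
have e0 : eps k != 0 by rewrite gt_eqF.
have [Mw Mw0 HMw] := ctest_bounded twC.
have [MF MF0 HMF] := ctest_bounded tF.
pose K x y := F y * wC (eps k *: x) * cexpi (2 * pi * dotp x (y - xi)).
have KE x : ift F x * (wC (eps k *: x) * cexpi (- (2 * pi * dotp x xi))) =
    cintegral (K x).
  rewrite -cintegralZr; last exact/ctest_cintegrable/ctest_modulation.
  apply: eq_cintegral => y; rewrite /K dotpBr mulrBr cexpiD; ring.
rewrite (eq_cintegral KE).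
have mK : cmeas (fun z : 'cV[R]_n * 'cV[R]_n => K z.1 z.2).
  have mF : cmeas (fun z : 'cV[R]_n * 'cV[R]_n => F z.2).
    exact: (cmeas_comp (ctest_cmeasurable tF) measurable_snd).
  apply: cmeasM; first apply: cmeasM => //.
    under eq_fun do rewrite -ME.
    apply: (cmeas_comp (f := fun x => wC (M *m x)) _ measurable_fst).
    exact: (cmeasurable_comp (measurable_fun_mulmx M) (ctest_cmeasurable twC)).
  apply: cmeas_cexpi; apply: measurable_funM => //; apply: measurable_dotp.
    exact: measurable_fst.
  exact: (measurableT_comp (measurable_transl (- xi)) measurable_snd).
have iwM : cintegrable (fun x => wC (M *m x)).
  exact/cintegrable_lscale/ctest_cintegrable.
rewrite (cintegral_fubini mK.1 mK.2 (rint_normc iwM)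
  (rint_normc (ctest_cintegrable tF))); last first.
  by move=> x y; rewrite /K !normcM normc_cexpi mulr1 mulrC ME.
have inner y : cintegral (K ^~ y) =
    F y * ((lscale M +i* 0)%C * ift wC ((eps k)^-1 *: (y - xi))).
  pose h z := wC z * cexpi (2 * pi * dotp ((eps k)^-1 *: (y - xi)) z).
  have ih : cintegrable h by exact/ctest_cintegrable/ctest_modulation.
  rewrite -[ift _ _]/(cintegral h) -cintegral_lscale// -cintegralZ; last first.
    exact: cintegrable_lscale.
  apply: eq_cintegral => x; rewrite /K /h ME dotpZl dotpZr mulKf// mulrA.
  by rewrite (dotpC x).
rewrite (eq_cintegral inner).
pose g z := F (z + xi) * ((lscale M +i* 0)%C * ift wC ((eps k)^-1 *: z)).
have [N N0 HN] := ift_bounded twC.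
have mexp : cmeasurable (fun y => (lscale M +i* 0)%C * ift wC ((eps k)^-1 *: (y - xi))).
  apply: cmeasurableZ; under eq_fun do rewrite -VE.
  apply: (cmeasurable_comp (f := fun y => ift wC (invmx M *m y)) (measurable_transl (- xi))).
  exact: (cmeasurable_comp (measurable_fun_mulmx _) (cmeasurable_ift twC)).
rewrite -(cintegral_transl xi); last first.
  apply: (cintegrableM (M := normc (lscale M +i* 0)%C * N)) => //.
    exact: ctest_cintegrable.
  by move=> x; rewrite normcM ler_wpM2l ?normc_ge0.
pose g' u := (lscale M +i* 0)%C * (F (eps k *: u + xi) * ift wC u).
have ig' : cintegrable (fun u => F (eps k *: u + xi) * ift wC u).
  under eq_fun do rewrite mulrC.
  apply: (cintegrableM (M := MF) (cintegrable_ift twC)) => //.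
  under eq_fun do rewrite -ME.
  by have [] := ctest_cmeasurable (ctest_affine xi uM tF).
transitivity (cintegral (fun z => g' (invmx M *m z))).
  apply: eq_cintegral => z; rewrite addrK /g' VE scalerA mulfV// scale1r.
  by rewrite mulrCA.
rewrite cintegral_lscale ?unitmx_inv//; last exact: cintegrableZ.
rewrite cintegralZ// mulrA (_ : (lscale _ +i* 0)%C * (lscale _ +i* 0)%C = 1) ?mul1r//.
apply: complexP; first by rewrite cReM/= mulr0 subr0 mulrC lscale_inv.
by rewrite cImM/= mulr0 mul0r addr0.
Qed.

(** Dominated convergence on both sides of the regularised identity as [eps k] tends to 0: the left
    side tends to [w 0] times the Fourier transform, the right side to [F xi] times the integral of
    [ift wC]. *)
Lemma fourier_ift F xi : ctest F -> fourier (ift F) xi = fconst * F xi.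
Proof.
move=> tF; have iF := cintegrable_ift tF; have iw := cintegrable_ift twC.
have [Mw Mw0 HMw] := ctest_bounded twC.
have [MF MF0 HMF] := ctest_bounded tF.
have mexp : cmeasurable (fun x : 'cV[R]_n => cexpi (- (2 * pi * dotp x xi))).
  apply: cmeasurable_cexpi; apply: measurable_funN; apply: measurable_funM => //.
  by apply: measurable_dotp => //; exact: measurable_id.
have uE k : ((eps k)%:M : 'M[R]_n) \in unitmx.
  by apply: unitmx_scalar; rewrite gt_eqF.
have mw k : cmeasurable (fun x => wC (eps k *: x)).
  have := ctest_cmeasurable (ctest_affine 0 (uE k) twC).
  by under eq_fun do rewrite mul_scalar_mx addr0.
have mF k : cmeasurable (fun x => F (eps k *: x + xi)).
  have := ctest_cmeasurable (ctest_affine xi (uE k) tF).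
  by under eq_fun do rewrite mul_scalar_mx.
have p1 x : ccvg (fun k => ift F x * (wC (eps k *: x) * cexpi (- (2 * pi * dotp x xi))))
    (ift F x * (wC 0 * cexpi (- (2 * pi * dotp x xi)))).
  apply: ccvgM; first exact: ccvg_cst.
  apply: ccvgM; last exact: ccvg_cst.
  apply: (ctest_ccvg twC); have := @cvg_eps x 0.
  by under eq_cvg do rewrite addr0.
have b1 k x : normc (ift F x * (wC (eps k *: x) * cexpi (- (2 * pi * dotp x xi)))) <=
    Mw * normc (ift F x).
  by rewrite !normcM normc_cexpi mulr1 mulrC ler_wpM2r ?normc_ge0.
have [_ lim1] := @cintegral_dominated _ _
  (fun k x => ift F x * (wC (eps k *: x) * cexpi (- (2 * pi * dotp x xi))))
  (fun x => ift F x * (wC 0 * cexpi (- (2 * pi * dotp x xi))))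
  (fun x => Mw * normc (ift F x))
  (fun k => cmeasurableM (cmeasurable_ift tF) (cmeasurableM (mw k) mexp))
  p1 (rintZ Mw (rint_normc iF)) b1.
have p2 u : ccvg (fun k => F (eps k *: u + xi) * ift wC u) (F xi * ift wC u).
  apply: ccvgM; last exact: ccvg_cst.
  by apply: (ctest_ccvg tF); exact: cvg_eps.
have b2 k u : normc (F (eps k *: u + xi) * ift wC u) <= MF * normc (ift wC u).
  by rewrite normcM ler_wpM2r ?normc_ge0.
have [_ lim2] := @cintegral_dominated _ _
  (fun k u => F (eps k *: u + xi) * ift wC u)
  (fun u => F xi * ift wC u)
  (fun x => MF * normc (ift wC x))
  (fun k => cmeasurableM (mF k) (cmeasurable_ift twC)) p2
  (rintZ MF (rint_normc iw)) b2.
have := ccvg_unique lim1.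
rewrite (funext (fun k => fourier_ift_regularised xi k tF)) => /(_ _ lim2).
rewrite cintegralZ// => E.
have -> : fourier (ift F) xi = (w 0 +i* 0)%C^-1 *
    cintegral (fun x => ift F x * (wC 0 * cexpi (- (2 * pi * dotp x xi)))).
  rewrite -cintegralZ; last first.
    apply: (cintegrableM (M := Mw) iF).
      by apply: cmeasurableM => //; exact: cmeasurable_cst.
    by move=> x; rewrite normcM normc_cexpi mulr1.
  apply: eq_cintegral => x.
  by rewrite mulrCA (mulKf wC0).
by rewrite E /fconst; set c := cintegral (ift _); rewrite [RHS]mulrC [c / _]mulrC mulrCA.
Qed.

(** Fubini moves the conjugate exponential from [ift G] onto [ift F], where the inversion formula
    applies. *)
Lemma parseval F G : ctest F -> ctest G ->
  cintegral (fun x => ift F x * (ift G x)^*) =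
  fconst * cintegral (fun x => F x * (G x)^*).
Proof.
move=> tF tG; have iF := cintegrable_ift tF; have iG := ctest_cintegrable tG.
have iGJ := cintegrableJ iG.
pose K x y := ift F x * (G y)^* * cexpi (- (2 * pi * dotp x y)).
have KE x : ift F x * (ift G x)^* = cintegral (K x).
  have ie : cintegrable (fun y => G y * cexpi (2 * pi * dotp x y)).
    exact/ctest_cintegrable/ctest_modulation.
  rewrite -cintegralJ// -cintegralZ; last exact: cintegrableJ.
  by apply: eq_cintegral => y; rewrite /K rmorphM/= -cexpiN mulrA.
rewrite (eq_cintegral KE).
have mK : cmeas (fun z : 'cV[R]_n * 'cV[R]_n => K z.1 z.2).
  apply: cmeasM; first apply: cmeasM.
  - exact: (cmeas_comp (cmeasurable_ift tF) measurable_fst).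
  - exact: (cmeas_comp (cmeasurableJ (ctest_cmeasurable tG)) measurable_snd).
  - apply: cmeas_cexpi; apply: measurable_funN; apply: measurable_funM => //.
    by apply: measurable_dotp; [exact: measurable_fst|exact: measurable_snd].
rewrite (cintegral_fubini mK.1 mK.2 (rint_normc iF) (rint_normc iGJ)); last first.
  by move=> x y; rewrite /K !normcM normc_cexpi mulr1.
have inner y : cintegral (K ^~ y) = (G y)^* * (fconst * F y).
  rewrite -fourier_ift// -cintegralZ.
    by apply: eq_cintegral => x; rewrite /K mulrA (mulrC (ift F x)).
  apply: (cintegrableM (M := 1) iF) => [|x]; last by rewrite normc_cexpi.
  apply: cmeasurable_cexpi; apply: measurable_funN; apply: measurable_funM => //.
  by apply: measurable_dotp => //; exact: measurable_id.
rewrite (eq_cintegral inner) -cintegralZ.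
  by apply: eq_cintegral => y; rewrite mulrC mulrA.
have [M _ HM] := ctest_bounded tG.
apply: (cintegrableM (M := M) (ctest_cintegrable tF)).
  exact: cmeasurableJ (ctest_cmeasurable tG).
by move=> x; rewrite normcJ.
Qed.

Lemma cintegral_mulJ F :
  cintegral (fun x => F x * (F x)^*) = ((\int[mu]_x (normc (F x) ^+ 2)) +i* 0)%C.
Proof.
rewrite (eq_cintegral (fun x => mulJz (F x))).
by congr Complex => /=; rewrite /Rintegral integral0.
Qed.

(** Parseval's identity for the bump itself exhibits the constant as a quotient of two positive
    integrals. *)
Lemma fconst_gt0 : exists2 k : R, 0 < k & fconst = (k +i* 0)%C.
Proof.
have := parseval twC twC; rewrite !cintegral_mulJ.
set A := \int[mu]_x _; set B := \int[mu]_x _ => E.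
have B0 : 0 < B.
  apply: (@Rintegral_gt0 _ 0).
  - under eq_fun do rewrite normc_sqr/= expr0n addr0 expr2.
    by apply: Cinf_continuous => k; apply: CkM; apply: tw.1.
  - by move=> x; exact: sqr_ge0.
  - exact: L2_rint (ctest_L2 twC).
  - by rewrite normc_sqr/= expr0n addr0 exprn_gt0.
have A0 : 0 < A.
  apply: (@Rintegral_gt0 _ 0).
  - under eq_fun do rewrite normc_sqr !expr2.
    apply: Cinf_continuous => k; apply: CkDf; apply: CkM;
      solve [exact: Cinf_Re_ift|exact: Cinf_Im_ift].
  - by move=> x; exact: sqr_ge0.
  - exact: L2_rint (L2_ift twC).
  (* [ift wC] does not vanish at 0, where its real part is the integral of the bump. *)
  - rewrite exprn_gt0// lt_neqAle normc_ge0 andbT eq_sym; apply/eqP => /normc0_eq0.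
    move=> /(congr1 (@complex.Re R))/= E1.
    have : \int[mu]_x w x = 0.
      rewrite -[RHS]E1; apply: eq_Rintegral => x _.
      by rewrite dotp0l mulr0 cos0 mulr1 mul0r subr0.
    apply/eqP; rewrite gt_eqF//; apply: (@Rintegral_gt0 _ 0) => //.
    + exact: Cinf_continuous tw.1.
    + by move=> x; exact: bump_ge0.
    + exact: rtest_rint.
exists (A / B); first exact: divr_gt0.
have B0C : (B +i* 0)%C != 0 :> C by apply/eqP => -[] /eqP; rewrite (gt_eqF B0).
apply: (mulIf B0C); rewrite -E; apply: complexP.
  by rewrite cReM/= mulr0 subr0 mulfVK// gt_eqF.
by rewrite cImM/= mulr0 mul0r addr0.
Qed.

End inversion.

(** * Expansive matrices and lattices *)

Section expansive_powers.
Context {R : realType}.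

Lemma cvg0_recursion (q : R) (a b : nat -> R) : 0 <= q -> q < 1 ->
  (forall j, 0 <= a j) -> (forall j, a j.+1 <= q * (a j + b j)) ->
  b k @[k --> \oo] --> 0 -> a k @[k --> \oo] --> 0.
Proof.
move=> q0 q1 a0 ab b0.
have H (e : R) : 0 < e -> \forall k \near \oo, a k <= e.
  move=> e0.
  (* With [b k] below this value the recursion keeps [e / 2] as a barrier: [q (e/2 + (1 - q) e/2)]
     is at most [e/2], the gap being [(1 - q)^2 e/2]. What is left of the initial value decays like
     [q^k]. *)
  have e2 : 0 < (1 - q) * e / 2 by rewrite divr_gt0// mulr_gt0// subr_gt0.
  have [N _ HN] : \forall k \near \oo, b k <= (1 - q) * e / 2.
    move/cvgrPdist_le : b0 => /(_ _ e2); apply: filterS => k.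
    by rewrite sub0r normrN => /(le_trans (ler_norm _)).
  have aN k : a (N + k)%N <= q ^+ k * a N + e / 2.
    elim: k => [|k IHk].
      by rewrite addn0 expr0 mul1r lerDl divr_ge0// ltW.
    rewrite addnS; apply: le_trans (ab _) _.
    have := HN (N + k)%N (leq_addr _ _); move: IHk.
    move: (a (N + k)%N) (b (N + k)%N) => x y Hx Hy.
    apply: (@le_trans _ _ (q * (q ^+ k * a N + e / 2 + (1 - q) * e / 2))).
      by apply: ler_wpM2l => //; exact: lerD.
    rewrite exprS -subr_ge0.
    rewrite (_ : _ - _ = (1 - q) * (1 - q) * (e / 2)); last by field.
    by rewrite !mulr_ge0 ?subr_ge0 ?(ltW q1) ?invr_ge0 ?(ltW e0).
  have qk : q ^+ k * a N @[k --> \oo] --> 0.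
    rewrite -(mul0r (a N)); apply: cvgMr_tmp.
    by apply: cvg_expr; rewrite ger0_norm.
  have [M _ HM] : \forall k \near \oo, q ^+ k * a N <= e / 2.
    move/cvgrPdist_le : qk => /(_ (e / 2)); rewrite divr_gt0// => /(_ isT).
    by apply: filterS => k; rewrite sub0r normrN => /(le_trans (ler_norm _)).
  exists (N + M)%N => // k /= NMk.
  have kN : (N <= k)%N by apply: leq_trans NMk; exact: leq_addr.
  rewrite -(subnKC kN); apply: le_trans (aN _) _.
  rewrite [leRHS](splitr e) lerD2r; apply: HM => /=.
  by rewrite leq_subRL.
apply/cvgrPdist_le => e e0; apply: filterS (H _ e0) => k ke.
by rewrite sub0r normrN ger0_norm.
Qed.

Lemma cvg_succ (u : nat -> R) (l : R) :
  u k @[k --> \oo] --> l -> u k.+1 @[k --> \oo] --> l.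
Proof. by move=> ul; rewrite (cvg_shiftS u). Qed.

Let nrm n (X : 'M[R[i]]_n) : R := \sum_i \sum_j normc (X i j).

Let nrm_ge0 n (X : 'M[R[i]]_n) : 0 <= nrm X.
Proof. by apply: sumr_ge0 => i _; apply: sumr_ge0 => j _; exact: normc_ge0. Qed.

Let nrmD n (X Y : 'M[R[i]]_n) : nrm (X + Y) <= nrm X + nrm Y.
Proof.
rewrite -big_split; apply: ler_sum => i _; rewrite -big_split; apply: ler_sum => j _.
by rewrite mxE normcD.
Qed.

Let nrmZ n a (X : 'M[R[i]]_n) : nrm (a *: X) = normc a * nrm X.
Proof.
rewrite mulr_sumr; apply: eq_bigr => i _; rewrite mulr_sumr; apply: eq_bigr => j _.
by rewrite mxE normcM.
Qed.

Let nrmN n (X : 'M[R[i]]_n) : nrm (- X) = nrm X.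
Proof. by apply: eq_bigr => i _; apply: eq_bigr => j _; rewrite mxE normcN. Qed.

(* [X] is annihilated by a product of factors [A - l], which are peeled off one
   at a time: each contributes a contraction of ratio [1 / |l|]. *)
Lemma inverse_powers_cvg0 n (A : 'M[R[i]]_n.+1) (s : seq R[i]) X :
  A \in unitmx -> (forall l, l \in s -> 1 < normc l) ->
  foldr (fun l Y => (A - l%:M) *m Y) X s = 0 ->
  nrm (A ^- k *m X) @[k --> \oo] --> 0.
Proof.
(* The last factor of [s] acts first on [X]: removing it replaces [X] by [(A - l) X], which the
   shorter product annihilates. *)
move=> uA; elim/last_ind: s X => [|s l IHs] X ls /=.
  move=> ->; under eq_cvg do rewrite mulmx0.
  rewrite (_ : nrm 0 = 0); first exact: cvg_cst.
  by rewrite /nrm big1// => i _; rewrite big1// => j _; rewrite mxE normc0.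
rewrite foldr_rcons => sX.
have l1 : 1 < normc l by apply: ls; rewrite mem_rcons inE eqxx.
have l0 : l != 0 by apply: contraTneq l1 => ->; rewrite normc0 ltNge ler01.
have lp : 0 < normc l by exact: lt_trans l1.
have /IHs : forall l, l \in s -> 1 < normc l.
  by move=> m ms; apply: ls; rewrite mem_rcons inE ms orbT.
move=> /(_ _ sX) bcvg.
apply: (@cvg0_recursion (normc l)^-1 _ (fun k => nrm (A ^- k.+1 *m ((A - l%:M) *m X)))).
- by rewrite invr_ge0 ltW.
- by rewrite invf_lt1.
- by move=> j; exact: nrm_ge0.
- move=> j.
  have E : A ^- j.+1 *m ((A - l%:M) *m X) = A ^- j *m X - l *: (A ^- j.+1 *m X).
    rewrite mulmxBl mul_scalar_mx mulmxBr -scalemxAr mulmxA; congr (_ *m _ - _).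
    by rewrite exprS invrM ?unitrX// -!mulmxE -mulmxA mulVmx// mulmx1.
  have -> : A ^- j.+1 *m X = l^-1 *: (A ^- j *m X - A ^- j.+1 *m ((A - l%:M) *m X)).
    by rewrite E opprB addrC subrK scalerA mulVf// scale1r.
  rewrite nrmZ Normc.normcV ler_wpM2l ?invr_ge0 ?(ltW lp)//.
  by apply: le_trans (nrmD _ _) _; rewrite nrmN.
- exact: (@cvg_succ (fun k => nrm (A ^- k *m ((A - l%:M) *m X)))).
Qed.

Lemma expansive_normc n (A : 'M[R]_n) l : expansive A ->
  eigenvalue (map_mx (real_complex R) A) l -> 1 < normc l.
Proof. by move=> eA /eA; rewrite -[1]/(1%:C)%C [`|l|]/((normc l)%:C)%C ltcR. Qed.

Lemma expansive_unitmx n (A : 'M[R]_n) : expansive A -> A \in unitmx.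
Proof.
move=> eA; rewrite unitmxE unitfE; apply/det0P => -[v v0 vA].
have : 1 < normc (0 : R[i]).
  apply: (expansive_normc eA); apply/eigenvalueP.
  exists (map_mx (real_complex R) v); last by rewrite map_mx_eq0.
  by rewrite -map_mxM vA map_mx0 scale0r.
by rewrite normc0 ltNge ler01.
Qed.

(** Over the complex numbers the characteristic polynomial splits, and Cayley-Hamilton provides the
    product of factors [A - l] that annihilates the identity. This takes the place of a Jordan form
    or of the spectral radius formula. *)
Lemma expansive_cvg0 n (A : 'M[R]_n.+1) (x : 'cV[R]_n.+1) : expansive A ->
  (A ^- k *m x) @[k --> \oo] --> (0 : 'cV[R]_n.+1).
Proof.
move=> eA; have uA := expansive_unitmx eA.
pose A' := map_mx (real_complex R) A.
have uA' : A' \in unitmx by rewrite map_unitmx.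
have [s sE] := closed_field_poly_normal (char_poly A').
rewrite (eqP (char_poly_monic A')) scale1r in sE.
have ls l : l \in s -> 1 < normc l.
  move=> ls; apply: (expansive_normc eA); rewrite -/A' eigenvalue_root_char sE.
  by rewrite root_prod_XsubC.
have s0 : foldr (fun l Y => (A' - l%:M) *m Y) 1%:M s = 0.
  rewrite -(Cayley_Hamilton A') sE rmorph_prod/=.
  elim: (s) => [|l r IHr]; first by rewrite big_nil.
  by rewrite big_cons /= IHr rmorphB/= horner_mx_X horner_mx_C.
have := inverse_powers_cvg0 uA' ls s0.
under eq_cvg do rewrite mulmx1; move=> nA.
have bound k : `|A ^- k *m x| <= nrm (A' ^- k) * `|x|.
  have E : A' ^- k = map_mx (real_complex R) (A ^- k).
    by rewrite map_invmx; congr (_^-1); rewrite /A' rmorphXn.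
  apply: cV_norm_le => [|i]; first by rewrite mulr_ge0// nrm_ge0.
  rewrite mxE; apply: le_trans (ler_norm_sum _ _ _) _.
  apply: (@le_trans _ _ ((\sum_j normc ((A' ^- k) i j)) * `|x|)).
    rewrite mulr_suml; apply: ler_sum => j _; rewrite normrM.
    by rewrite E [in leRHS]mxE normc_real ler_wpM2l// mx_norm_coord.
  rewrite ler_wpM2r// /nrm [leRHS](bigD1 i)//= lerDl; apply: sumr_ge0 => j _.
  by apply: sumr_ge0 => l _; exact: normc_ge0.
apply/cvgrPdist_le => e e0.
have e' : 0 < e / (1 + `|x|) by rewrite divr_gt0// ltr_pwDl.
move/cvgrPdist_le : nA => /(_ _ e'); apply: filterS => k.
rewrite !sub0r !normrN ger0_norm ?nrm_ge0// => H; apply: le_trans (bound k) _.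
apply: le_trans (ler_wpM2r _ H) _ => //.
rewrite -mulrA ler_piMr ?(ltW e0)// mulrC ler_pdivrMr ?mul1r ?lerDr//.
Qed.

End expansive_powers.

(** * Locally finite groups and the dual lattice *)

Section lattice.
Context {R : realType} {n : nat}.
Implicit Types (L : set 'cV[R]_n) (k x : 'cV[R]_n).

Record discrete_group L : Prop := {
  discrete0 : L 0 ;
  discreteB : forall k l, L k -> L l -> L (k - l) ;
  discrete_finite : forall r : R, finite_set (L `&` [set k | `|k| <= r]) }.

Lemma discreteN L k : discrete_group L -> L k -> L (- k).
Proof. by move=> dL Lk; rewrite -sub0r; apply: discreteB => //; exact: discrete0. Qed.

Lemma discreteD L k l : discrete_group L -> L k -> L l -> L (k + l).
Proof. by move=> dL Lk Ll; rewrite -[l]opprK; apply: discreteB => //; exact: discreteN. Qed.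

(** A dual vector is determined by its integer coordinates [P^T k], and a bound on [k] leaves
    finitely many values for these. *)
Lemma dual_lattice_discrete (G : set 'cV[R]_n) : full_rank_lattice G ->
  discrete_group (dual_lattice G).
Proof.
move=> [P uP GE]; split.
- by move=> g _; rewrite dotp0l int_num0.
- by move=> k l Lk Ll g Gg; rewrite dotpBl rpredB ?Lk ?Ll.
move=> r.
have [C C0 HC] := mulmx_bound (P^T).
pose N := (Num.truncn (C * `|r|)).+1.
(* The integers between [-N] and [N] are encoded by ordinals, shifted by [N]. *)
pose f (c : {ffun 'I_n -> 'I_(N + N).+1}) : 'cV[R]_n :=
  invmx P^T *m \col_i ((c i)%:R - N%:R).
apply: (@sub_finite_set _ _ (f @` setT)); last exact/finite_image/finite_finset.
move=> k [Lk kr]; rewrite /= in kr.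
have H i : exists c : 'I_(N + N).+1, (P^T *m k) i 0 = c%:R - N%:R.
  have : (P^T *m k) i 0 \is a Num.int.
    have -> : (P^T *m k) i 0 = dotp k (P *m map_mx intr (delta_mx i 0)).
      rewrite dotpC dotp_mulmx dotpC (_ : map_mx intr _ = delta_mx i 0) ?dotp_delta//.
      by apply/matrixP => a b; rewrite !mxE; case: (_ && _).
    by apply: Lk; rewrite GE; exists (delta_mx i 0).
  move=> /intrP[m mE].
  have : `|m%:~R : R| <= N%:R.
    rewrite -mE; apply: le_trans (mx_norm_coord _ _ _) _.
    apply: le_trans (HC _) _; apply/ltW; apply: le_lt_trans (truncnS_gt _).
    by rewrite ler_wpM2l ?(ltW C0)// (le_trans kr)// ler_norm.
  rewrite -intr_norm -[N%:R]/((N%:Z)%:~R) ler_int => mN.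
  have mN' : (absz (m + N%:Z)%R < (N + N).+1)%N by lia.
  exists (Ordinal mN'); rewrite /= mE -[X in _ - X]/((N%:Z)%:~R).
  rewrite -[(absz _)%:R]/(((absz (m + N%:Z)%R)%:Z)%:~R : R) -intrB; congr (_%:~R); lia.
have /choice[c cE] := H; exists [ffun i => c i] => //.
have uPT : P^T \in unitmx by rewrite unitmx_tr.
rewrite /f -[RHS](mulKmx uPT); congr (_ *m _).
by apply/matrixP => i j; rewrite !mxE ord1 ffunE -cE mxE.
Qed.

End lattice.

(** * Tilings by a compact set *)

Section tiling.
Context {R : realType} {n : nat}.
Local Notation mu := (lebesgue_cV n).
Implicit Types (L K : set 'cV[R]_n) (k x y : 'cV[R]_n).

Definition ae_tiling L K : Prop := {ae mu, forall x,
  (\esum_(k in L) (\1_K (x + k) : R)%:E = 1)%E}.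

(** Nonempty open sets are not negligible. This is how the almost everywhere tiling condition yields
    statements about every point. *)
Lemma ae_near_false (P : 'cV[R]_n -> Prop) x :
  {ae mu, forall y, P y} -> ~ \forall y \near x, ~ P y.
Proof.
move=> aeP /nbhs_ballP[e /= e0 He].
apply: (ball_not_negligible (x := x) e0).
by apply: negligibleS aeP => y; exact: He.
Qed.

Lemma near_seq (I : eqType) (s : seq I) (P : I -> 'cV[R]_n -> Prop) x :
  (forall i, i \in s -> \forall y \near x, P i y) ->
  \forall y \near x, forall i, i \in s -> P i y.
Proof.
elim: s => [|a s IHs] H; first by apply: filterS (@filterT _ (nbhs x) _) => y _ i; rewrite in_nil.
have H1 := H a (mem_head _ _).
have H2 : \forall y \near x, forall i, i \in s -> P i y.
  by apply: IHs => i si; apply: H; rewrite inE si orbT.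
apply: filterS2 H1 H2 => y Pa Ps i; rewrite inE => /orP[/eqP->//|].
exact: Ps.
Qed.

Lemma finite_setP (A : set 'cV[R]_n) : finite_set A ->
  exists s : seq 'cV[R]_n, forall x, x \in s <-> A x.
Proof.
move=> /finite_seqP[s ->]; exists s => x; split => //.
Qed.

Lemma compact_norm_bound K : compact K -> exists2 r : R, 0 < r &
  forall x, K x -> `|x| <= r.
Proof.
move=> /compact_bounded[N [_ HN]]; exists (`|N| + 1); first by rewrite ltr_wpDl.
by apply: HN; rewrite (le_lt_trans (ler_norm _))// ltrDl.
Qed.

Lemma closed_compact K : compact K -> closed K.
Proof. by apply: compact_closed; exact: norm_hausdorff. Qed.

Context {L K : set 'cV[R]_n}.
Context (dL : discrete_group L) (cK : compact K) (tK : ae_tiling L K).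
Let U := K^°.

(** Near a point missed by all translates of [K], only finitely many translates matter and each is
    closed, so a whole neighbourhood would be missed. *)
Lemma tiling_cover x : exists2 k, L k & K (x + k).
Proof.
apply: contrapT => H.
have nK k : L k -> ~ K (x + k) by move=> Lk Kk; apply: H; exists k.
have [r r0 Kr] := compact_norm_bound cK.
have [s sE] := finite_setP (discrete_finite dL (r + (`|x| + 1))).
have H1 : \forall y \near x, forall k, k \in s -> ~ K (y + k).
  apply: near_seq => k /sE[Lk _].
  have oK : open (~` K) by apply: closed_openC; exact: closed_compact.
  have : nbhs (x + k) (~` K) by apply: open_nbhs_nbhs; split=> //; exact: nK.
  have c : (fun y => y + k) @ x --> x + k.
    by apply: (@cvgD _ _ _ (nbhs x) _ id (cst k)); [exact: cvg_id|exact: cvg_cst].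
  exact: c.
have H2 : \forall y \near x, `|y| <= `|x| + 1.
  apply/nbhs_ballP; exists 1 => //= y; rewrite -ball_normE /= => xy.
  by rewrite -[y](subrKC x) addrC (le_trans (ler_normD _ _))// addrC lerD// distrC ltW.
apply: (ae_near_false (x := x) tK); apply: filterS2 H1 H2 => y Hs yx.
rewrite esum1; first by move=> /eqP; rewrite eqe eq_sym oner_eq0.
move=> k Lk; rewrite indicE; case: (boolP (y + k \in K)) => // /set_mem Ky.
exfalso; apply: (Hs k) => //; apply/sE; split=> //=.
rewrite -[k](addKr y) addrC (le_trans (ler_normB _ _))//.
by apply: lerD => //; exact: Kr.
Qed.

(** If two interiors met, the sum of indicators would be at least 2 on a neighbourhood of the common
    point. *)
Lemma tiling_interior_disjoint x k : L k -> k != 0 -> U x -> U (x - k) -> False.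
Proof.
move=> Lk k0 Ux Uxk.
apply: (ae_near_false (x := x) tK).
have H1 : \forall y \near x, K y by [].
have H2 : \forall y \near x, K (y - k).
  have c : (fun y => y - k) @ x --> x - k.
    by apply: (@cvgB _ _ _ (nbhs x) _ id (cst k)); [exact: cvg_id|exact: cvg_cst].
  exact: c.
apply: filterS2 H1 H2 => y Ky Kyk E.
have : (2%:E <= \esum_(k in L) (\1_K (y + k) : R)%:E)%E.
  apply: esum_ge; exists [set 0; - k].
    split; first by rewrite setUC; exact: finite_set2.
    by move=> z /= [->|->]; [exact: discrete0|exact: discreteN].
  rewrite fsbigU//=; last first.
    by move=> z /= [-> /esym/eqP]; rewrite oppr_eq0 (negbTE k0).
  by rewrite !fsbig_set1 !indicE addr0 !mem_set// -EFinD lee_fin.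
by rewrite E lee_fin leNgt ltr1n.
Qed.

(* The points of [K] in no translate of its interior: a compact subset of [K]
   whose translates still cover the space. *)
Definition core : set 'cV[R]_n :=
  [set x | K x /\ forall k, L k -> k != 0 -> ~ U (x - k)].

Lemma core_sub : core `<=` K. Proof. by move=> x []. Qed.

Lemma core_compact : compact core.
Proof.
apply: (subclosed_compact _ cK core_sub).
rewrite (_ : core = K `&` \bigcap_(k in [set k | L k /\ k != 0])
    ~` ((fun x => x - k) @^-1` U)); last first.
  apply/seteqP; split=> x [Kx H]; split=> // k; first by move=> [Lk k0]; exact: H.
  by move=> Lk k0; apply: H.
apply: closedI; first exact: closed_compact.
apply: closed_bigI => k _; apply: open_closedC.
apply: open_comp => [x _|]; last exact: open_interior.
by apply: (@cvgB _ _ _ (nbhs x) _ id (cst k)); [exact: cvg_id|exact: cvg_cst].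
Qed.

(** A translate of [x] lying in the interior belongs to the core because interiors are disjoint. If
    there is none, any translate lying in [K] belongs to it. *)
Lemma core_cover x : exists2 k, L k & core (x + k).
Proof.
have [[k [Lk Uk]]|nU] := pselect (exists k, L k /\ U (x + k)).
  exists k => //; split; first exact: interior_subset.
  move=> l Ll l0; exact: (tiling_interior_disjoint Ll l0 Uk).
have [k Lk Kk] := tiling_cover x; exists k => //; split=> // l Ll l0 Ul.
by apply: nU; exists (k - l); rewrite addrA; split=> //; exact: discreteB.
Qed.

Lemma core_disjoint x k : L k -> k != 0 -> core x -> ~ U (x - k).
Proof. by move=> Lk k0 [_]; apply. Qed.

End tiling.

Section strict.
Context {R : realType} {n : nat}.

Lemma compact_open_margin (K O : set 'cV[R]_n) : compact K -> open O -> K `<=` O ->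
  exists2 d : R, 0 < d & forall x y, K x -> `|y| < d -> O (x + y).
Proof.
move=> cK oO KO.
have /compact_near_coveringP cov := cK.
have := cov R 0^'+ (fun d x => forall y, `|y| < d -> O (x + y)) _.
case=> [x Kx|e /= e0 He].
  have /nbhs_ballP[r /= r0 xr] : nbhs x O by apply: open_nbhs_nbhs; split=> //; exact: KO.
  exists (ball x (r / 2), [set d | d < r / 2]).
    split=> /=; first by apply: nbhsx_ballx; rewrite divr_gt0.
    by apply: nbhs_right_lt; rewrite divr_gt0.
  move=> [x' d] [/= xx' dr] y yd; apply: xr; move: xx'.
  rewrite -!ball_normE /= => xx'.
  rewrite opprD addrA; apply: le_lt_trans (ler_normB _ _) _.
  by rewrite (splitr r) ltrD// (lt_trans yd).
exists (e / 2); first by rewrite divr_gt0.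
move=> x y Kx ye; apply: (He (e / 2)) => //=; last by rewrite divr_gt0.
by rewrite sub0r normrN gtr0_norm ?divr_gt0// ltr_pdivrMr// ltr_pMr// ltr1n.
Qed.


End strict.

(** * The symbol of the scaling function *)

Arguments core {R n} L K.

Section periodization.
Context {R : realType} {n : nat}.
Implicit Types (k x y : 'cV[R]_n) (f : 'cV[R]_n -> R).

(** The sum over the infinite set [L] has its intended value when finitely many terms are nonzero,
    as for bounded support; otherwise it is 0 by default. *)
Definition per (L : set 'cV[R]_n) f x : R := \sum_(k \in L) f (x + k).

Context {L : set 'cV[R]_n} (dL : discrete_group L).

Definition lat (r : R) : seq 'cV[R]_n :=
  finmap.enum_fset (fset_set (L `&` [set k | `|k| <= r])).

Lemma mem_lat r k : k \in lat r <-> L k /\ `|k| <= r.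
Proof.
have fL := discrete_finite dL r.
by rewrite /lat (in_fset_set fL k); split=> [/set_mem|/mem_set].
Qed.

Lemma uniq_lat r : uniq (lat r). Proof. exact: finmap.fset_uniq. Qed.

(** The list depends on [x] only through the bound [r], so one finite sum represents the
    periodization on a whole ball. *)
Lemma per_lat f r0 r x : (forall y, r0 < `|y| -> f y = 0) -> `|x| + r0 <= r ->
  per L f x = \sum_(k <- lat r) f (x + k).
Proof.
move=> f0 xr; rewrite -(fsbig_finite _ _ (discrete_finite dL r)).
apply/esym/fsbig_widen => [k [] //|k [Lk]].
move=> /= H; apply: f0; rewrite ltNge; apply/negP => xk; apply: H; split => //=.
rewrite -[k](addKr x) (le_trans (ler_normD _ _))// normrN.
by rewrite (le_trans _ xr)// lerD2l.
Qed.

Lemma per_transl f x l : L l -> per L f (x + l) = per L f x.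
Proof.
move=> Ll; rewrite /per (reindex_fsbig (fun k => k - l) L)//=.
  by apply: eq_fsbigr => k _; rewrite -addrA [l + _]addrC subrK.
split=> [k Lk|k k' _ _ /addIr//|k Lk]; first exact: discreteB.
by exists (k + l); rewrite ?addrK//; exact: discreteD.
Qed.

Lemma Ck_per j f : Ck j f -> bsupp f -> Ck j (per L f).
Proof.
move=> Cf [r0 f0]; apply: Ck_local => x.
exists (fun y => \sum_(k <- lat (`|x| + 1 + r0)) f (y + k)).
  by apply: Ck_sum => k; exact: Ck_transl.
have H : \forall y \near x, `|y| <= `|x| + 1.
  apply/nbhs_ballP; exists 1 => //= y; rewrite -ball_normE /= => xy.
  by rewrite -[y](subrKC x) addrC (le_trans (ler_normD _ _))// addrC lerD// distrC ltW.
by apply: filterS H => y yx; apply: (per_lat f0); rewrite lerD2r.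
Qed.

Lemma per_single f x : bsupp f -> (forall k, L k -> k != 0 -> f (x + k) = 0) ->
  per L f x = f x.
Proof.
move=> [r0 f0] fk; rewrite (@per_lat f r0 (`|x| + `|r0|))//; last first.
  by rewrite lerD2l ler_norm.
have l0 : 0 \in lat (`|x| + `|r0|).
  by apply/mem_lat; split; [exact: discrete0|rewrite normr0 addr_ge0].
rewrite (bigD1_seq 0)//= ?uniq_lat// addr0 big_seq_cond big1 ?addr0//.
by move=> k /andP[/mem_lat[Lk _] k0]; exact: fk.
Qed.

Lemma per_gt0 f x k : bsupp f -> (forall y, 0 <= f y) -> L k -> 0 < f (x + k) ->
  0 < per L f x.
Proof.
move=> [r0 f0] fge0 Lk fk; rewrite (@per_lat f r0 (`|x| + `|r0| + `|k|))//; last first.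
  by rewrite -addrA lerD2l (le_trans (ler_norm r0))// lerDl.
have lk : k \in lat (`|x| + `|r0| + `|k|).
  by apply/mem_lat; split => //; rewrite lerDr addr_ge0.
by rewrite (bigD1_seq k)//= ?uniq_lat// ltr_pwDl// sumr_ge0.
Qed.

Lemma perZ f a x : bsupp f -> per L (fun y => a * f y) x = a * per L f x.
Proof.
move=> [r0 f0]; rewrite (@per_lat f r0 (`|x| + r0))//.
rewrite (@per_lat _ r0 (`|x| + r0)) ?mulr_sumr// => y yr.
by rewrite f0// mulr0.
Qed.

End periodization.

Section symbol.
Context {R : realType} {n : nat}.
Local Notation mu := (lebesgue_cV n.+1).

Lemma expansive_trmx m (A : 'M[R]_m) : expansive A -> expansive A^T.
Proof.
move=> eA l; rewrite eigenvalue_root_char => rl; apply: eA.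
rewrite eigenvalue_root_char.
suff E : char_poly (map_mx (real_complex R) A) = char_poly (map_mx (real_complex R) A^T).
  by rewrite E.
rewrite /char_poly -det_tr; congr determinant.
by rewrite /char_poly_mx linearB /= tr_scalar_mx -!map_trmx.
Qed.

(* [Phi] is [h / sqrt S] where [h > 0] on [core L K] has its support near that
   set and [S] is the periodization of [h ^+ 2]. Points of [V] are well inside
   [K], hence away from the nontrivial translates of the support of [h]; the
   inclusion of [K] in [B K^°] leaves room for [invmx B] to map the support of
   [h] into [V]. *)
Lemma exists_symbol (L K : set 'cV[R]_n.+1) (B : 'M[R]_n.+1) :
  discrete_group L -> compact K -> ae_tiling L K -> expansive B ->
  K `<=` [set B *m y | y in K^°] ->
  exists (Phi : 'cV[R]_n.+1 -> R) (V : set 'cV[R]_n.+1),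
    [/\ rtest Phi,
        forall x, per L (fun y => Phi y ^+ 2) x = 1,
        forall x, V x -> Phi x = 1 /\ forall k, L k -> k != 0 -> Phi (x + k) = 0,
        forall x, Phi (B *m x) != 0 -> V x &
        exists2 d : R, 0 < d & forall x, `|x| < d -> V x].
Proof.
move=> dL cK tK eB KB; have uB := expansive_unitmx eB.
set U := K^° in KB *.
have KU x : K x -> U (invmx B *m x) by move=> /KB[y Uy <-]; rewrite mulKmx.
(* [invmx B] maps [K] into itself and its powers contract, so the orbit of any point of [K] tends to
   0; [K] is closed. This is what lets [V] contain a ball around 0. *)
have K0 : K 0.
  have [k _ K0k] := tiling_cover dL cK tK 0.
  have KN j : K (B ^- j *m (0 + k)).
    elim: j => [|j IHj]; first by rewrite expr0 invr1 mul1mx.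
    rewrite exprSr invrM ?unitrX// -mulmxE -mulmxA.
    by apply: interior_subset; exact: KU.
  have := @closed_cvg _ _ \oo _ (fun j => B ^- j *m (0 + k)) K (closed_compact cK).
  by apply; [exact: nearW|exact: expansive_cvg0].
have [d d0 Hd] : exists2 d : R, 0 < d & forall x y, K x -> `|y| < d ->
    U (invmx B *m (x + y)).
  have oO : open ((fun x => invmx B *m x) @^-1` U).
    by apply: open_comp => [x _|]; [exact: continuous_mulmx|exact: open_interior].
  exact: (compact_open_margin cK oO KU).
have [C C0 HC] := mulmx_bound B.
(* Two estimates share the margin [d]: [e + C e < d] when [B x] is within [e] of the core, and
   [C (e + e) < d] for the ball around 0. *)
pose e := d / (2 * (1 + C)).
have C1 : 0 < 1 + C by rewrite addr_gt0.
have e0 : 0 < e by rewrite divr_gt0// mulr_gt0.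
have eC : e + C * e < d.
  rewrite (_ : e + C * e = d / 2); last by rewrite /e; field; rewrite lt0r_neq0.
  by rewrite ltr_pdivrMr// ltr_pMr// ltr1n.
have eC' : C * (e + e) < d.
  rewrite (_ : C * (e + e) = d * (C / (1 + C))); last by rewrite /e; field; rewrite lt0r_neq0.
  by rewrite gtr_pMr// ltr_pdivrMr// mul1r ltrDr.
pose V : set 'cV[R]_n.+1 := [set x | forall v, `|v| < e -> U (x + v)].
have := core_compact (L := L) cK.
rewrite compact_cover => /(_ _ (core L K) (fun c => ball c e)).
case=> [c _|x cx|D D_ HD]; first exact: ball_open.
  by exists x => //; exact: ballxx.
pose h x : R := \sum_(c <- finmap.enum_fset D) bump c e x.
have h_ge0 x : 0 <= h x by apply: sumr_ge0 => c _; exact: bump_ge0.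
have hsupp x : h x != 0 -> exists2 c, core L K c & `|x - c| < e.
  move=> hx; apply: contrapT => H; move/eqP: hx; apply.
  rewrite /h big_seq_cond big1// => c /andP[cD _].
  apply: bump_eq0 => //; rewrite leNgt; apply/negP => xc; apply: H.
  by exists c => //; exact: set_mem (D_ _ cD).
have hpos x : core L K x -> 0 < h x.
  move=> /HD[c /= cD]; rewrite -ball_normE /= distrC -(bump_gt0 _ _ e0) => cx.
  rewrite /h (bigD1_seq c)//= ?finmap.fset_uniq// ltr_pwDl//.
  by apply: sumr_ge0 => *; exact: bump_ge0.
have Ch : Cinf h by move=> k; apply: Ck_sum => c; exact: Cinf_bump.
have bh : bsupp h.
  have [r r0 Kr] := compact_norm_bound cK.
  exists (r + e) => x rx; apply/eqP; apply: contraTT rx => /hsupp[c [Kc _] xc].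
  rewrite -leNgt -[x](subrKC c) (le_trans (ler_normD _ _))//.
  by rewrite lerD ?Kr// ltW.
have bh2 : bsupp (fun y => h y ^+ 2).
  by case: bh => r hr; exists r => x /hr ->; rewrite expr0n.
pose S := per L (fun y => h y ^+ 2).
have S0 x : 0 < S x.
  have [k Lk ck] := core_cover dL cK tK x.
  by apply: (per_gt0 dL bh2 _ Lk) => [y|]; rewrite ?sqr_ge0// exprn_gt0// hpos.
have CS : Cinf S.
  move=> k; apply: (Ck_per dL) => //.
  by under eq_fun do rewrite expr2; exact: CkM.
exists (fun x => (Num.sqrt (S x))^-1 * h x), V.
have sq x : ((Num.sqrt (S x))^-1 * h x) ^+ 2 = (S x)^-1 * h x ^+ 2.
  by rewrite exprMn exprVn sqr_sqrtr// ltW.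
have hV x k : V x -> L k -> k != 0 -> h (x + k) = 0.
  move=> Vx Lk k0; apply/eqP/negPn/negP => /hsupp[c cc xc].
  apply: (core_disjoint Lk k0 cc).
  rewrite (_ : c - k = x + (c - k - x)); last by rewrite [RHS]addrC subrK.
  by apply: Vx; rewrite -addrA -opprD distrC [k + x]addrC.
split.
- by apply: rtestMl => // k; exact: Ck_invsqrt.
- move=> x; rewrite -(mulVf (lt0r_neq0 (S0 x))) /S -(perZ dL _ _ bh2).
  by apply: eq_fsbigr => k /set_mem Lk; rewrite sq /S (per_transl dL).
(* On [V] the periodization [S] has the single term [h ^+ 2], so that the quotient is
   [h / |h| = 1]. *)
- move=> x Vx; split; last by move=> k Lk k0; rewrite hV// mulr0.
  have Sx : S x = h x ^+ 2.
    by apply: (per_single dL) => // k Lk k0; rewrite hV// expr0n.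
  have := S0 x; rewrite Sx sqrtr_sqr ger0_norm// => h0.
  by rewrite mulVf//; apply: contraTneq h0 => ->; rewrite expr0n ltxx.
- move=> x; rewrite mulf_eq0 negb_or => /andP[_] /hsupp[c [Kc _] xc] v ve.
  rewrite (_ : x + v = invmx B *m (c + ((B *m x - c) + B *m v))).
    apply: Hd => //; rewrite (le_lt_trans (ler_normD _ _))//.
    rewrite (le_lt_trans _ eC)// lerD// ?(ltW xc)// (le_trans (HC _))//.
    by rewrite ler_pM2l// ltW.
  by rewrite addrA subrKC -mulmxDr mulKmx.
- exists e => // x xe v ve.
  rewrite (_ : x + v = invmx B *m (0 + B *m (x + v))).
    apply: Hd => //; rewrite (le_lt_trans (HC _))// (le_lt_trans _ eC')//.
    by rewrite ler_pM2l// (le_trans (ler_normD _ _))// lerD// ltW.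
  by rewrite add0r mulKmx.
Qed.

End symbol.

Arguments lat {R n} L r.

(** * Characters and orthogonality of translates *)

Section characters.
Context {R : realType} {n : nat}.
Implicit Types (v x y : 'cV[R]_n).

Definition ez v x : R[i] := cexpi (2 * pi * dotp v x).

Lemma ezDl v w x : ez (v + w) x = ez v x * ez w x.
Proof. by rewrite /ez dotpDl mulrDr cexpiD. Qed.

Lemma ezDr v x y : ez v (x + y) = ez v x * ez v y.
Proof. by rewrite /ez dotpDr mulrDr cexpiD. Qed.

Lemma ezNl v x : ez (- v) x = (ez v x)^*.
Proof. by rewrite /ez dotpNl mulrN cexpiN. Qed.

Lemma ezC v x : ez v x = ez x v. Proof. by rewrite /ez dotpC. Qed.

Lemma ez0 x : ez 0 x = 1. Proof. by rewrite /ez dotp0l mulr0 cexpi0. Qed.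

Lemma normc_ez v x : normc (ez v x) = 1. Proof. exact: normc_cexpi. Qed.

Lemma cexpi_int (m : R) : m \is a Num.int -> cexpi (2 * pi * m) = 1.
Proof.
have N k : cexpi (2 * pi * k%:R) = 1 :> R[i].
  elim: k => [|k IHk]; first by rewrite mulr0 cexpi0.
  rewrite -[k.+1]addn1 natrD mulrDr cexpiD IHk mul1r mulr1.
  by rewrite /cexpi mulr_natl cos2pi sin2pi.
move=> /intrP[[k|k] ->]; first exact: N.
by rewrite NegzE mulrNz mulrN cexpiN (N k.+1) rmorph1.
Qed.

Lemma ez_int v x : dotp v x \is a Num.int -> ez v x = 1.
Proof. exact: cexpi_int. Qed.

Lemma ift_transl F v x : ift F (x - v) = ift (fun xi => F xi * ez (- v) xi) x.
Proof.
apply: eq_cintegral => xi; rewrite -[LHS]/(F xi * ez (x - v) xi).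
by rewrite -[RHS]/(F xi * ez (- v) xi * ez x xi) ezDl mulrA mulrAC.
Qed.

End characters.

Section orthogonality.
Context {R : realType} {n : nat}.
Local Notation mu := (lebesgue_cV n).
Context {L : set 'cV[R]_n} (dL : discrete_group L).
Implicit Types (u : 'cV[R]_n -> R) (k x y v g : 'cV[R]_n).

Lemma perm_lat_opp r : perm_eq [seq - k | k <- lat L r] (lat L r).
Proof.
apply: uniq_perm => [||k].
- by rewrite map_inj_uniq ?uniq_lat//; exact: oppr_inj.
- exact: uniq_lat.
apply/mapP/idP => [[l /(mem_lat dL)[Ll lr] ->]|/(mem_lat dL)[Lk kr]].
  by apply/(mem_lat dL); rewrite normrN; split => //; exact: discreteN.
exists (- k); rewrite ?opprK//.
by apply/(mem_lat dL); rewrite normrN; split => //; exact: discreteN.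
Qed.

(* Insert [per L u' = 1] on the left, and [per L u = 1] on the right: as [ez g]
   is periodic, the terms correspond through translations by [L]. *)
Lemma partition_integral u u' g : rtest u -> rtest u' ->
  (forall x, per L u x = 1) -> (forall x, per L u' x = 1) ->
  (forall k, L k -> dotp g k \is a Num.int) ->
  cintegral (fun x => (u x +i* 0)%C * ez g x) =
  cintegral (fun x => (u' x +i* 0)%C * ez g x).
Proof.
move=> tu tu' pu pu' gL.
have [_ [r1 r1u]] := tu; have [_ [r2 r2u]] := tu'.
(* If [x] and [x + k] both have norm at most [r0], then [k] has norm at most [r0 + r0]: one list of
   lattice points serves for both expansions. *)
pose r0 := Num.max r1 r2; pose r := r0 + r0.
have uE w w' x : (forall y, r0 < `|y| -> w y = 0) ->
    (forall y, r0 < `|y| -> w' y = 0) -> (forall x, per L w' x = 1) ->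
    w x = \sum_(k <- lat L r) w x * w' (x + k).
  move=> w0 w'0 pw'; have [xr|xr] := ltP r0 `|x|.
    by rewrite w0// big1// => k _; rewrite mul0r.
  by rewrite -mulr_sumr -(per_lat dL w'0) ?pw' ?mulr1// lerD2r.
have {}r1u y : r0 < `|y| -> u y = 0 by rewrite gt_max => /andP[/r1u].
have {}r2u y : r0 < `|y| -> u' y = 0 by rewrite gt_max => /andP[_ /r2u].
have csum (s : seq 'cV[R]_n) (F : 'cV[R]_n -> R) :
    ((\sum_(k <- s) F k) +i* 0)%C = \sum_(k <- s) (F k +i* 0)%C :> R[i].
  apply: complexP; rewrite ?cRe_sum ?cIm_sum//=; by rewrite big1.
have tt w w' k : rtest w -> rtest w' ->
    ctest (fun x => (w x * w' (x + k) +i* 0)%C * ez g x).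
  move=> [Cw bw] [Cw' _]; apply: ctest_modulation; apply: ctest_real.
  by apply: rtestMr => // j; exact: Ck_transl.
transitivity (\sum_(k <- lat L r)
    cintegral (fun x => (u x * u' (x + k) +i* 0)%C * ez g x)).
  rewrite -cintegral_sum => [|k]; last exact/ctest_cintegrable/tt.
  by apply: eq_cintegral => x; rewrite -mulr_suml -csum -uE.
transitivity (\sum_(k <- lat L r)
    cintegral (fun x => (u' x * u (x + k) +i* 0)%C * ez g x)); last first.
  rewrite -cintegral_sum => [|k]; last exact/ctest_cintegrable/tt.
  by apply: eq_cintegral => x; rewrite -mulr_suml -csum -uE.
rewrite -[RHS](perm_big _ (perm_lat_opp r)) big_map.
rewrite big_seq [RHS]big_seq; apply: eq_bigr => k /(mem_lat dL)[Lk _].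
rewrite -[RHS](cintegral_transl k); last exact/ctest_cintegrable/tt.
apply: eq_cintegral => x; rewrite addrK ezDr [ez g k]ez_int ?mulr1; last exact: gL.
by rewrite [u x * _]mulrC.
Qed.

(* Translating [u] by [g / (2 |g|^2)] changes the sign of the integral, whereas
   the integral does not depend on the partition of unity. *)
Lemma partition_orthogonal u g : rtest u -> (forall x, per L u x = 1) ->
  (forall k, L k -> dotp g k \is a Num.int) -> g != 0 ->
  cintegral (fun x => (u x +i* 0)%C * ez g x) = 0.
Proof.
move=> tu pu gL g0.
have gg : 0 < dotp g g.
  rewrite lt_neqAle sumr_ge0 ?andbT => [|i _]; last exact: sqr_ge0.
  apply: contra g0 => /eqP/esym/eqP; rewrite psumr_eq0 => [/allP H|i _]; last exact: sqr_ge0.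
  apply/eqP/matrixP => i j; rewrite ord1 mxE.
  by have := H i (mem_index_enum _); rewrite mulf_eq0 orbb => /eqP.
pose v := (2 * dotp g g)^-1 *: g.
have gv : ez g v = -1.
  rewrite /ez dotpZr (_ : _ * _ = pi); last by field; rewrite lt0r_neq0.
  by apply: complexP; rewrite /= ?cospi ?sinpi ?oppr0.
have tv : rtest (fun x => u (x + v)).
  have [Cu [r ur]] := tu; split; first by move=> k; exact: Ck_transl.
  exists (r + `|v|) => x xr; apply: ur.
  by have := ler_normB (x + v) v; rewrite addrK; lra.
have iv : cintegrable (fun x => (u (x + v) +i* 0)%C * ez g x).
  exact/ctest_cintegrable/ctest_modulation/ctest_real.
have : cintegral (fun x => (u x +i* 0)%C * ez g x) =
    - cintegral (fun x => (u x +i* 0)%C * ez g x).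
  rewrite -{1}(cintegral_transl v); last first.
    exact/ctest_cintegrable/ctest_modulation/ctest_real.
  rewrite -mulN1r [in RHS](@partition_integral u (fun x => u (x + v)))//; last first.
    move=> x; rewrite -(pu (x + v)); apply: eq_fsbigr => k _.
    by rewrite addrAC.
  rewrite -cintegralZ//; apply: eq_cintegral => x.
  by rewrite ezDr gv mulrN1 mulrN mulN1r.
by move/eqP; rewrite eq_sym eqNr => /eqP.
Qed.

End orthogonality.

Lemma realcM (R : realType) (a b : R) : (a +i* 0)%C * (b +i* 0)%C = (a * b +i* 0)%C.
Proof. by apply: complexP; rewrite ?cReM ?cImM/=; ring. Qed.

(** * The scaling function and its orthonormal translates *)

Section scaling.
Context {R : realType} {n : nat}.
Local Notation mu := (lebesgue_cV n).
Context {L G : set 'cV[R]_n} (dL : discrete_group L).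
Context (GB : forall g h, G g -> G h -> G (g - h)).
Context (GL : forall g k, G g -> L k -> dotp g k \is a Num.int).
Context {Phi : 'cV[R]_n -> R} (tPhi : rtest Phi).
Context (pPhi : forall x, per L (fun y => Phi y ^+ 2) x = 1).

Let kappa := Re (@fconst R n).
Let I2 := \int[mu]_x (Phi x ^+ 2).

(** By Parseval, [kappa * I2] is the squared L^2 norm of the inverse transform of [Phi]. *)
Definition norm_const := (Num.sqrt (kappa * I2))^-1.

Lemma fconstE : @fconst R n = (kappa +i* 0)%C.
Proof. by rewrite /kappa; have [k k0 ->] := @fconst_gt0 R n. Qed.

Lemma kappa_gt0 : 0 < kappa.
Proof. by rewrite /kappa; have [k k0 ->] := @fconst_gt0 R n. Qed.

Lemma rtest_Phi2 : rtest (fun x => Phi x ^+ 2).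
Proof. by under eq_fun do rewrite expr2; apply: rtestMr => //; case: tPhi. Qed.

Lemma I2_gt0 : 0 < I2.
Proof.
have [x0 Px0] : exists x0, Phi x0 != 0.
  apply: contrapT => H; have := pPhi 0.
  suff -> : per L (fun y => Phi y ^+ 2) 0 = 0 by move/esym/eqP; rewrite oner_eq0.
  apply: fsbig1 => k _; apply/eqP; rewrite sqrf_eq0; apply/negPn/negP => P0; apply: H.
  by exists (0 + k).
have [C2 b2] := rtest_Phi2.
apply: (@Rintegral_gt0 _ _ _ x0); first exact: Cinf_continuous.
- by move=> x; exact: sqr_ge0.
- exact: rtest_rint rtest_Phi2.
- by rewrite lt0r sqrf_eq0 Px0 sqr_ge0.
Qed.

Lemma norm_const_gt0 : 0 < norm_const.
Proof. by rewrite invr_gt0 sqrtr_gt0 mulr_gt0// ?kappa_gt0// I2_gt0. Qed.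

Definition scaling_symbol x : R[i] := (norm_const * Phi x +i* 0)%C.

Definition scaling := ift scaling_symbol.

Lemma ctest_scaling : ctest scaling_symbol.
Proof. by apply: ctest_real; exact: rtestZ. Qed.

Lemma ctest_ez (F : 'cV[R]_n -> R[i]) v : ctest F -> ctest (fun x => F x * ez v x).
Proof. exact: ctest_modulation. Qed.

Lemma translate_scaling g :
  translate g scaling = ift (fun x => scaling_symbol x * ez (- g) x).
Proof. by apply/funext => x; exact: ift_transl. Qed.

(** Parseval turns the inner product into the integral of [Phi ^+ 2] against the character [h - g],
    which vanishes for [g != h] because [Phi ^+ 2] is a partition of unity. *)
Lemma scaling_orthonormal g h : G g -> G h ->
  L2dot (translate g scaling) (translate h scaling) = (g == h)%:R.
Proof.
move=> Gg Gh; rewrite !translate_scaling /L2dot parseval; [|exact/ctest_ez/ctest_scaling..].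
have -> : cintegral (fun x => scaling_symbol x * ez (- g) x * (scaling_symbol x * ez (- h) x)^*) =
    (norm_const ^+ 2 +i* 0)%C * cintegral (fun x => ((Phi x ^+ 2) +i* 0)%C * ez (h - g) x).
  rewrite -cintegralZ; last first.
    by apply/ctest_cintegrable/ctest_ez/ctest_real; exact: rtest_Phi2.
  apply: eq_cintegral => x; rewrite ezDl rmorphM /= -[(ez (- h) x)^*]ezNl opprK.
  set a := ez h x; set b := ez (- g) x.
  rewrite (_ : (scaling_symbol x)^* = scaling_symbol x); last first.
    by apply: complexP; rewrite ?cReJ ?cImJ//= oppr0.
  rewrite (_ : (Phi x ^+ 2 +i* 0)%C = (Phi x +i* 0)%C ^+ 2); last first.
    by apply: complexP; rewrite expr2 ?cReM ?cImM/=; ring.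
  rewrite (_ : scaling_symbol x = (norm_const +i* 0)%C * (Phi x +i* 0)%C); last first.
    by apply: complexP; rewrite ?cReM ?cImM/=; ring.
  rewrite (_ : (norm_const ^+ 2 +i* 0)%C = (norm_const +i* 0)%C ^+ 2); last first.
    by apply: complexP; rewrite expr2 ?cReM ?cImM/=; ring.
  ring.
have [<-|gh] := eqVneq g h; last first.
  rewrite (partition_orthogonal dL) ?mulr0//; first exact: rtest_Phi2.
    by move=> k Lk; apply: GL => //; exact: GB.
  by rewrite subr_eq0 eq_sym.
rewrite subrr (eq_cintegral (g := fun x => (Phi x ^+ 2 +i* 0)%C)) => [|x]; last first.
  by rewrite ez0 mulr1.
have -> : cintegral (fun x => (Phi x ^+ 2 +i* 0)%C) = (I2 +i* 0)%C.
  by rewrite /cintegral /= /Rintegral integral0.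
rewrite fconstE !realcM exprVn sqr_sqrtr; last first.
  by rewrite ltW// mulr_gt0// ?kappa_gt0// I2_gt0.
rewrite (_ : kappa * _ = 1)//.
by field; rewrite !lt0r_neq0// ?kappa_gt0// I2_gt0.
Qed.

End scaling.

(** * Approximation of periodic functions *)

Section korovkin1.
Context {R : realType}.
Implicit Types (t u : R) (N M j : nat).

(** This is [cos (pi u) ^ 2]. Its [N]-th power is the de la Vallee Poussin kernel of degree [N] up
    to normalisation, and [wtc N] is the mean of that power over a period. *)
Definition wt u : R := (1 + cos (2 * pi * u)) / 2.

Definition wtc N : R := 'C(2 * N, N)%:R / 4 ^+ N.

Lemma wt_ge0 u : 0 <= wt u.
Proof. by rewrite divr_ge0// -lerBlDl sub0r cos_geN1. Qed.

Lemma wt_le1 u : wt u <= 1.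
Proof. by rewrite ler_pdivrMr// mul1r; have := cos_le1 (2 * pi * u); lra. Qed.

Lemma wtc_gt0 N : 0 < wtc N.
Proof. by rewrite divr_gt0 ?exprn_gt0// ltr0n bin_gt0 leq_pmull. Qed.

Lemma wtcS N : wtc N - wtc N.+1 = wtc N / (2 * N.+1%:R).
Proof.
have E : N.+1%:R * 'C(2 * N.+1, N.+1)%:R = (2 * (2 * N).+1)%:R * 'C(2 * N, N)%:R :> R.
  rewrite -!natrM; congr (_%:R); rewrite (_ : 2 * N.+1 = (2 * N).+2)%N; last lia.
  have := mul_bin_diag (2 * N).+2 N; have := mul_bin_down (2 * N).+1 N => /=.
  rewrite (_ : (2 * N).+1 - N = N.+1)%N; last lia.
  nia.
have N0 : N.+1%:R != 0 :> R by rewrite pnatr_eq0.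
have -> : wtc N.+1 = N.+1%:R * 'C(2 * N.+1, N.+1)%:R / (N.+1%:R * 4 ^+ N.+1).
  by rewrite /wtc -mulf_div divff// mul1r.
have P4 : 4 ^+ N != 0 :> R by rewrite expf_neq0.
rewrite E /wtc (natrM _ 2) -[(2 * N).+1]addn1 natrD natrM exprS.
move: N0 P4; rewrite -[N.+1]addn1 natrD; move: (_ ^+ N) => p N0 P4.
by field; rewrite N0 P4.
Qed.

Lemma cexpiX (a : R) k : cexpi a ^+ k = cexpi (k%:R * a).
Proof.
elim: k => [|k IHk]; first by rewrite expr0 mul0r cexpi0.
by rewrite exprSr IHk -cexpiD -[in RHS](addn1 k) natrD mulrDl mul1r.
Qed.

Lemma cexpi_neq1 M l : (0 < l < M)%N -> cexpi (2 * pi * (l%:R / M%:R) : R) != 1.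
Proof.
move=> /andP[l0 lM]; have M0 : 0 < M%:R :> R by rewrite ltr0n (leq_ltn_trans _ lM).
have s0 : 0 < sin (pi * (l%:R / M%:R) : R).
  have q0 : 0 < l%:R / M%:R :> R by apply: divr_gt0 => //; rewrite ltr0n.
  apply: sin_gt0_pi; rewrite mulr_gt0 ?pi_gt0//=.
  by rewrite gtr_pMr ?pi_gt0// ltr_pdivrMr// mul1r ltr_nat.
apply/negP => /eqP E0; have {E0} := congr1 (@complex.Re R) E0; rewrite /=.
rewrite -mulrA mulr_natl cos_mulr2n => E.
have := sin2cos2 (pi * (l%:R / M%:R) : R); have : 0 < sin (pi * (l%:R / M%:R) : R) ^+ 2.
  by rewrite exprn_gt0.
move: E; rewrite -mulr_natl; lra.
Qed.

Lemma geometric_root M (q : R[i]) : q != 1 -> q ^+ M = 1 ->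
  \sum_(j < M) q ^+ j = 0.
Proof.
move=> q1 qM; have := subrX1 q M; rewrite qM subrr => /esym/eqP.
by rewrite mulf_eq0 subr_eq0 (negbTE q1) => /eqP.
Qed.

Lemma conjC_eq1 (z : R[i]) : z^* = 1 -> z = 1.
Proof. by case: z => a b [-> /eqP]; rewrite oppr_eq0 => /eqP ->. Qed.

(** In this form powers of [wt] expand by the binomial formula, with frequencies from [-N] to
    [N]. *)
Lemma wtE u : (wt u +i* 0)%C =
  (4^-1 +i* 0)%C * ((cexpi (2 * pi * u))^* * (cexpi (2 * pi * u) + 1) ^+ 2) :> R[i].
Proof.
have := cos2Dsin2 (2 * pi * u); rewrite /wt; set c := cos _; set s := sin _ => cs.
have s2 : s ^+ 2 = 1 - c ^+ 2 by lra.
apply: complexP; rewrite expr2 ?(cReM, cImM, cReD, cImD, cReJ, cImJ)/= -/c -/s.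
  rewrite [RHS](_ : _ = 4^-1 * (c ^+ 3 + 2 * c ^+ 2 + c + c * s ^+ 2 + 2 * s ^+ 2)); last by ring.
  by rewrite s2; field.
rewrite [RHS](_ : _ = 4^-1 * (s * (c ^+ 2 + s ^+ 2 - 1))); last by ring.
by rewrite s2; ring.
Qed.

(* The frequencies of [wt ^+ N] are at most [N < M], hence sampling at the
   M-th roots of unity does not alias. *)
Lemma wt_sum N M t : (N < M)%N ->
  \sum_(j < M) wt (t - j%:R / M%:R) ^+ N = M%:R * wtc N.
Proof.
move=> NM.
pose z (j : nat) : R[i] := cexpi (2 * pi * (t - j%:R / M%:R)).
pose o : R[i] := cexpi (- (2 * pi * (1 / M%:R))).
have M0 : M%:R != 0 :> R by rewrite pnatr_eq0 -lt0n (leq_ltn_trans _ NM).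
have zE j : z j = z 0%N * o ^+ j.
  by rewrite cexpiX -cexpiD /z; congr cexpi; field.
have oo : o^* * o = 1 by rewrite mulrC mulJz normc_cexpi expr1n.
have oX l : o ^+ l = (cexpi (2 * pi * (l%:R / M%:R)))^*.
  by rewrite cexpiX -cexpiN; congr cexpi; field.
have oM : o ^+ M = 1.
  by rewrite oX divff// cexpi_int ?rmorph1// rpred1.
have o1 l : (0 < l < M)%N -> o ^+ l != 1.
  move=> lM; rewrite oX; apply: contra (cexpi_neq1 lM) => /eqP H.
  by apply/eqP; exact: conjC_eq1.
(* The ratio is [o] to the power [k - N], a nonzero exponent of absolute value at most [N < M],
   hence a nontrivial [M]-th root of unity. *)
have q k : (k <= 2 * N)%N -> k != N -> \sum_(j < M) ((o^*) ^+ N * o ^+ k) ^+ j = 0.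
  move=> kN kn; apply: geometric_root; last first.
    by rewrite exprMn -!exprM ![(_ * M)%N]mulnC !exprM oM -rmorphXn oM rmorph1 !expr1n mul1r.
  move: kn; rewrite neq_ltn => /orP[kn|kn].
    have -> : (o^*) ^+ N * o ^+ k = (o ^+ (N - k))^*.
      rewrite rmorphXn -[in LHS](subnK (ltnW kn)) exprD -mulrA -exprMn oo expr1n.
      by rewrite mulr1.
    apply: contra (o1 (N - k)%N _) => [/eqP H|]; last lia.
    by apply/eqP; exact: conjC_eq1.
  have -> : (o^*) ^+ N * o ^+ k = o ^+ (k - N).
    by rewrite -[in LHS](subnKC (ltnW kn)) exprD mulrA -exprMn oo expr1n mul1r.
  by apply: o1; lia.
have step j : (wt (t - j%:R / M%:R) ^+ N +i* 0)%C = \sum_(k < (2 * N).+1)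
    ((4^-1 ^+ N * 'C(2 * N, k)%:R) +i* 0)%C * ((z 0%N)^* ^+ N * z 0%N ^+ k) *
      ((o^*) ^+ N * o ^+ k) ^+ j.
  have -> : (wt (t - j%:R / M%:R) ^+ N +i* 0)%C = (wt (t - j%:R / M%:R) +i* 0)%C ^+ N.
    by elim: N {NM q} => [//|N' IH]; rewrite !exprS -IH realcM.
  rewrite wtE -/(z j) 2!exprMn -exprM exprD1n !mulr_sumr.
  apply: eq_bigr => k _; rewrite zE rmorphM rmorphXn.
  have -> : ((4^-1 ^+ N * 'C(2 * N, k)%:R) +i* 0)%C =
      (4^-1 +i* 0)%C ^+ N * 'C(2 * N, k)%:R :> R[i].
    have -> : 'C(2 * N, k)%:R = ('C(2 * N, k)%:R +i* 0)%C :> R[i].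
      by elim: 'C(2 * N, k) => [//|m IH]; rewrite -addn1 !natrD IH; apply: complexP; rewrite ?cReD ?cImD/= ?addr0.
    by rewrite -realcM; congr (_ * _); elim: N {NM q k} => [//|N' IH]; rewrite !exprS -IH realcM.
  rewrite -mulr_natr !exprMn -!exprM [(j * N)%N]mulnC [(j * k)%N]mulnC.
  by ring.
have : ((\sum_(j < M) wt (t - j%:R / M%:R) ^+ N) +i* 0)%C =
    ((M%:R * wtc N) +i* 0)%C :> R[i].
  transitivity (\sum_(j < M) (wt (t - j%:R / M%:R) ^+ N +i* 0)%C).
    by apply: complexP; rewrite ?cRe_sum ?cIm_sum//= big1.
  under eq_bigr do rewrite step.
  rewrite exchange_big /=; under eq_bigr do rewrite -mulr_sumr.
  have NN : (N < (2 * N).+1)%N by lia.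
  rewrite (bigD1 (Ordinal NN))//= [X in _ + X]big1 ?addr0 => [|k kN]; last first.
    by rewrite q ?mulr0// -ltnS.
  under eq_bigr do rewrite -exprMn oo !expr1n.
  rewrite sumr_const card_ord -exprMn mulrC [_^* * _]mulrC mulJz normc_cexpi.
  rewrite expr1n expr1n mulr1.
  have -> : 1 *+ M = (M%:R +i* 0)%C :> R[i].
    elim: M {NM M0 z zE o oo oX oM o1 q step} => [//|m IH].
    by rewrite mulrS IH -addn1 natrD; apply: complexP; rewrite ?cReD ?cImD/= ?addr0// addrC.
  by rewrite realcM /wtc exprVn [_ / _]mulrC.
by move=> /(congr1 (@complex.Re R)).
Qed.

(** Degree [N] alone would be sampled exactly by [N.+1] points. One more is taken because the
    variance involves [wt ^+ N.+1], which must not alias either. *)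
Definition kor (h : R -> R) N t : R := \sum_(j < N.+2)
  h (j%:R / N.+2%:R) * (wt (t - j%:R / N.+2%:R) ^+ N / (N.+2%:R * wtc N)).

Lemma kor_weight N t :
  \sum_(j < N.+2) wt (t - j%:R / N.+2%:R) ^+ N / (N.+2%:R * wtc N) = 1.
Proof.
by rewrite -mulr_suml wt_sum// divff// mulf_neq0// lt0r_neq0// wtc_gt0.
Qed.

Lemma kor_weight_ge0 N t (j : nat) :
  0 <= wt (t - j%:R / N.+2%:R) ^+ N / (N.+2%:R * wtc N).
Proof. by rewrite divr_ge0 ?exprn_ge0 ?wt_ge0// mulr_ge0// ltW// wtc_gt0. Qed.

(** Since [(1 - wt) wt^N = wt^N - wt^(N+1)], the sum is [(wtc N - wtc N.+1) / wtc N]. Its vanishing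
    in the limit is the concentration of the kernel on integer translates of [t]. *)
Lemma kor_variance N t : \sum_(j < N.+2) (1 - wt (t - j%:R / N.+2%:R)) *
    (wt (t - j%:R / N.+2%:R) ^+ N / (N.+2%:R * wtc N)) = (2 * N.+1%:R)^-1.
Proof.
under eq_bigr do rewrite mulrBl mul1r [X in _ - X]mulrA -exprS.
rewrite sumrB kor_weight -mulr_suml wt_sum//.
have c0 : wtc N != 0 by rewrite lt0r_neq0// wtc_gt0.
have N2 : N.+2%:R != 0 :> R by rewrite pnatr_eq0.
rewrite -mulf_div divff// mul1r -(divff c0) -mulrBl wtcS mulrAC divff// mul1r//.
Qed.

Lemma kor_bound h B N t : (forall s, `|h s| <= B) -> `|kor h N t| <= B.
Proof.
move=> hB; have -> : B = \sum_(j < N.+2)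
    B * (wt (t - j%:R / N.+2%:R) ^+ N / (N.+2%:R * wtc N)).
  by rewrite -mulr_sumr kor_weight mulr1.
apply: le_trans (ler_norm_sum _ _ _) _; apply: ler_sum => j _.
have w0 := kor_weight_ge0 N t j; rewrite normrM (ger0_norm w0).
exact: ler_wpM2r.
Qed.

Lemma wt_far (d0 : R) : 0 < d0 -> exists2 d : R, 0 < d &
  forall u, wt u > 1 - d -> exists m : int, `|u - m%:~R| < d0.
Proof.
(* The cut at [1/2] keeps [2 * pi * d1] in [[0, pi]], where the cosine decreases. The threshold [d]
   below is [1 - wt d1]. *)
move=> d00; pose d1 := Num.min d0 (1 / 2).
have d10 : 0 < d1 by rewrite lt_min d00/= divr_gt0.
have d11 : d1 <= 1 / 2 by rewrite ge_min lexx orbT.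
have P : 0 < pi :> R := pi_gt0 R.
have I (v : R) : 0 <= v -> v <= 1 / 2 -> 2 * pi * v \in `[0, pi].
  move=> v0 v1; rewrite in_itv/= !mulr_ge0 ?(ltW P)//=.
  have : pi * v <= pi * (1 / 2) by rewrite ler_pM2l.
  lra.
exists ((1 - cos (2 * pi * d1)) / 2).
  rewrite divr_gt0// subr_gt0 -[ltRHS]cos0 ltr_cos ?I// ?(ltW d10)//.
    by rewrite !mulr_gt0.
  by rewrite in_itv/= lexx ltW.
move=> u H; exists (Num.floor (u + 1 / 2)); move: H; set m := Num.floor _.
have /andP[m1 m2] : m%:~R <= u + 1 / 2 < (m + 1)%:~R by exact: floor_itv.
move: m2; rewrite intrD => m2; set v := u - _.
have v2 : `|v| <= 1 / 2 by rewrite ler_norml /v; apply/andP; split; lra.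
apply: contraTT => /=; rewrite -!leNgt /wt => dv.
have -> : cos (2 * pi * u) = cos (2 * pi * `|v|).
  have -> : cos (2 * pi * u) = cos (2 * pi * v).
    have := cexpiD (2 * pi * v) (2 * pi * m%:~R).
    have -> : cexpi (2 * pi * m%:~R) = 1 :> R[i] by apply: cexpi_int; exact: intr_int.
    rewrite mulr1 -mulrDr subrK.
    by move/(congr1 (@complex.Re R)).
  by case: (ger0P v) => // _; rewrite mulrN cosN.
have : cos (2 * pi * `|v|) <= cos (2 * pi * d1).
  rewrite leNgt ltr_cos ?I//; last exact: ltW.
  by rewrite -leNgt ler_pM2l ?mulr_gt0// ge_min dv.
lra.
Qed.

(** Korovkin's argument: [|h t - h s|] is at most [e/2 + (2B/d) (1 - wt (t - s))], by continuity
    when [t - s] is close to an integer and by boundedness otherwise. Averaging over the samples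
    leaves [e/2] plus a multiple of the variance. *)
Lemma kor_cvg (h : R -> R) B t : (forall s, `|h s| <= B) -> (forall s (m : int), h (s + m%:~R) = h s) ->
  {for t, continuous h} -> kor h N t @[N --> \oo] --> h t.
Proof.
move=> hB hp ch; apply/cvgrPdist_le => e e0.
have B0 : 0 <= B by exact: le_trans (normr_ge0 _) (hB 0).
have e2 : 0 < e / 2 by rewrite divr_gt0.
move: ch => /cvgrPdist_le /(_ _ e2) /nbhs_ballP[d0 /= d00 Hd0].
have [d d_gt0 Hd] := wt_far d00.
have near0 : \forall N \near \oo, N.+1%:R^-1 <= e * d / (2 * B + 1).
  have P : 0 < e * d / (2 * B + 1) by rewrite divr_gt0 ?mulr_gt0// ltr_wpDl// mulr_ge0.
  have := @cvg_harmonic R; move/cvgrPdist_le => /(_ _ P); apply: filterS => N /=.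
  by rewrite sub0r normrN ger0_norm.
apply: filterS near0 => N HN.
have -> : h t - kor h N t = \sum_(j < N.+2) (h t - h (j%:R / N.+2%:R)) *
    (wt (t - j%:R / N.+2%:R) ^+ N / (N.+2%:R * wtc N)).
  under eq_bigr do rewrite mulrBl.
  by rewrite sumrB -mulr_sumr kor_weight mulr1.
apply: (@le_trans _ _ (\sum_(j < N.+2) ((e / 2) + (2 * B / d) * (1 - wt (t - j%:R / N.+2%:R))) *
    (wt (t - j%:R / N.+2%:R) ^+ N / (N.+2%:R * wtc N)))).
  apply: le_trans (ler_norm_sum _ _ _) _; apply: ler_sum => j _.
  have w0 := kor_weight_ge0 N t j; rewrite normrM (ger0_norm w0).
  apply: ler_wpM2r => //.
  have w1 := wt_le1 (t - j%:R / N.+2%:R).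
  have [H|H] := ltP (1 - d) (wt (t - j%:R / N.+2%:R)).
    have [m Hm] := Hd _ H; rewrite -(hp (j%:R / N.+2%:R) m) (le_trans (Hd0 _ _))//.
      by rewrite -ball_normE/= opprD addrA.
    by rewrite lerDl mulr_ge0 ?subr_ge0// divr_ge0 ?mulr_ge0// ltW.
  rewrite (le_trans (ler_normB _ _))// (@le_trans _ _ (2 * B))//.
    by have := hB t; have := hB (j%:R / N.+2%:R); lra.
  have : 2 * B <= 2 * B / d * (1 - wt (t - j%:R / N.+2%:R)).
    by rewrite -mulrA ler_peMr ?mulr_ge0// ler_pdivlMl// mulr1; lra.
  by move: e2; lra.
under eq_bigr do rewrite mulrDl -[2 * B / d * _ * _]mulrA.
rewrite big_split/= -!mulr_sumr kor_weight kor_variance mulr1.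
rewrite invfM mulrA.
have D0 : 0 < 2 * B + 1 by rewrite ltr_wpDl// mulr_ge0.
have H1 : 2 * B / d / 2 * N.+1%:R^-1 <= 2 * B / d / 2 * (e * d / (2 * B + 1)).
  by rewrite ler_wpM2l// !divr_ge0 ?mulr_ge0// ltW.
rewrite -lerBrDl (le_trans H1)//.
rewrite (_ : 2 * B / d / 2 * (e * d / (2 * B + 1)) = (e / 2) * ((2 * B) / (2 * B + 1))); last first.
  by field; rewrite !lt0r_neq0.
rewrite (_ : e - e / 2 = e / 2 * 1); last by field.
by rewrite ler_wpM2l ?(ltW e2)// ler_pdivrMr// mul1r lerDl.
Qed.

End korovkin1.

Section periodic.
Context {R : realType} {n : nat}.
Implicit Types (g : 'cV[R]_n -> R) (x : 'cV[R]_n).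

Definition zperiodic g := forall x (m : 'cV[int]_n), g (x + map_mx intr m) = g x.

Lemma zperiodic_bounded g : continuous g -> zperiodic g ->
  exists2 B : R, 0 < B & forall x, `|g x| <= B.
Proof.
move=> cg pg.
have cK : compact [set x : 'cV[R]_n | `|x| <= 1].
  by apply: (@compact_cV _ _ _ 1) => //; exact: closed_norm_le.
have : compact (g @` [set x : 'cV[R]_n | `|x| <= 1]).
  by apply: continuous_compact => //; apply: continuous_subspaceT.
move=> /compact_bounded[N [_ HN]]; exists (`|N| + 1); first by rewrite ltr_wpDl.
move=> x; pose m : 'cV[int]_n := \col_i - Num.floor (x i 0).
rewrite -(pg x m); apply: (HN (`|N| + 1)).
  by rewrite (le_lt_trans (ler_norm _))// ltrDl.
exists (x + map_mx intr m) => //=.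
apply: cV_norm_le => // i; rewrite !mxE rmorphN /=.
have /andP[] := floor_itv (x i 0); rewrite intrD => f1 f2.
by rewrite ler_norml; apply/andP; split; lra.
Qed.

Definition setc (i : 'I_n) x (s : R) : 'cV[R]_n := x + (s - x i 0) *: delta_mx i 0.

Lemma setcE i x s j : setc i x s j 0 = if j == i then s else x j 0.
Proof.
rewrite /setc !mxE eqxx andbT; case: eqP => [->|_]; last by rewrite mulr0 addr0.
by rewrite mulr1 subrKC.
Qed.

Lemma setc_id i x : setc i x (x i 0) = x.
Proof. by rewrite /setc subrr scale0r addr0. Qed.

Lemma setcDl i x s (m : 'cV[int]_n) :
  exists m', setc i (x + map_mx intr m) s = setc i x s + map_mx intr m'.
Proof.
exists (\col_j if j == i then 0 else m j 0); apply/matrixP => j k.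
by rewrite ord1 [RHS]mxE !setcE !mxE; case: eqP => // _; rewrite addr0.
Qed.

Lemma setcDr i x s (m : int) :
  exists m', setc i x (s + m%:~R) = setc i x s + map_mx intr m'.
Proof.
exists (\col_j if j == i then m else 0); apply/matrixP => j k.
by rewrite ord1 [RHS]mxE !setcE !mxE; case: eqP => // _; rewrite addr0.
Qed.

Lemma continuous_setcl i s : continuous (fun x => setc i x s).
Proof.
move=> x; apply: (@cvgD _ _ _ (nbhs x) _ id); first exact: cvg_id.
apply: (@cvgZr_tmp _ _ _ (nbhs x)).
apply: (@cvgB _ _ _ (nbhs x)); first exact: cvg_cst.
exact: coord_continuous.
Qed.

Lemma continuous_setcr i x : continuous (setc i x).
Proof.
move=> s; apply: cvgD; first exact: cvg_cst.
by apply: cvgZr_tmp; apply: cvgB; [exact: cvg_id|exact: cvg_cst].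
Qed.

Definition depends (k : nat) g :=
  forall x y : 'cV[R]_n, (forall j : 'I_n, (j < k)%N -> x j 0 = y j 0) -> g x = g y.

End periodic.

(** * Periodic functions as bounded limits of trigonometric polynomials *)

Section closure.
Context {R : realType} {n : nat}.
Local Notation C := R[i].
Implicit Types (MM : set ('cV[R]_n -> C)).

(** [MM] stands for a set of multipliers. Bounded pointwise convergence is required rather than
    uniform convergence, because dominated convergence turns it into L^2 convergence after
    multiplication by a fixed L^2 function. *)
Record trig_closed (P : 'M[R]_n) MM : Prop := {
  trig1 : MM (fun=> 1) ;
  trigL : forall a f g, MM f -> MM g -> MM (fun x => a * f x + g x) ;
  trigM : forall f (m : 'cV[int]_n), MM f ->
    MM (fun x => f x * ez (P *m map_mx intr m) x) ;
  trig_cvg : forall f_ f (B : R), (forall k, MM (f_ k)) ->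
    (forall k x, normc (f_ k x) <= B) ->
    (forall x, ccvg (f_ ^~ x) (f x)) -> MM f }.

Section std.
Context {MM : set ('cV[R]_n -> C)} (tM : trig_closed 1%:M MM).

Lemma trig0 : MM (fun=> 0).
Proof.
have := trigL tM (- 1) (trig1 tM) (trig1 tM).
by under eq_fun do rewrite mulr1 addNr.
Qed.

Lemma trigD f g : MM f -> MM g -> MM (fun x => f x + g x).
Proof.
by move=> Mf Mg; have := trigL tM 1 Mf Mg; under eq_fun do rewrite mul1r.
Qed.

Lemma trigZ a f : MM f -> MM (fun x => a * f x).
Proof.
by move=> Mf; have := trigL tM a Mf trig0; under eq_fun do rewrite addr0.
Qed.

Lemma trig_sum I (s : seq I) (F : I -> 'cV[R]_n -> C) :
  (forall i, MM (F i)) -> MM (fun x => \sum_(i <- s) F i x).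
Proof.
move=> MF; elim: s => [|i s IHs].
  by under eq_fun do rewrite big_nil; exact: trig0.
by under eq_fun do rewrite big_cons; exact: trigD.
Qed.

Lemma trig_wt f (i : 'I_n) (s : R) : MM f ->
  MM (fun x => f x * (wt (x i 0 - s) +i* 0)%C).
Proof.
move=> Mf; have d1 : map_mx intr (delta_mx i 0 : 'cV[int]_n) = delta_mx i 0 :> 'cV[R]_n.
  by rewrite map_delta_mx.
have := trigM tM (delta_mx i 0) Mf; have := trigM tM (- delta_mx i 0) Mf.
rewrite map_mxN !mul1mx d1 => M1 M2.
have := trigL tM ((4^-1 +i* 0)%C * cexpi (2 * pi * s)) M1
  (trigL tM ((4^-1 +i* 0)%C * cexpi (- (2 * pi * s))) M2 (trigZ (2^-1 +i* 0)%C Mf)).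
congr MM; apply/funext => x; rewrite /ez dotpNl [dotp _ x]dotpC dotp_delta.
have -> : (wt (x i 0 - s) +i* 0)%C =
    (4^-1 +i* 0)%C * (cexpi (2 * pi * s) * cexpi (2 * pi * - x i 0)) +
    (4^-1 +i* 0)%C * (cexpi (- (2 * pi * s)) * cexpi (2 * pi * x i 0)) +
    (2^-1 +i* 0)%C; last by ring.
rewrite -!cexpiD.
rewrite /wt; apply: complexP; rewrite ?(cReM, cImM, cReD, cImD)/=.
  rewrite (_ : 2 * pi * s + 2 * pi * - x i 0 = - (2 * pi * (x i 0 - s))); last by ring.
  rewrite (_ : - (2 * pi * s) + 2 * pi * x i 0 = 2 * pi * (x i 0 - s)); last by ring.
  by rewrite cosN; field.
rewrite (_ : 2 * pi * s + 2 * pi * - x i 0 = - (2 * pi * (x i 0 - s))); last by ring.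
rewrite (_ : - (2 * pi * s) + 2 * pi * x i 0 = 2 * pi * (x i 0 - s)); last by ring.
by rewrite sinN; field.
Qed.

Lemma trig_wtX f (i : 'I_n) (s : R) N : MM f ->
  MM (fun x => f x * (wt (x i 0 - s) ^+ N +i* 0)%C).
Proof.
move=> Mf; elim: N => [|N IHN]; first by under eq_fun do rewrite mulr1.
have := trig_wt i s IHN; congr MM; apply/funext => x.
by rewrite -mulrA realcM exprSr.
Qed.

(* The induction replaces one coordinate at a time by its samples, so that only
   the one-dimensional Korovkin operators are needed. *)
Lemma korovkin_std_depends k (g : 'cV[R]_n -> R) : (k <= n)%N -> continuous g ->
  zperiodic g -> depends k g -> MM (fun x => (g x +i* 0)%C).
Proof.
elim: k g => [|k IHk] g kn cg pg dg.
  have := trigZ (g 0 +i* 0)%C (trig1 tM); congr MM; apply/funext => x.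
  by rewrite mulr1 (dg x 0).
pose i := Ordinal kn; have [B B0 gB] := zperiodic_bounded cg pg.
apply: (@trig_cvg _ _ tM (fun N x => (kor (fun s => g (setc i x s)) N (x i 0) +i* 0)%C) _ B).
- move=> N; pose F (j : 'I_N.+2) (x : 'cV[R]_n) : C :=
    (((N.+2%:R * wtc N)^-1 +i* 0)%C *
     ((g (setc i x (j%:R / N.+2%:R)) +i* 0)%C * (wt (x i 0 - j%:R / N.+2%:R) ^+ N +i* 0)%C)).
  have MF j : MM (F j).
    apply: trigZ; apply: trig_wtX; apply: (IHk (fun x => g (setc i x (j%:R / N.+2%:R)))).
    + exact: ltnW.
    + by move=> x; apply: (@continuous_comp _ _ _ (fun x => setc i x _) g x);
        [exact: continuous_setcl|exact: cg].
    + by move=> x m; have [m' ->] := setcDl i x (j%:R / N.+2%:R) m; exact: pg.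
    + move=> x y xy; apply: dg => l; rewrite ltnS leq_eqVlt !setcE => /orP[/eqP li|lk].
        by rewrite (_ : l = i) ?eqxx//; exact: val_inj.
      by case: eqP => // _; exact: xy.
  have := trig_sum (index_enum 'I_N.+2) MF; congr MM; apply/funext => x.
  rewrite (eq_bigr (fun j : 'I_N.+2 => ((N.+2%:R * wtc N)^-1 *
      (g (setc i x (j%:R / N.+2%:R)) * wt (x i 0 - j%:R / N.+2%:R) ^+ N) +i* 0)%C)).
    apply: complexP; rewrite ?(cRe_sum, cIm_sum)/=; last by rewrite big1.
    by apply: eq_bigr => j _; rewrite mulrC mulrA.
  by move=> j _; rewrite /F !realcM.
- by move=> N x; rewrite normc_real; apply: kor_bound => s; exact: gB.
- move=> x; split => /=; last exact: cvg_cst.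
  have := @kor_cvg _ (fun s => g (setc i x s)) B (x i 0).
  rewrite /= setc_id; apply => [s|s m|]; first exact: gB.
    by have [m' ->] := setcDr i x s m; exact: pg.
  by apply: (@continuous_comp _ _ _ (setc i x) g);
    [exact: continuous_setcr|exact: cg].
Qed.

End std.

(** In the variable [P^T x] the dual lattice becomes Z^n, and the characters indexed by the lattice
    become the standard ones. *)
Lemma korovkin_closure (P : 'M[R]_n) MM (g : 'cV[R]_n -> R) : P \in unitmx ->
  trig_closed P MM -> continuous g ->
  (forall x k, dual_lattice [set P *m map_mx intr m | m in [set: 'cV[int]_n]] k ->
    g (x + k) = g x) -> MM (fun x => (g x +i* 0)%C).
Proof.
move=> uP tM cg pg.
have uT : P^T \in unitmx by rewrite unitmx_tr.
pose MM' : set ('cV[R]_n -> C) := [set F | MM (fun x => F (P^T *m x))].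
have tM' : trig_closed 1%:M MM'.
  split.
  - by have := trig1 tM.
  - by move=> a F1 F2 M1 M2; have := trigL tM a M1 M2.
  - move=> F m /(trigM tM m); congr MM; apply/funext => x.
    by rewrite /ez mul1mx dotpC -dotp_mulmx dotpC.
  - move=> F_ F B MF FB cF; apply: (trig_cvg tM (fun k => MF k)) => [k x|x]; first exact: FB.
    exact: cF.
have := @korovkin_std_depends MM' tM' n (fun y => g (invmx P^T *m y)) (leqnn n).
have -> : (fun x => (g x +i* 0)%C) = fun x => (g (invmx P^T *m (P^T *m x)) +i* 0)%C.
  by apply/funext => x; rewrite mulKmx.
apply.
- by move=> y; apply: (@continuous_comp _ _ _ (mulmx (invmx P^T)) g);
    [exact: continuous_mulmx|exact: cg].
- move=> y m; rewrite mulmxDr; apply: pg => _ [m' _ <-].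
  rewrite dotpC dotp_mulmx mulKVmx// /dotp rpred_sum// => j _.
  by rewrite !mxE rpredM//; exact: intr_int.
- by move=> x y xy; congr (g (_ *m _)); apply/matrixP => j l; rewrite ord1 xy.
Qed.

End closure.

(** * The scaling space *)

Arguments norm_const {R n} Phi.
Arguments scaling_symbol {R n} Phi x.
Arguments scaling {R n} Phi.

Section lspan.
Context {R : realType} {n : nat}.
Local Notation C := R[i].
Local Notation mu := (lebesgue_cV n).
Local Notation rint f := (mu.-integrable setT (EFin \o f)).
Implicit Types (f g F : 'cV[R]_n -> C).

Lemma lspan_id (I : Type) (D : set I) (e : I -> 'cV[R]_n -> C) i : D i -> lspan D e (e i).
Proof.
move=> Di; exists 1%N, (fun=> i), (fun=> 1); split=> //.
by apply/funext => x; rewrite big_ord1 mul1r.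
Qed.

Lemma lspan0 (I : Type) (D : set I) (e : I -> 'cV[R]_n -> C) (i0 : I) : D i0 ->
  lspan D e (cst 0).
Proof.
move=> D0; exists 0%N, (fun=> i0), (fun=> 0); split=> //.
by apply/funext => x; rewrite big_ord0.
Qed.

Lemma lspan_linear (I : Type) (D : set I) (e : I -> 'cV[R]_n -> C) (a : C) f g :
  lspan D e f -> lspan D e g -> lspan D e (fun x => a * f x + g x).
Proof.
move=> [m [s [c [Ds ->]]]] [m' [s' [c' [Ds' ->]]]].
exists (m + m')%N, (fun i => match fintype.split i with inl j => s j | inr j => s' j end),
  (fun i => match fintype.split i with inl j => a * c j | inr j => c' j end).
split=> [i|]; first by case: (fintype.split i).
apply/funext => x; rewrite big_split_ord /= mulr_sumr; congr (_ + _).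
  by apply: eq_bigr => i _; rewrite (unsplitK (inl i)) mulrA.
by apply: eq_bigr => i _; rewrite (unsplitK (inr i)).
Qed.

Lemma lspan_sub (I : Type) (D : set I) (e : I -> 'cV[R]_n -> C) (V : set ('cV[R]_n -> C)) :
  V (cst 0) -> (forall a f g, V f -> V g -> V (fun x => a * f x + g x)) ->
  (forall i, D i -> V (e i)) -> lspan D e `<=` V.
Proof.
move=> V0 VL De _ [m [s [c [Ds ->]]]].
elim: m s c Ds => [|m IHm] s c Ds; first by under eq_fun do rewrite big_ord0.
under eq_fun do rewrite big_ord_recl.
apply: (VL (c ord0) (e (s ord0)) (fun x => \sum_(i < m) c (lift ord0 i) * e (s (lift ord0 i)) x)).
  exact: De.
by apply: (IHm (fun i => s (lift ord0 i)) (fun i => c (lift ord0 i))) => i.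
Qed.

Lemma L2_0 : L2 (cst 0 : 'cV[R]_n -> C).
Proof.
apply/L2P; split; first exact: cmeasurable_cst.
by rewrite /sqn integral0_eq// => x _; rewrite normc0 expr0n.
Qed.

Lemma L2_linear a f g : L2 f -> L2 g -> L2 (fun x => a * f x + g x).
Proof. by move=> Lf Lg; apply: L2D => //; exact: L2Z. Qed.

Lemma closed_subspace_lspan (I : Type) (D : set I) (e : I -> 'cV[R]_n -> C) (i0 : I) :
  D i0 -> (forall i, D i -> L2 (e i)) -> closed_subspace (L2closure (lspan D e)).
Proof.
move=> D0 De; apply: closed_subspace_L2closure.
- by apply: lspan_sub => //; [exact: L2_0|exact: L2_linear].
- exact: lspan0 D0.
- by move=> a f g; exact: lspan_linear.
Qed.

Lemma closed_subspaceD (W : set ('cV[R]_n -> C)) f g : closed_subspace W ->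
  W f -> W g -> W (fun x => f x + g x).
Proof.
by move=> cW Wf Wg; have := Defs.closed_subspaceP cW 1 Wf Wg; under eq_fun do rewrite mul1r.
Qed.

Lemma closed_subspaceZ (W : set ('cV[R]_n -> C)) a f : closed_subspace W ->
  W f -> W (fun x => a * f x).
Proof.
move=> cW Wf; have := Defs.closed_subspaceP cW a Wf (closed_subspace0 cW).
by under eq_fun do rewrite addr0.
Qed.

Lemma closed_subspace_dominated (W : set ('cV[R]_n -> C))
    (f_ : nat -> 'cV[R]_n -> C) f (G : 'cV[R]_n -> R) : closed_subspace W ->
  (forall k, W (f_ k)) -> (forall x, ccvg (f_ ^~ x) (f x)) -> rint G ->
  (forall k x, normc (f_ k x) ^+ 2 <= G x) -> W f.
Proof.
move=> cW Wf cf iG fG; apply: (closed_subspace_closed cW).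
have WL := closed_subspace_L2 cW.
apply: (L2closure_dominated WL _ cf iG fG) => k.
by apply: sub_L2closure => //; exact: Wf.
Qed.

(** The multipliers [f] such that [w * f] times every lattice character lies in [W] form a
    [trig_closed] set. Asking for every character in the definition is what makes this set stable
    under characters. *)
Lemma closed_subspace_periodic (W : set ('cV[R]_n -> C)) (P : 'M[R]_n)
    (w : 'cV[R]_n -> C) (g : 'cV[R]_n -> R) : closed_subspace W -> P \in unitmx ->
  L2 w -> (forall m : 'cV[int]_n, W (fun x => w x * ez (P *m map_mx intr m) x)) ->
  continuous g ->
  (forall x k, dual_lattice [set P *m map_mx intr m | m in [set: 'cV[int]_n]] k ->
    g (x + k) = g x) -> W (fun x => w x * (g x +i* 0)%C).
Proof.
move=> cW uP Lw We cg pg.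
pose MM : set ('cV[R]_n -> C) := [set f | forall m : 'cV[int]_n,
  W (fun x => w x * f x * ez (P *m map_mx intr m) x)].
have tM : trig_closed P MM.
  split.
  - by move=> m; under eq_fun do rewrite mulr1; exact: We.
  - move=> a f h Mf Mh m; have := Defs.closed_subspaceP cW a (Mf m) (Mh m).
    by congr W; apply/funext => x; ring.
  - move=> f m Mf m'; have := Mf (m + m'); congr W; apply/funext => x.
    by rewrite map_mxD mulmxDr ezDl; ring.
  - move=> f_ f B Mf fB cf m.
    apply: (closed_subspace_dominated cW (fun k => Mf k m)
      (G := fun x => B ^+ 2 * normc (w x) ^+ 2)).
    + move=> x; apply: ccvgM; last exact: ccvg_cst.
      by apply: ccvgM; [exact: ccvg_cst|exact: cf].
    + exact/rintZ/L2_rint.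
    + move=> k x; rewrite !normcM normc_ez mulr1 exprMn mulrC.
      by rewrite ler_wpM2r ?sqr_ge0// ler_sqr ?nnegrE ?normc_ge0// (le_trans (normc_ge0 _) (fB k x)).
have := korovkin_closure uP tM cg pg 0; congr W; apply/funext => x.
by rewrite map_mx0 mulmx0 ez0 mulr1.
Qed.

Lemma iftD F1 F2 x : ctest F1 -> ctest F2 ->
  ift (fun xi => F1 xi + F2 xi) x = ift F1 x + ift F2 x.
Proof.
move=> t1 t2; rewrite -cintegralD; [|exact/ctest_cintegrable/ctest_modulation..].
by apply: eq_cintegral => xi; rewrite mulrDl.
Qed.

Lemma iftZ a F x : ctest F -> ift (fun xi => a * F xi) x = a * ift F x.
Proof.
move=> tF; rewrite -cintegralZ; last exact/ctest_cintegrable/ctest_modulation.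
by apply: eq_cintegral => xi; rewrite mulrA.
Qed.

Lemma ift0 x : ift (cst 0 : 'cV[R]_n -> C) x = 0.
Proof.
transitivity (cintegral (fun _ : 'cV[R]_n => 0 : C)); last exact: cintegral0.
by apply: eq_cintegral => xi; rewrite mul0r.
Qed.

Lemma iftB F1 F2 x : ctest F1 -> ctest F2 ->
  ift (fun xi => F1 xi - F2 xi) x = ift F1 x - ift F2 x.
Proof.
move=> t1 t2; rewrite -mulN1r -iftZ// -iftD//; last exact: ctestZ.
by congr (ift _ _); apply/funext => xi; rewrite mulN1r.
Qed.

Lemma ctest0 : ctest (cst 0 : 'cV[R]_n -> C).
Proof.
by apply: (ctest_real (f := cst 0)); split; [move=> k; exact: Ck_cst|exists 0].
Qed.

Lemma ctestB F1 F2 : ctest F1 -> ctest F2 -> ctest (fun x => F1 x - F2 x).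
Proof.
move=> t1 t2; under eq_fun do rewrite -mulN1r.
by apply: ctestD => //; exact: ctestZ.
Qed.

Lemma plancherel F : ctest F -> sqn (ift F) = ((Re (@fconst R n))%:E * sqn F)%E.
Proof.
move=> tF; have := parseval tF tF; rewrite !cintegral_mulJ.
have [k k0 ->] := @fconst_gt0 R n; rewrite realcM => -[E].
by rewrite (sqnE (L2_ift tF)) (sqnE (ctest_L2 tF)) E.
Qed.

(** The approximants are finite combinations of test functions, so Plancherel's identity for test
    functions is enough to carry the approximation over to the space side. *)
Lemma ift_lspan (I : Type) (D : set I) (e : I -> 'cV[R]_n -> C) F :
  (forall i, D i -> ctest (e i)) -> ctest F -> L2closure (lspan D e) F ->
  L2closure (lspan D (fun i => ift (e i))) (ift F).
Proof.
move=> te tF /L2closureP[LF HF]; apply/L2closureP; split; first exact: L2_ift.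
have [k k0 kE] := @fconst_gt0 R n.
move=> eps eps0; have [g Dg Hg] := HF (eps / k) (divr_gt0 eps0 k0).
have [tg Dig] : (ctest g /\ lspan D (fun i => ift (e i)) (ift g)).
  have [m [s [c [Ds gE]]]] := Dg; rewrite gE.
  have tE m' (s' : 'I_m' -> I) c' : (forall i, D (s' i)) ->
      ctest (fun x => \sum_(i < m') c' i * e (s' i) x) /\
      (forall x, ift (fun x => \sum_(i < m') c' i * e (s' i) x) x =
        \sum_(i < m') c' i * ift (e (s' i)) x).
    elim: m' s' c' => [|m' IH] s' c' Ds'.
      by split=> [|x]; under eq_fun do rewrite big_ord0; [exact: ctest0|rewrite big_ord0 ift0].
    have [t E] := IH (fun i => s' (lift ord0 i)) (fun i => c' (lift ord0 i)) (fun i => Ds' _).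
    have t0 : ctest (fun x => c' ord0 * e (s' ord0) x) by apply: ctestZ; exact: te.
    split=> [|x].
      by under eq_fun do rewrite big_ord_recl; exact: ctestD.
    under eq_fun do rewrite big_ord_recl.
    by rewrite iftD// iftZ ?E ?big_ord_recl//; exact: te.
  have [t E] := tE m s c Ds; split=> //.
  by exists m, s, c; split=> //; apply/funext.
exists (ift g) => //.
have -> : (fun x => ift F x - ift g x) = ift (fun x => F x - g x).
  by apply/funext => x; rewrite iftB.
rewrite plancherel; last exact: ctestB.
by rewrite kE /= -(mulfVK (lt0r_neq0 k0) eps) mulrC EFinM lte_pmul2l.
Qed.

End lspan.

Section core.
Context {R : realType} {n : nat}.
Local Notation C := R[i].
Context {L G : set 'cV[R]_n} (dL : discrete_group L) {P : 'M[R]_n} (uP : P \in unitmx).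
Context (GP : G = [set P *m map_mx intr m | m in [set: 'cV[int]_n]]).
Context (LG : L = dual_lattice G).
Context {Phi : 'cV[R]_n -> R} {V : set 'cV[R]_n} (tPhi : rtest Phi).
Context (pPhi : forall x, per L (fun y => Phi y ^+ 2) x = 1).
Context (PhiV : forall x, V x ->
  Phi x = 1 /\ forall k, L k -> k != 0 -> Phi (x + k) = 0).

Lemma lattice0 : G 0.
Proof. by rewrite GP; exists 0 => //; rewrite map_mx0 mulmx0. Qed.

Lemma latticeN g : G g -> G (- g).
Proof. by rewrite GP => -[m _ <-]; exists (- m) => //; rewrite map_mxN mulmxN. Qed.

Lemma ctest_scaling_ez g : ctest (fun x => scaling_symbol Phi x * ez (- g) x).
Proof. by apply: ctest_ez; exact: ctest_scaling. Qed.

Lemma L2_translate_scaling g : L2 (translate g (scaling Phi)).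
Proof. by rewrite translate_scaling//; apply: L2_ift; exact: ctest_scaling_ez. Qed.

Definition scaling_space := L2closure (lspan G (fun y => translate y (scaling Phi))).

Lemma scaling_space_closed : closed_subspace scaling_space.
Proof.
apply: (closed_subspace_lspan lattice0) => g _; exact: L2_translate_scaling.
Qed.

(* [F] is the product of the symbol with the periodization of [F]: the latter
   is approximated by trigonometric polynomials. *)
Lemma ift_scaling_space F : ctest F -> (forall x, F x != 0 -> V x) ->
  scaling_space (ift F).
Proof.
move=> tF FV; rewrite /scaling_space.
have -> : (fun y => translate y (scaling Phi)) =
    (fun y => ift (fun x => scaling_symbol Phi x * ez (- y) x)).
  by apply/funext => y; exact: translate_scaling.
apply: ift_lspan => //; first by move=> g _; exact: ctest_scaling_ez.
set W := L2closure _.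
have cW : closed_subspace W.
  by apply: (closed_subspace_lspan lattice0) => g _; apply: ctest_L2; exact: ctest_scaling_ez.
have H (f : 'cV[R]_n -> R) : rtest f -> (forall x, f x != 0 -> V x) ->
    W (fun x => (f x +i* 0)%C).
  move=> [Cf bf] fV; set c := norm_const Phi; have c0 : 0 < c by exact: (norm_const_gt0 tPhi pPhi).
  have := @closed_subspace_periodic R n W P (scaling_symbol Phi)
    (fun x => c^-1 * per L f x) cW uP.
  have -> : (fun x => scaling_symbol Phi x * (c^-1 * per L f x +i* 0)%C) =
      fun x => (f x +i* 0)%C.
    apply/funext => x; rewrite /scaling_symbol realcM -/c; congr (_ +i* _)%C.
    rewrite mulrCA mulrA mulrA mulVf ?lt0r_neq0// mul1r.
    have [Px|Px] := eqVneq (Phi x) 0.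
      rewrite Px mul0r; apply/esym/eqP; apply: contraTT isT => /fV /PhiV[].
      by rewrite Px => /eqP; rewrite eq_sym oner_eq0.
    (* If [f (x + k)] were nonzero, [x + k] would lie in [V], and the vanishing of [Phi] at its
       translate by [- k] would give [Phi x = 0]. *)
    rewrite (per_single dL bf); last first.
      move=> k Lk k0; apply/eqP; apply: contraNT Px => /fV /PhiV[_].
      move=> /(_ (- k)); rewrite addrK => ->//; rewrite ?oppr_eq0//.
      exact: discreteN.
    have [->|fx] := eqVneq (f x) 0; first by rewrite mulr0.
    by have [-> _] := PhiV (fV _ fx); rewrite mul1r.
  apply.
  - by apply: ctest_L2; exact: ctest_scaling.
  - move=> m; apply: sub_L2closure.
      apply: lspan_sub => [||g _]; [exact: L2_0|exact: L2_linear|].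
      by apply: ctest_L2; exact: ctest_scaling_ez.
    have -> : (fun x => scaling_symbol Phi x * ez (P *m map_mx intr m) x) =
        (fun y x => scaling_symbol Phi x * ez (- y) x) (- (P *m map_mx intr m)).
      by apply/funext => x; rewrite opprK.
    apply: lspan_id.
    by apply: latticeN; rewrite GP; exists m.
  - by apply: (@Cinf_continuous _ _ (fun x => c^-1 * per L f x)) => k; apply: CkM; [exact: Ck_cst|exact: Ck_per].
  - move=> x k; rewrite -GP -LG => Lk; by rewrite (per_transl dL).
have [F1 F2] := tF.
have W1 : W (fun x => (Re (F x) +i* 0)%C).
  by apply: (H _ F1) => x Fx; apply: FV; apply: contra_neq Fx => ->.
have W2 : W (fun x => (Im (F x) +i* 0)%C).
  by apply: (H _ F2) => x Fx; apply: FV; apply: contra_neq Fx => ->.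
have := Defs.closed_subspaceP cW (0 +i* 1)%C W2 W1; congr W; apply/funext => x.
by case: (F x) => a b; apply: complexP; rewrite ?(cReD, cImD, cReM, cImM)/=; ring.
Qed.

End core.

(** * Density in L^2 *)

Section density.
Context {R : realType} {n : nat}.
Local Notation C := R[i].
Local Notation mu := (lebesgue_cV n).
Local Notation rint f := (mu.-integrable setT (EFin \o f)).
Context {W : set ('cV[R]_n -> C)} (cW : closed_subspace W).
Context (CW : forall f : 'cV[R]_n -> R, continuous f -> bsupp f ->
  W (fun x => (f x +i* 0)%C)).

Let WR (f : 'cV[R]_n -> R) := W (fun x => (f x +i* 0)%C).

Lemma real_subspaceD f g : WR f -> WR g -> WR (fun x => f x + g x).
Proof.
move=> Wf Wg; have := closed_subspaceD cW Wf Wg; congr W; apply/funext => x.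
by apply: complexP; rewrite ?(cReD, cImD)/= ?addr0.
Qed.

Lemma real_subspaceZ a f : WR f -> WR (fun x => a * f x).
Proof.
move=> Wf; have := closed_subspaceZ (a +i* 0)%C cW Wf; congr W; apply/funext => x.
exact: realcM.
Qed.

Lemma real_subspace0 : WR (fun=> 0).
Proof. exact: closed_subspace0 cW. Qed.

Lemma real_subspace_sum I (s : seq I) (F : I -> 'cV[R]_n -> R) :
  (forall i, WR (F i)) -> WR (fun x => \sum_(i <- s) F i x).
Proof.
move=> WF; elim: s => [|i s IHs].
  by rewrite /WR; under eq_fun do rewrite big_nil; exact: real_subspace0.
by rewrite /WR; under eq_fun do rewrite big_cons; exact: real_subspaceD.
Qed.

Lemma real_subspace_dominated (f_ : nat -> 'cV[R]_n -> R) f (G : 'cV[R]_n -> R) :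
  (forall k, WR (f_ k)) -> (forall x, f_ k x @[k --> \oo] --> f x) -> rint G ->
  (forall k x, `|f_ k x| ^+ 2 <= G x) -> WR f.
Proof.
move=> Wf cf iG fG; apply: (closed_subspace_dominated cW Wf _ iG) => [x|k x].
  by split => /=; [exact: cf|exact: cvg_cst].
by rewrite normc_real.
Qed.

(** For [a <= b] this is 1 on [[a, b]] and falls to 0 with slope [k + 1] outside: continuous
    functions tending pointwise to the indicator of the closed interval. *)
Definition trap (k : nat) (a b t : R) : R :=
  Num.max 0 (1 - k.+1%:R * Num.max 0 (Num.max (a - t) (t - b))).

Lemma trap_ge0 k a b t : 0 <= trap k a b t.
Proof. by rewrite /trap le_max lexx. Qed.

Lemma trap_le k a b t : trap k a b t <= trap 0 a b t.
Proof.
rewrite /trap; set d := Num.max 0 (Num.max (a - t) (t - b)); have d0 : 0 <= d by rewrite /d le_max lexx.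
rewrite ge_max le_max lexx/= le_max; apply/orP; right.
by rewrite lerB// mul1r ler_peMl// ler1n.
Qed.

Lemma trap_in k a b t : t \in `[a, b] -> trap k a b t = 1.
Proof.
rewrite in_itv/= => /andP[at_ tb]; rewrite /trap.
rewrite (max_l (_ : Num.max (a - t) (t - b) <= 0)); last by rewrite ge_max !subr_le0 at_.
by rewrite mulr0 subr0 max_r.
Qed.

Lemma trap_out a b t : t \notin `[a, b] -> \forall k \near \oo, trap k a b t = 0.
Proof.
rewrite in_itv/= negb_and -!ltNge => H; rewrite /trap.
set d := Num.max (a - t) (t - b).
have d0 : 0 < d by rewrite lt_max !subr_gt0.
rewrite (max_r (ltW d0)); have := @cvg_harmonic R; move/cvgrPdist_le => /(_ _ d0).
apply: filterS => k; rewrite /harmonic/= sub0r normrN ger0_norm// => kd.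
by rewrite max_l// subr_le0 -ler_pdivrMl// mulr1.
Qed.

Lemma trap_lt1 k a b t : trap k a b t != 0 -> `|t| <= `|a| + `|b| + 1.
Proof.
move=> H; have : trap 0 a b t != 0.
  by apply: contra_neq H => t0; apply/eqP; rewrite eq_le trap_ge0 andbT -t0 trap_le.
rewrite /trap mul1r => {}H; have : Num.max (a - t) (t - b) < 1.
  rewrite ltNge; apply: contra_neqN H => d1.
  by rewrite max_l// (max_r (le_trans ler01 d1)) subr_le0.
rewrite gt_max => /andP[]; have := ler_norm b; have := ler_normr a (- a); rewrite opprK lexx orbT.
have := ler_norm (- a); rewrite normrN.
move=> ? _ ? ? ?; rewrite ler_norml; apply/andP; split; have := normr_ge0 a; have := normr_ge0 b; lra.
Qed.

Lemma continuous_trap k a b : continuous (trap k a b).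
Proof.
move=> t; apply: (@continuous_max _ _ (cst 0) (fun t => 1 - k.+1%:R * _)).
  exact: cvg_cst.
apply: cvgB; first exact: cvg_cst.
apply: cvgM; first exact: cvg_cst.
apply: (@continuous_max _ _ (cst 0) (fun t => Num.max (a - t) (t - b))).
  exact: cvg_cst.
apply: (@continuous_max _ _ (fun t => a - t) (fun t => t - b)).
  by apply: cvgB; [exact: cvg_cst|exact: cvg_id].
by apply: cvgB; [exact: cvg_id|exact: cvg_cst].
Qed.

Lemma real_subspace_box (a b : 'I_n -> R) : WR (\1_(box a b)).
Proof.
pose F k (x : 'cV[R]_n) := \prod_(i < n) trap k (a i) (b i) (x i 0).
have cF k : continuous (F k).
  have C (s : seq 'I_n) : continuous (fun x : 'cV[R]_n => \prod_(i <- s) trap k (a i) (b i) (x i 0)).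
    elim: s => [|i s IHs].
      by under eq_fun do rewrite big_nil; move=> x; apply: (@cvg_cst _ _ _ (nbhs x)).
    under eq_fun do rewrite big_cons; move=> x.
    apply: (@cvgM _ _ (nbhs x)); last exact: IHs.
    apply: (@continuous_comp _ _ _ (fun x : 'cV[R]_n => x i 0) (trap k (a i) (b i))).
      exact: coord_continuous.
    exact: continuous_trap.
  exact: C.
have bF k : bsupp (F k).
  exists (\sum_(i < n) (`|a i| + `|b i| + 1)) => x xr; apply/eqP.
  apply: contraTT xr; rewrite -leNgt prodf_seq_neq0 => /allP H.
  apply: cV_norm_le => [|i]; first by apply: sumr_ge0 => i _; rewrite !addr_ge0.
  have /trap_lt1 /le_trans-> // : trap k (a i) (b i) (x i 0) != 0.
    exact: H (mem_index_enum i).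
  by rewrite (bigD1 i)//= lerDl sumr_ge0// => j _; rewrite !addr_ge0.
have F0 k x : 0 <= F k x by apply: prodr_ge0 => i _; exact: trap_ge0.
have FF k x : F k x <= F 0%N x.
  by apply: ler_prod => i _; rewrite trap_ge0 trap_le.
have F1 x : F 0%N x <= 1.
  rewrite -[leRHS](@big1_eq _ _ *%R _ (index_enum 'I_n) xpredT).
  apply: ler_prod => i _; rewrite trap_ge0/= /trap ge_max ler01/= lerBlDr lerDl mul1r.
  by rewrite le_max lexx.
apply: (real_subspace_dominated (f_ := F) (G := F 0%N)).
- by move=> k; apply: CW.
- move=> x; rewrite indicE; have [/= Bx|nBx] := boolP (x \in box a b).
    rewrite (_ : F ^~ x = cst 1); first exact: cvg_cst.
    apply/funext => k; apply: big1 => i _; apply: trap_in.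
    exact: (set_mem Bx).
  have [i xi] : exists i, x i 0 \notin `[a i, b i].
    apply: contrapT => H; move/negP: nBx; apply; apply/mem_set => i.
    by apply: contrapT => xi; apply: H; exists i; exact/negP.
  apply: cvg_near_cst; apply: filterS (trap_out xi) => k ki.
  by rewrite /F (bigD1 i)//= ki mul0r.
- exact: rint_continuous_bsupp.
- move=> k x; rewrite ger0_norm// expr2 (le_trans _ (FF k x))//.
  by rewrite ler_piMl// (le_trans (FF k x)).
Qed.

Lemma bsupp_box (a b : 'I_n -> R) : bsupp (\1_(box a b) : 'cV[R]_n -> R).
Proof.
exists (\sum_(i < n) (`|a i| + `|b i|)) => x xr; rewrite indicE.
case: (boolP (x \in box a b)) xr => // /set_mem Bx.
rewrite ltNge => /negP[]; apply: cV_norm_le => [|i].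
  by apply: sumr_ge0 => i _; rewrite addr_ge0.
apply: (@le_trans _ _ (`|a i| + `|b i|)); last first.
  by rewrite (bigD1 i)//= lerDl sumr_ge0// => j _; rewrite addr_ge0.
have := Bx i; rewrite in_itv/= => /andP[].
have := ler_norm (- a i); rewrite normrN; have := ler_norm (b i).
have := normr_ge0 (a i); have := normr_ge0 (b i).
by move=> *; rewrite ler_norml; apply/andP; split; lra.
Qed.

Lemma rint_box (a b : 'I_n -> R) : rint (\1_(box a b) : 'cV[R]_n -> R).
Proof.
apply: (@rint_bsupp _ _ _ 1); last exact: bsupp_box.
  by apply: measurable_indic; exact: measurable_box.
by move=> x; rewrite indicE ger0_norm// lern1 leq_b1.
Qed.

(** Dynkin's argument starting from boxes. Intersecting with a fixed box supplies the integrable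
    majorant for the countable unions and makes the complement a difference of two members. *)
Lemma real_subspace_indic A (a b : 'I_n -> R) : measurable A ->
  WR (\1_(A `&` box a b)).
Proof.
move=> mA; move: a b.
apply: (@dynkin_induction _ _ (@boxes R n)
  (fun A => forall a b, WR (\1_(A `&` box a b)))) => //.
- exact: measurable_boxesE.
- exact: setI_closed_boxes.
- by move=> a b; rewrite setTI; exact: real_subspace_box.
- move=> _ [a' [b' ->]] a b.
  have [a2 [b2 ->]] := setI_closed_boxes (ex_intro _ a' (ex_intro _ b' erefl))
    (ex_intro _ a (ex_intro _ b erefl)).
  exact: real_subspace_box.
- move=> S mS WS a b.
  have := real_subspaceD (real_subspace_box a b) (real_subspaceZ (-1) (WS a b)).
  congr WR; apply/funext => x; rewrite !indicE !in_setI in_setC.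
  by case: (x \in S) => /=; rewrite ?mulr0 ?addr0// mulN1r subrr.
- move=> F mF tF WF a b.
  pose f_ k (x : 'cV[R]_n) : R := \sum_(j < k) \1_(F j `&` box a b) x.
  have fE k x : f_ k x = \1_(box a b) x * ([exists j : 'I_k, x \in F j])%:R.
    rewrite /f_ indicE; have [Bx|nBx] := boolP (x \in box a b); last first.
      by rewrite mul0r big1// => j _; rewrite indicE in_setI (negbTE nBx) andbF.
    rewrite mul1r; case: existsP => [[j xj]|nx].
      rewrite (bigD1 j)//= indicE in_setI xj Bx big1 ?addr0// => l lj.
      rewrite indicE in_setI; have [xl|//] := boolP (x \in F l).
      have /trivIsetP := tF => /(_ l j I I); rewrite -val_eqE in lj.
      by move=> /(_ lj)/seteqP[/(_ x) H _]; case: H; split; exact: set_mem.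
    rewrite big1// => j _; rewrite indicE in_setI.
    by case: (boolP (x \in F j)) => // xj; case: nx; exists j.
  apply: (real_subspace_dominated (f_ := f_) (G := \1_(box a b))).
  + by move=> k; apply: real_subspace_sum => j; exact: WF.
  + move=> x; apply: cvg_near_cst.
    have [[j _ Fj]|nF] := pselect ((\bigcup_k F k) x).
      exists j.+1 => //= k jk; rewrite fE !indicE in_setI.
      rewrite (_ : [exists j, _] = true); last first.
        by apply/existsP; exists (Ordinal jk); exact/mem_set.
      by rewrite mulr1 [x \in \bigcup_k F k]mem_set//; exists j.
    exists 0%N => //= k _; rewrite fE !indicE in_setI.
    rewrite [x \in \bigcup_k F k]memNset// (_ : [exists j, _] = false) ?mulr0//.
    by apply/negbTE/negP => /existsP[j /set_mem xj]; apply: nF; exists j.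
  + exact: rint_box.
  + move=> k x; rewrite fE indicE -natrM ger0_norm// -natrX ler_nat.
    by case: (x \in box a b) => //; case: [exists j, _].
- by rewrite -measurable_boxesE.
Qed.

Import HBNNSimple.

(** Simple functions increasing to [f] need not be square integrable combinations of bounded sets,
    hence the truncation to growing cubes. *)
Lemma real_subspace_ge0 (f : 'cV[R]_n -> R) : measurable_fun setT f ->
  (forall x, 0 <= f x) -> rint (fun x => f x ^+ 2) -> WR f.
Proof.
move=> mf f0 if2.
have mEf : measurable_fun setT (EFin \o f) by exact/measurable_EFinP.
pose phi := nnsfun_approx measurableT mEf.
pose B k : set 'cV[R]_n := box (fun=> - k%:R) (fun=> k%:R).
have ef0 x : setT x -> (0 <= (EFin \o f) x)%E by rewrite lee_fin.
have phile k x : phi k x <= f x.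
  by have := le_approx k ef0 (x := x) I; rewrite -nnsfun_approxE lee_fin.
apply: (real_subspace_dominated (f_ := fun k x => phi k x * \1_(B k) x)
  (G := fun x => f x ^+ 2)) => //.
- move=> k; rewrite (_ : (fun _ => _) = fun x =>
    \sum_(i < size (finmap.enum_fset (fset_set (range (phi k)))))
      ((finmap.enum_fset (fset_set (range (phi k))))`_i * \1_((phi k @^-1` [set (finmap.enum_fset (fset_set (range (phi k))))`_i]) `&` B k) x)).
    apply: real_subspace_sum => i; apply: real_subspaceZ.
    apply: real_subspace_indic.
    exact: measurable_sfunP.
  apply/funext => x; rewrite [phi k x]fimfunEord mulr_suml; apply: eq_bigr => i _.
  by rewrite -mulrA indicI.
- move=> x; rewrite -[f x]mulr1; apply: cvgM.
    have := @cvg_nnsfun_approx _ _ _ _ measurableT _ mEf ef0 x I.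
    exact: fine_cvg.
  apply: cvg_near_cst; exists (Num.truncn `|x|).+1 => //= k xk.
  rewrite indicE mem_set// => i; rewrite in_itv/= -ler_norml.
  rewrite (le_trans (mx_norm_coord _ _ _))// ltW// (lt_le_trans (truncnS_gt _))//.
  by rewrite ler_nat.
- move=> k x; rewrite ler_sqr ?nnegrE// ger0_norm; last by rewrite mulr_ge0// indicE.
  rewrite indicE; case: (x \in B k); rewrite ?mulr1 ?mulr0//; exact: phile.
Qed.

Lemma L2_sub_closed_subspace : L2 `<=` W.
Proof.
move=> f Lf; have [[m1 m2] _] := Lf; have i2 := L2_rint Lf.
have H (g : 'cV[R]_n -> R) : measurable_fun setT g ->
    (forall x, g x ^+ 2 <= normc (f x) ^+ 2) -> WR g.
  move=> mg gf.
  (* For [e = 1] and [e = -1] these are the positive and negative parts of [g]. *)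
  have D (e : R) : `|e| = 1 -> WR (fun x => (`|g x| + e * g x) / 2).
    move=> e1; have h (x : 'cV[R]_n) : `|e * g x| = `|g x| by rewrite normrM e1 mul1r.
    have h0 x : 0 <= (`|g x| + e * g x) / 2.
      by rewrite divr_ge0// -lerBlDl sub0r lerNl -h -normrN ler_norm.
    have mh : measurable_fun setT (fun x => (`|g x| + e * g x) / 2).
      apply: measurable_funM => //; apply: measurable_funD.
        exact: (measurableT_comp (@normr_measurable R setT) mg).
      exact: measurable_funM.
    apply: real_subspace_ge0 => //.
    apply: (rint_le _ i2) => [|x]; first exact: measurable_funX.
    rewrite ger0_norm ?sqr_ge0// (le_trans _ (gf x))// -[leRHS]real_normK ?num_real//.
    rewrite ler_sqr ?nnegrE// ler_pdivrMr//.
    by have := ler_norm (e * g x); rewrite h; lra.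
  have := real_subspaceD (D 1 (normr1 R)) (real_subspaceZ (- 1) (D (- 1) (normrN1 R))).
  by congr WR; apply/funext => x; field.
have W1 : WR (fun x => Re (f x)).
  by apply: H => // x; rewrite normc_sqr lerDl sqr_ge0.
have W2 : WR (fun x => Im (f x)).
  by apply: H => // x; rewrite normc_sqr lerDr sqr_ge0.
have := Defs.closed_subspaceP cW (0 +i* 1)%C W2 W1; congr W; apply/funext => x.
by case: (f x) => a b; apply: complexP; rewrite ?(cReD, cImD, cReM, cImM)/=; ring.
Qed.

End density.

(** * Density of the inverse transforms of test functions *)

Section dilation.
Context {R : realType} {n : nat}.
Local Notation C := R[i].
Local Notation mu := (lebesgue_cV n).
Local Notation rint f := (mu.-integrable setT (EFin \o f)).
Implicit Types (F : 'cV[R]_n -> C) (x v : 'cV[R]_n).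

Lemma ctest_transl F v : ctest F -> ctest (fun x => F (x + v)).
Proof.
by move=> /(ctest_affine v (unitmx1 R n)); under eq_fun do rewrite mul1mx.
Qed.

Lemma ctest_mulmx F (M : 'M[R]_n) : M \in unitmx -> ctest F ->
  ctest (fun x => F (M *m x)).
Proof.
by move=> uM /(ctest_affine 0 uM); under eq_fun do rewrite addr0.
Qed.

Lemma ift_modulation F v x : ctest F ->
  ift F x * ez v x = ift (fun xi => F (xi - v)) x.
Proof.
move=> tF; have t2 := ctest_transl (- v) tF.
have t3 : ctest (fun xi => F (xi - v) * ez x xi) by exact: ctest_ez.
rewrite -[RHS]/(cintegral (fun xi => F (xi - v) * ez x xi)).
rewrite -[RHS](cintegral_transl v); last exact: ctest_cintegrable.
rewrite -cintegralZr; last exact/ctest_cintegrable/ctest_ez.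
by apply: eq_cintegral => xi; rewrite addrK ezDr mulrA [ez x v]ezC.
Qed.

Lemma ift_lscale F (M : 'M[R]_n) x : M \in unitmx -> ctest F ->
  ift F (M *m x) = (lscale M^T +i* 0)%C * ift (fun xi => F (invmx M^T *m xi)) x.
Proof.
move=> uM tF; have uT : M^T \in unitmx by rewrite unitmx_tr.
rewrite -cintegral_lscale//; last first.
  apply/ctest_cintegrable/ctest_modulation.
  by apply: ctest_mulmx => //; rewrite unitmx_inv.
by apply: eq_cintegral => xi; rewrite mulKmx// dotp_mulmx.
Qed.

Context {W : set ('cV[R]_n -> C)} (cW : closed_subspace W).
Context (HW : forall F, ctest F -> W (ift F)).

(** A function with compactly supported spectrum and positive value at 0. Its dilates are cutoffs
    tending to a nonzero constant, and multiplying them by a character merely translates the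
    spectrum, so that the products remain inverse transforms of test functions. *)
Let K0 := ift (fun xi : 'cV[R]_n => (bump 0 1 xi +i* 0)%C).

Let tB : ctest (fun xi : 'cV[R]_n => (bump 0 1 xi +i* 0)%C).
Proof. by apply: ctest_real; apply: rtest_bump. Qed.

Let K00 : exists2 c : R, 0 < c & K0 0 = (c +i* 0)%C.
Proof.
exists (\int[mu]_x bump (0 : 'cV[R]_n) 1 x).
  have [Cb bb] := rtest_bump (0 : 'cV[R]_n) (@ltr01 R).
  apply: (@Rintegral_gt0 _ _ _ 0).
  - exact: Cinf_continuous.
  - exact: bump_ge0.
  - exact: rint_continuous_bsupp (Cinf_continuous Cb) bb.
  - by rewrite bump_gt0// subrr normr0.
rewrite /K0 /ift; transitivity (cintegral (fun x : 'cV[R]_n => (bump 0 1 x +i* 0)%C)).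
  by apply: eq_cintegral => xi; rewrite dotp0l mulr0 cexpi0 mulr1.
by rewrite /cintegral/= /Rintegral integral0.
Qed.

Let K0W (M : 'M[R]_n) v : M \in unitmx -> W (fun x => K0 (M *m x) * ez v x).
Proof.
move=> uM; have uT : invmx M^T \in unitmx by rewrite unitmx_inv unitmx_tr.
pose F1 (xi : 'cV[R]_n) : C := (bump 0 1 (invmx M^T *m xi) +i* 0)%C.
have tM : ctest F1 := ctest_mulmx uT tB.
have := closed_subspaceZ (lscale M^T +i* 0)%C cW (HW (ctest_transl (- v) tM)).
congr W; apply/funext => x; rewrite -[ift _ _](ift_modulation v x tM) mulrA; congr (_ * _).
by rewrite /K0 [RHS]ift_lscale.
Qed.

Let dual_scalar (rho : R) k : 0 < rho ->
  dual_lattice [set (rho^-1)%:M *m map_mx intr m | m in [set: 'cV[int]_n]] k ->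
  k != 0 -> rho <= `|k|.
Proof.
move=> r0 Lk k0; have [i ki] : exists i, k i 0 != 0.
  apply: contrapT => H; move/eqP: k0; apply; apply/matrixP => i j.
  by rewrite ord1 mxE; apply/eqP/negPn/negP => ki; apply: H; exists i.
apply: le_trans (mx_norm_coord k i 0).
have := Lk ((rho^-1)%:M *m map_mx intr (delta_mx i 0 : 'cV[int]_n)).
rewrite map_delta_mx mul_scalar_mx dotpZr dotp_delta => /(_ _)/intrP[|m Em].
  by exists (delta_mx i 0) => //; rewrite map_delta_mx mul_scalar_mx.
have {}Em : k i 0 = rho * m%:~R by rewrite -Em mulrA divff ?mul1r// lt0r_neq0.
have m0 : m != 0 by apply: contra_neq ki => m0; rewrite Em m0 mulr0.
rewrite Em normrM gtr0_norm// ler_peMr ?(ltW r0)//.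
by rewrite -intr_norm ler1z -gtz0_ge1 normr_gt0.
Qed.

Let CcK0 (f : 'cV[R]_n -> R) (M : 'M[R]_n) : M \in unitmx -> continuous f -> bsupp f ->
  W (fun x => K0 (M *m x) * (f x +i* 0)%C).
Proof.
move=> uM cf bf; have [B B0 fB] := continuous_bsupp_bounded cf bf.
have [r r0 fr] := bsupp_pos bf.
(* The term [2 * r] separates the translates of the support, so that all periodizations are bounded
   by [B]; the term [k.+1] makes the period tend to infinity. *)
pose rho (k : nat) : R := 2 * r + k.+1%:R.
have rho0 k : 0 < rho k by rewrite addr_gt0// mulr_gt0.
pose G k := [set ((rho k)^-1)%:M *m map_mx intr m | m in [set: 'cV[int]_n]].
have uR k : ((rho k)^-1)%:M \in @unitmx R n by apply: unitmx_scalar; rewrite invr_eq0 lt0r_neq0.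
have dL k : discrete_group (dual_lattice (G k)) by apply: dual_lattice_discrete; exists ((rho k)^-1)%:M.
have LK0 : L2 (fun x => K0 (M *m x)).
  by apply: L2_lscale => //; exact: L2_ift.
have single k x : `|x| < rho k - r -> per (dual_lattice (G k)) f x = f x.
  move=> xr; apply: (per_single (dL k) bf) => l Ll l0; apply: fr.
  have := dual_scalar (rho0 k) Ll l0; have := ler_normB (x + l) x.
  by rewrite [x + l]addrC addrK; lra.
have bound k x : `|per (dual_lattice (G k)) f x| <= B.
  have [[l [Ll xl]]|H] := pselect (exists l, dual_lattice (G k) l /\ `|x + l| <= r).
    rewrite -(per_transl (dL k) f x Ll) single ?fB//.
    by rewrite (le_lt_trans xl)// /rho; have := ltr0Sn R k; lra.
  rewrite [per _ _ _](_ : _ = 0) ?normr0 ?ltW//.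
  apply: fsbig1 => l Ll; apply: fr; rewrite ltNge; apply/negP => xl.
  by apply: H; exists l.
apply: (closed_subspace_dominated cW (f_ := fun k x => K0 (M *m x) *
  (per (dual_lattice (G k)) f x +i* 0)%C) (G := fun x => B ^+ 2 * normc (K0 (M *m x)) ^+ 2)).
- move=> k; apply: (closed_subspace_periodic (g := per (dual_lattice (G k)) f) cW (uR k) LK0).
  + by move=> m; exact: K0W.
  + by have [] := @Ck_per _ _ _ (dL k) 0%N f (conj cf I) bf.
  + by move=> x l Ll; rewrite (per_transl (dL k)).
- move=> x; apply: ccvgM; first exact: ccvg_cst.
  split => /=; last exact: cvg_cst.
  apply: cvg_near_cst; exists (Num.truncn `|x|).+1 => //= k xk.
  apply: single; have := truncnS_gt `|x|; have : (Num.truncn `|x|).+1%:R <= k%:R :> R by rewrite ler_nat.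
  by rewrite /rho -addn1 natrD; lra.
- exact/rintZ/L2_rint.
- move=> k x; rewrite normcM normc_real exprMn mulrC ler_wpM2r ?sqr_ge0//.
  by rewrite ler_sqr ?nnegrE// (le_trans (normr_ge0 _) (bound k x)).
Qed.

(* A compactly supported [f] is approximated by products of a periodization of
   [f], whose period grows, with a slowly varying [K0 (eps x)]. *)
Lemma L2_sub_ift : L2 `<=` W.
Proof.
apply: (L2_sub_closed_subspace cW) => f cf bf.
have [c c0 K0c] := K00; have [M M0 K0M] := ift_bounded tB.
have Wc : W (fun x => K0 0 * (f x +i* 0)%C).
  pose e (k : nat) : R := k.+1%:R^-1.
  have ue k : (e k)%:M \in @unitmx R n by apply: unitmx_scalar; rewrite invr_eq0 pnatr_eq0.
  apply: (closed_subspace_dominated cW (f_ := fun k x => K0 ((e k)%:M *m x) *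
    (f x +i* 0)%C) (G := fun x => M ^+ 2 * f x ^+ 2)).
  - by move=> k; exact: CcK0.
  - move=> x; apply: ccvgM; last exact: ccvg_cst.
    have ex : (e k)%:M *m x @[k --> \oo] --> (0 : 'cV[R]_n).
      under eq_fun do rewrite mul_scalar_mx.
      by rewrite -(scale0r x); apply: cvgZr_tmp; exact: cvg_harmonic.
    split.
      exact: (cvg_comp (fun k => (e k)%:M *m x) _ ex (@Cinf_continuous _ _ _ (Cinf_Re_ift tB) 0)).
    exact: (cvg_comp (fun k => (e k)%:M *m x) _ ex (@Cinf_continuous _ _ _ (Cinf_Im_ift tB) 0)).
  - apply: rintZ; apply: rint_continuous_bsupp.
      by move=> x; apply: (@cvgM _ _ (nbhs x)); exact: cf.
    by case: bf => r fr; exists r => x /fr ->; rewrite expr0n.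
  - move=> k x; rewrite normcM normc_real exprMn real_normK ?num_real//.
    by rewrite ler_wpM2r ?sqr_ge0// ler_sqr ?nnegrE ?normc_ge0.
have := closed_subspaceZ (c^-1 +i* 0)%C cW Wc; congr W; apply/funext => x.
by rewrite K0c !realcM mulKf// lt0r_neq0.
Qed.

End dilation.

(** * Dilates of the scaling space *)

Section contraction.
Context {R : realType} {n : nat}.
Local Notation mu := (lebesgue_cV n.+1).
Local Notation rint f := (mu.-integrable setT (EFin \o f)).

Lemma cV_sum_delta m (x : 'cV[R]_m) : x = \sum_(i < m) x i 0 *: delta_mx i 0.
Proof.
apply/matrixP => j k; rewrite ord1 summxE (bigD1 j)//= big1 => [|i ij].
  by rewrite !mxE !eqxx mulr1 addr0.
by rewrite !mxE eq_sym (negbTE ij) mulr0.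
Qed.

Lemma expansive_uniform (B : 'M[R]_n.+1) (d : R) : expansive B -> 0 < d ->
  exists k : nat, forall x : 'cV[R]_n.+1, `|B ^- k *m x| <= d * `|x|.
Proof.
move=> eB d0; have d1 : 0 < d / n.+1%:R by rewrite divr_gt0.
have H (s : seq 'I_n.+1) : \forall k \near \oo, forall i, i \in s ->
    `|B ^- k *m (delta_mx i 0 : 'cV[R]_n.+1)| <= d / n.+1%:R.
  elim: s => [|i s IHs]; first exact: nearW.
  have := expansive_cvg0 (delta_mx i 0 : 'cV[R]_n.+1) eB.
  move/cvgrPdist_le => /(_ _ d1); apply: filterS2 IHs => k Hs.
  rewrite sub0r normrN => Hi j; rewrite inE => /orP[/eqP -> //|]; exact: Hs.
have [k _ /(_ k (leqnn k)) Hk] := H (enum 'I_n.+1).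
exists k => x; rewrite {1}[x]cV_sum_delta mulmx_sumr.
apply: le_trans (ler_norm_sum _ _ _) _.
apply: (@le_trans _ _ (\sum_(i < n.+1) d / n.+1%:R * `|x|)).
  apply: ler_sum => i _; rewrite -scalemxAr normrZ mulrC.
  by apply: ler_pM => //; [apply: Hk; rewrite mem_enum|exact: mx_norm_coord].
by rewrite sumr_const card_ord -[leLHS]mulr_natr mulrAC divfK// pnatr_eq0.
Qed.

Let Q (r : R) : set 'cV[R]_n.+1 := box (fun=> - r) (fun=> r).

Lemma Rintegral_cube (r : R) : 0 <= r -> \int[mu]_x \1_(Q r) x = (2 * r) ^+ n.+1.
Proof.
move=> r0; rewrite /Rintegral integral_indic ?setIT//; last exact: measurable_box.
rewrite [X in fine X](lebesgue_cV_box (a := fun=> - r) (b := fun=> r)); last first.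
  by move=> i; rewrite ge0_cp.
by rewrite /= prodr_const card_ord opprK -mulr2n mulr_natl.
Qed.

(** The factor is compared through the unit cube: for a suitable [k] its preimage under [A ^+ k]
    lies in the cube of half-side [d]. With [d = min e 1] the ratio of volumes [d ^+ n.+1] is at
    most [d], the dimension being positive. *)
Lemma lscale_expansive (A : 'M[R]_n.+1) (e : R) : expansive A -> 0 < e ->
  exists k : nat, lscale (A ^+ k) <= e.
Proof.
move=> eA e0; have uA := expansive_unitmx eA.
pose d := Num.min e 1; have d0 : 0 < d by rewrite lt_min e0 ltr01.
have [k Hk] := expansive_uniform eA d0; exists k.
have uk : A ^+ k \in unitmx by exact: unitrX.
have P : 0 < (2 * 1) ^+ n.+1 :> R by rewrite mulr1 exprn_gt0.
rewrite -(ler_pM2r P) -(Rintegral_cube ler01) -Rintegral_lscale//; last exact: rint_box.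
apply: (@le_trans _ _ (\int[mu]_x \1_(Q d) x)).
  apply: le_Rintegral => //.
  - by apply: (@integrable_lscale _ _ _ (\1_(Q 1))) => //; exact: rint_box.
  - exact: rint_box.
  - move=> x _; rewrite !indicE.
    case: (boolP (A ^+ k *m x \in Q 1)) => // /set_mem Ax.
    rewrite mem_set// => i; rewrite in_itv/= -ler_norml.
    rewrite (le_trans (mx_norm_coord _ _ _))// -[x](mulKmx uk).
    rewrite (le_trans (Hk _))// ler_piMr ?(ltW d0)//.
    by apply: cV_norm_le => // j; have := Ax j; rewrite in_itv/= -ler_norml.
rewrite !Rintegral_cube ?(ltW d0)// mulr1 exprMn mulrC ler_wpM2r ?exprn_ge0//.
rewrite exprS (@le_trans _ _ (d * 1))//.
  by rewrite ler_wpM2l ?(ltW d0)// exprn_ile1 ?(ltW d0)// ge_min lexx orbT.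
by rewrite mulr1 ge_min lexx.
Qed.

End contraction.

Section supremum.
Context {R : realType} {n : nat}.
Local Notation C := R[i].
Local Notation mu := (lebesgue_cV n).
Local Notation rint f := (mu.-integrable setT (EFin \o f)).

(* Cauchy-Schwarz on the support of [F], in the form [2 |F| <= t |F|^2 + 1/t]. *)
Lemma ift_sup_le (r : R) : 0 < r -> exists2 c : R, 0 < c &
  forall F : 'cV[R]_n -> C, ctest F -> (forall x, r < `|x| -> F x = 0) ->
    forall x, normc (ift F x) ^+ 2 <= c * \int[mu]_x (normc (F x) ^+ 2).
Proof.
move=> r0; pose b : 'cV[R]_n -> R := \1_(box (fun=> - r) (fun=> r)).
have rb : rint b := rint_box _ _.
have m0 : 0 <= \int[mu]_x b x by apply: Rintegral_ge0 => x _; rewrite /b indicE.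
pose m := \int[mu]_x b x + 1; have {}m0 : 0 < m by rewrite ltr_wpDl.
exists (4 * m) => [|F tF Fr x]; first by rewrite mulr_gt0.
set S := \int[mu]_x _; pose D := \int[mu]_x normc (F x).
have iF := ctest_cintegrable tF; have rF := rint_normc iF.
have D0 : 0 <= D by apply: Rintegral_ge0 => y _; exact: normc_ge0.
have rS := L2_rint (ctest_L2 tF).
have DS : D ^+ 2 <= m * S.
  move: D0; rewrite le_eqVlt => /predU1P[<-|Dgt0].
    rewrite expr0n mulr_ge0 ?(ltW m0)//.
    by apply: Rintegral_ge0 => y _; exact: sqr_ge0.
  (* This value of [t] makes the term with [t^-1] at most [D], so that [2 D <= t S + D] gives
     [D^2 <= m S]. *)
  pose t := m / D; have t0 : 0 < t by exact: divr_gt0.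
  have H : D * 2 <= t * S + t^-1 * \int[mu]_x b x.
    rewrite /D /S -RintegralZr// -!RintegralZl// -RintegralD//; [|exact: rintZ..].
    apply: le_Rintegral => // [||y _].
    - by under eq_fun do rewrite /= mulrC; exact: rintZ.
    - by apply: rintD; exact: rintZ.
    rewrite /b indicE; have [yQ|yQ] := boolP (y \in _).
      rewrite mulr1 -subr_ge0.
      rewrite (_ : _ - _ = t * (normc (F y) - t^-1) ^+ 2); last by field; rewrite lt0r_neq0.
      by rewrite mulr_ge0 ?sqr_ge0// ltW.
    rewrite Fr ?normc0 ?mul0r ?mulr0 ?addr0 ?expr0n ?mulr0//.
    rewrite ltNge; apply: contra yQ => yr; apply: mem_set => i.
    by rewrite in_itv/= -ler_norml (le_trans (mx_norm_coord _ _ _)).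
  have H2 : t^-1 * \int[mu]_x b x <= D.
    rewrite /t invf_div mulrAC ler_pdivrMr// ler_pM2l// /m lerDl//.
  have {H H2} : D <= t * S by lra.
  by rewrite /t mulrAC ler_pdivlMr// expr2.
have H : normc (ift F x) <= 2 * D.
  apply: le_trans (normc_cintegral_le _) _; first exact/ctest_cintegrable/ctest_modulation.
  rewrite ler_pM2l//; rewrite le_eqVlt; apply/orP; left; apply/eqP.
  by apply: eq_Rintegral => y _; rewrite normcM normc_cexpi mulr1.
apply: (@le_trans _ _ ((2 * D) ^+ 2)); first by rewrite ler_sqr ?nnegrE ?normc_ge0// mulr_ge0.
have -> : (2 * D) ^+ 2 = 4 * D ^+ 2 by ring.
by rewrite -mulrA ler_pM2l.
Qed.

End supremum.

Section scaling_bound.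
Context {R : realType} {n : nat}.
Local Notation C := R[i].
Local Notation mu := (lebesgue_cV n).
Local Notation rint f := (mu.-integrable setT (EFin \o f)).
Context {G : set 'cV[R]_n} {Phi : 'cV[R]_n -> R} (tPhi : rtest Phi).

(* A form of the pointwise bound [|h x|^2 <= c |h|^2] which passes to the
   L2-closure. *)
Lemma scaling_space_local (V0 := L2closure (lspan G (fun y => translate y (scaling Phi)))) :
  exists2 c : R, 0 < c & forall h (e : 'cV[R]_n -> R), V0 h -> rint e ->
    (forall x, 0 <= e x <= 1) ->
    \int[mu]_x (e x * normc (h x) ^+ 2) <=
      c * (\int[mu]_x e x) * \int[mu]_x (normc (h x) ^+ 2).
Proof.
have [r r0 Pr] := bsupp_pos tPhi.2.
have [c c0 Hc] := @ift_sup_le R n r r0.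
have [k k0 kE] := @fconst_gt0 R n.
(* [c / k] is the pointwise bound for inverse transforms relative to their own norm. One factor 2
   comes from splitting [h] into an element [p] of the span and an error, the other from comparing
   the norms of [p] and [h]. *)
exists (4 * (c / k)) => [|h e V0h re e01]; first by rewrite mulr_gt0// divr_gt0.
have P p : lspan G (fun y => translate y (scaling Phi)) p ->
    exists F, [/\ ctest F, forall x, r < `|x| -> F x = 0 & p = ift F].
  apply: (lspan_sub (V := [set p | exists F,
    [/\ ctest F, forall x, r < `|x| -> F x = 0 & p = ift F]])) => [|a _ _ [F [tF Fr ->]] [F' [tF' Fr' ->]]|g _].
  - by exists (cst 0); split=> //; [exact: ctest0|apply/funext => x; rewrite ift0].
  - exists (fun x => a * F x + F' x); split.
    + by apply: ctestD => //; exact: ctestZ.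
    + by move=> x xr; rewrite Fr// Fr'// mulr0 addr0.
    + by apply/funext => x; rewrite iftD ?iftZ//; exact: ctestZ.
  - exists (fun x => scaling_symbol Phi x * ez (- g) x); split.
    + by apply: ctest_ez; exact: ctest_scaling.
    + by move=> x xr; rewrite /scaling_symbol Pr// mulr0 mul0r.
    + exact: translate_scaling.
have [Lh Hh] := (L2closureP _ _).1 V0h.
set I := \int[mu]_x e x; set S := \int[mu]_x (normc (h x) ^+ 2).
have I0 : 0 <= I by apply: Rintegral_ge0 => x _; case/andP: (e01 x).
have me := rint_measurable re.
have reh (f : 'cV[R]_n -> C) : L2 f -> rint (fun x => e x * normc (f x) ^+ 2).
  move=> Lf; apply: (rint_le _ (L2_rint Lf)) => [|x].
    by apply: measurable_funM => //; exact: rint_measurable (L2_rint Lf).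
  have /andP[e0 e1] := e01 x.
  have q0 := sqr_ge0 (normc (f x)).
  by rewrite (ger0_norm (mulr_ge0 e0 q0)); exact: ler_piMl.
apply/ler_addgt0Pr => eps eps0.
(* The squared error [T] enters the final bound with exactly this coefficient: 2 directly, and
   [4 (c / k) I] through the norm of [p]. *)
pose d := eps / (2 + 4 * (c / k) * I).
have E0 : 0 < 2 + 4 * (c / k) * I.
  by rewrite ltr_wpDr// mulr_ge0// mulr_ge0// ltW// divr_gt0.
have d0 : 0 < d by rewrite divr_gt0.
have [p Dp Hp] := Hh d d0; have [F [tF Fr pE]] := P p Dp.
have Lp : L2 p by rewrite pE; exact: L2_ift.
have LB := L2B Lh Lp.
pose T := \int[mu]_x (normc (h x - p x) ^+ 2).
have Td : T < d by move: Hp; rewrite (sqnE LB) lte_fin.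
pose Sp := \int[mu]_x (normc (p x) ^+ 2).
have SpF : Sp = k * \int[mu]_x (normc (F x) ^+ 2).
  have := plancherel tF; rewrite -pE (sqnE Lp) (sqnE (ctest_L2 tF)) kE /= -EFinM.
  by move=> [].
have psup x : normc (p x) ^+ 2 <= c / k * Sp.
  by rewrite SpF mulrA mulfVK ?lt0r_neq0// pE; exact: Hc.
have rT := L2_rint LB; have rp := L2_rint Lp; have rh := L2_rint Lh.
have H1 : Sp <= 2 * S + 2 * T.
  rewrite /Sp /S /T -!RintegralZl// -RintegralD//; [|exact: rintZ..].
  apply: le_Rintegral => // [|x _]; first by apply: rintD; exact: rintZ.
  have := normcD_sqr (h x) (- (h x - p x)); rewrite normcN.
  by rewrite opprB addrC subrK.
clearbody Sp.
have H2 : \int[mu]_x (e x * normc (h x) ^+ 2) <= 2 * T + 2 * (c / k * Sp * I).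
  have -> : 2 * T + 2 * (c / k * Sp * I) =
      \int[mu]_x (2 * normc (h x - p x) ^+ 2 + 2 * (c / k * Sp) * e x).
    by rewrite RintegralD//; [rewrite !RintegralZl// /T /I; ring|exact: rintZ..].
  apply: le_Rintegral => // [||x _]; first exact: reh.
    by apply: rintD; exact: rintZ.
  have /andP[e0 e1] := e01 x; have := normcD_sqr (h x - p x) (p x); rewrite subrK => H.
  apply: (@le_trans _ _ (e x * (2 * normc (h x - p x) ^+ 2) + e x * (2 * normc (p x) ^+ 2))).
    by rewrite -mulrDr ler_wpM2l.
  rewrite lerD//; first by rewrite ler_piMl// mulr_ge0// sqr_ge0.
  by rewrite mulrCA -mulrA ler_pM2l// mulrC ler_wpM2r.
have ck : 0 < c / k by rewrite divr_gt0.
have H3 : c / k * Sp * I <= c / k * (2 * S + 2 * T) * I.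
  by rewrite ler_wpM2r// ler_pM2l.
have H4 : T * (2 + 4 * (c / k) * I) <= eps.
  by rewrite -ler_pdivlMr// ltW.
by apply: (le_trans H2); rewrite -/S; nra.
Qed.

End scaling_bound.

Arguments scaling_space {R n} G Phi.

(** * Almost everywhere vanishing functions *)

Section null.
Context {R : realType} {n : nat}.
Local Notation C := R[i].
Local Notation mu := (lebesgue_cV n).
Implicit Types (f : 'cV[R]_n -> C).

Lemma sqn_eq0P f : cmeasurable f ->
  sqn f = 0%E <-> {ae mu, forall x, f x = 0}.
Proof.
move=> mf; have m2 := measurable_sqn mf.
have E : sqn f = (\int[mu]_x `|(normc (f x) ^+ 2)%:E|)%E.
  by apply: eq_integral => x _; rewrite gee0_abs// lee_fin sqr_ge0.
rewrite E ae_eq_integral_abs//; split; apply: filterS => x.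
  move=> /(_ I) [] /eqP; rewrite sqrf_eq0 => /eqP; exact: normc0_eq0.
by move=> -> _; rewrite normc0 expr0n.
Qed.

Lemma closed_subspace_null (W : set ('cV[R]_n -> C)) f : closed_subspace W ->
  L2 f -> sqn f = 0%E -> W f.
Proof.
move=> cW Lf f0; apply: (closed_subspace_closed cW); apply/L2closureP; split=> //.
move=> e e0; exists (cst 0); first exact: closed_subspace0 cW.
rewrite (_ : (fun x => _) = f) ?f0 ?lte_fin//.
by apply/funext => x; rewrite subr0.
Qed.

Lemma sqn_box0 f : L2 f ->
  (forall k : nat, \int[mu]_x (\1_(box (fun=> - k%:R) (fun=> k%:R)) x *
    normc (f x) ^+ 2) = 0) -> sqn f = 0%E.
Proof.
move=> Lf f0; rewrite sqnE//; congr EFin.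
have rf := L2_rint Lf.
have := @rint_dominated _ _ _ mu (fun (k : nat) x =>
  \1_(box (fun=> - k%:R) (fun=> k%:R)) x * normc (f x) ^+ 2)
  (fun x => normc (f x) ^+ 2) (fun x => normc (f x) ^+ 2).
case=> //.
- move=> k; apply: measurable_funM; last exact: rint_measurable rf.
  by apply: measurable_indic; exact: measurable_box.
- move=> x; apply: cvg_near_cst; exists (Num.truncn `|x|).+1 => //= k xk.
  rewrite indicE mem_set ?mul1r// => i; rewrite in_itv/= -ler_norml.
  rewrite (le_trans (mx_norm_coord _ _ _))// ltW// (lt_le_trans (truncnS_gt _))//.
  by rewrite ler_nat.
- move=> k x; have q0 := sqr_ge0 (normc (f x)).
  by rewrite indicE; case: (_ \in _); rewrite ?mul1r ?mul0r ?normr0// ger0_norm.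
move=> _; under eq_fun do rewrite f0.
by move=> /(cvg_unique _ (cvg_cst _)) => /(_ (@norm_hausdorff _ _)) <-.
Qed.

End null.

(** * The multiresolution axioms for the dilates of a closed subspace *)

Section dilates.
Context {R : realType} {n : nat}.
Local Notation C := R[i].
Local Notation mu := (lebesgue_cV n.+1).
Local Notation rint f := (mu.-integrable setT (EFin \o f)).
Context {A : 'M[R]_n.+1} (eA : expansive A).
Context {V0 : set ('cV[R]_n.+1 -> C)} (cV0 : closed_subspace V0).
Context (V0A : forall f, V0 f -> V0 (fun x => f (invmx A *m x))).
Context (V0ift : forall F, ctest F -> exists m : nat, V0 (fun x => ift F (A ^- m *m x))).
Context (V0loc : exists2 c : R, 0 < c & forall h (e : 'cV[R]_n.+1 -> R), V0 h ->
  rint e -> (forall x, 0 <= e x <= 1) ->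
  \int[mu]_x (e x * normc (h x) ^+ 2) <=
    c * (\int[mu]_x e x) * \int[mu]_x (normc (h x) ^+ 2)).

Definition dilates (j : int) : set ('cV[R]_n.+1 -> C) :=
  [set f | L2 f /\ V0 (fun x => f (A ^ (- j) *m x))].

Let uA : A \is a GRing.unit := expansive_unitmx eA.

Let uAj j : A ^ j \in unitmx. Proof. exact: unitrXz. Qed.

Let AD i j (x : 'cV[R]_n.+1) : A ^ i *m (A ^ j *m x) = A ^ (i + j) *m x.
Proof. by rewrite mulmxA mulmxE -exprzDr. Qed.

Lemma dilates_closed j : closed_subspace (dilates j).
Proof.
have V0L := closed_subspace_L2 cV0.
split.
- by move=> f [].
- by split; [exact: L2_0|exact: closed_subspace0 cV0].
- move=> a f g [Lf Vf] [Lg Vg]; split; first exact: L2_linear.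
  exact: (Defs.closed_subspaceP cV0 a Vf Vg).
- move=> f Vf; have [Lf _] := Vf; split=> //.
  apply: (closed_subspace_closed cV0).
  apply: (@L2closure_comp _ _ (dilates j) V0 (A ^ (- j)) f) => //.
    by move=> g [].
  by move=> g [_ Vg]; exact: sub_L2closure.
Qed.

Lemma dilatesS j : dilates j `<=` dilates (j + 1).
Proof.
move=> f [Lf Vf]; split=> //; have := V0A Vf; congr V0; apply/funext => x.
by rewrite -[invmx A]/(A ^ (-1)) AD opprD.
Qed.

Lemma dilates_le i (m : nat) : dilates i `<=` dilates (i + m%:Z).
Proof.
elim: m => [|m IHm]; first by rewrite addr0.
by move=> f /IHm/dilatesS; rewrite -addrA -PoszD addn1.
Qed.

Lemma dilates0 : dilates 0 = V0.
Proof.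
apply/seteqP; split=> [f [_]|f Vf].
  by under eq_fun do rewrite oppr0 expr0z mul1mx.
split; first exact: closed_subspace_L2 cV0 _ Vf.
by under eq_fun do rewrite oppr0 expr0z mul1mx.
Qed.

(** For [f] in every dilate, [f (A ^+ m x)] lies in [V0] for all [m]. The local bound applied to it
    on the preimage of a cube [Q], then rescaled, bounds the mass of [f] on [Q] by a multiple of
    [lscale (A ^+ m)], which can be made arbitrarily small. *)
Lemma bigcap_dilates : \bigcap_j dilates j =
  [set f | L2 f /\ {ae mu, forall x, f x = 0}].
Proof.
apply/seteqP; split=> [f Vf|f [Lf f0] j _]; last first.
  have [mf _] := Lf; split=> //; apply: closed_subspace_null => //.
    exact: L2_lscale.
  by rewrite sqn_lscale// (sqn_eq0P mf).2// mule0.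
have [Lf _] := Vf 0 I; split=> //; have [mf _] := Lf.
apply/sqn_eq0P => //; apply: sqn_box0 => // k.
set Q := box _ _; have rQ : rint \1_Q := rint_box _ _.
have rf := L2_rint Lf.
have rQf : rint (fun x => \1_Q x * normc (f x) ^+ 2).
  apply: (rint_le _ rf) => [|x].
    by apply: measurable_funM; [exact: rint_measurable rQ|exact: rint_measurable rf].
  have q0 := sqr_ge0 (normc (f x)).
  by rewrite indicE; case: (_ \in _); rewrite ?mul1r ?mul0r ?normr0// ger0_norm.
set J := \int[mu]_x _; have J0 : 0 <= J.
  by apply: Rintegral_ge0 => x _; rewrite mulr_ge0 ?sqr_ge0// indicE.
have [c c0 Hc] := V0loc.
set q := \int[mu]_x \1_Q x; set S := \int[mu]_x normc (f x) ^+ 2.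
have q0 : 0 <= q by apply: Rintegral_ge0 => x _; rewrite indicE.
have S0 : 0 <= S by apply: Rintegral_ge0 => x _; exact: sqr_ge0.
have JE m : J <= c * q * S * lscale (A ^+ m).
  have [_ Vm] := Vf (- m%:Z) I; rewrite opprK in Vm.
  have um : A ^+ m \in unitmx by exact: unitrX.
  have s0 := lscale_gt0 um.
  have := Hc _ (fun x => \1_Q (A ^+ m *m x)) Vm.
  rewrite (@Rintegral_lscale _ _ _ (\1_Q))// -/q.
  rewrite (@Rintegral_lscale _ _ _ (fun x => \1_Q x * normc (f x) ^+ 2))// -/J.
  rewrite (@Rintegral_lscale _ _ _ (fun x => normc (f x) ^+ 2))// -/S => H.
  have {H} : lscale (A ^+ m) * J <= c * (lscale (A ^+ m) * q) * (lscale (A ^+ m) * S).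
    apply: H; first exact: (@integrable_lscale _ _ _ (\1_Q)).
    by move=> x; rewrite indicE; case: (_ \in _); rewrite /= ?lexx ?ler01.
  rewrite (_ : c * (_ * q) * (_ * S) = lscale (A ^+ m) * (c * q * S * lscale (A ^+ m))); last by ring.
  by rewrite ler_pM2l.
apply/eqP; rewrite eq_le J0 andbT; apply/ler_addgt0Pr => e e0; rewrite add0r.
have cqS : 0 <= c * q * S by rewrite !mulr_ge0// ltW.
have D0 : 0 < c * q * S + 1 by rewrite ltr_wpDl.
have [m Hm] := lscale_expansive eA (divr_gt0 e0 D0).
apply: (le_trans (JE m)).
apply: (@le_trans _ _ (c * q * S * (e / (c * q * S + 1)))); first by rewrite ler_wpM2l.
by rewrite mulrCA ler_piMr ?(ltW e0)// ler_pdivrMr// mul1r lerDl.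
Qed.

(** The union is a subspace because two dilates of indices [i] and [j] lie in the one of index
    [|i| + |j|]. It contains all inverse transforms of test functions, which are dense. *)
Lemma bigcup_dilates : L2closure (\bigcup_j dilates j) = L2.
Proof.
set U := \bigcup_j _.
have UL : U `<=` L2 by move=> f [j _ []].
have cU : closed_subspace (L2closure U).
  apply: closed_subspace_L2closure => //.
    by exists 0 => //; exact: closed_subspace0 (dilates_closed 0).
  move=> a f g [i _ Vf] [j _ Vg].
  have up (p : int) h : dilates p h -> dilates (`|p|%:Z) h.
    have -> : `|p|%:Z = p + (absz (`|p| - p))%:Z.
      by rewrite [X in _ + X]gez0_abs ?subr_ge0 ?ler_norm// abszE subrKC.
    exact: dilates_le.
  exists (`|i|%N + `|j|%N)%:Z => //.
  apply: (Defs.closed_subspaceP (dilates_closed _)).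
    by rewrite PoszD; apply: dilates_le; apply: up.
  by rewrite PoszD addrC; apply: dilates_le; apply: up.
apply/seteqP; split=> [f [] //|].
apply: (L2_sub_ift cU) => F tF; have [m Vm] := V0ift tF.
apply: sub_L2closure => //; exists m%:Z => //; split; first exact: L2_ift.
by move: Vm; rewrite exprnN.
Qed.

Lemma MRA_dilates (G : set 'cV[R]_n.+1) :
  (exists phi, scaling_function G V0 phi) -> MRA A G dilates.
Proof.
move=> sV0; split.
- exact: dilates_closed.
- exact: dilatesS.
- exact: bigcap_dilates.
- exact: bigcup_dilates.
- move=> j f Lf; rewrite dilates0; split=> [Vf|[_]]; last first.
    by under eq_fun do rewrite AD subrr expr0z mul1mx.
  split; first exact: L2_lscale.
  by under eq_fun do rewrite AD subrr expr0z mul1mx.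
- by rewrite dilates0.
Qed.

End dilates.

Lemma ctest_compactly_supported (R : realType) n (F : 'cV[R]_n -> R[i]) :
  bsupp F -> compactly_supported F.
Proof.
move=> [r Fr]; apply: (@compact_cV _ _ _ r); first exact: closed_closure.
have : closure [set x | F x != 0] `<=` [set x | `|x| <= r].
  rewrite (closure_id [set x : 'cV[R]_n | `|x| <= r]).1; last exact: closed_norm_le.
  apply: closure_subset => x /=; rewrite leNgt; apply: contraNN => xr.
  by rewrite Fr.
by [].
Qed.

Arguments dilates {R n} A V0 j.

Theorem theorem6p2 (R : realType) (n : nat) (A : 'M[R]_n.+1)
    (G : set 'cV[R]_n.+1)
    (latG : full_rank_lattice G) (expA : strictly_expansive A G) :
  exists (V : int -> set ('cV[R]_n.+1 -> R[i])) (phi : 'cV[R]_n.+1 -> R[i]),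
    [/\ MRA A G V,
        scaling_function G (V 0) phi,
        schwartz phi,
        csmooth (fourier phi) &
        compactly_supported (fourier phi)].
Proof.
have [eA [K [cK tK KB]]] := expA.
have eB : expansive A^T := expansive_trmx eA.
have dL := dual_lattice_discrete latG.
have [P uP GP] := latG.
have [Phi [V [tPhi pPhi PhiV PhiB [d d0 dV]]]] := exists_symbol dL cK tK eB KB.
have uA : A \in unitmx := expansive_unitmx eA.
pose V0 := scaling_space G Phi.
have cV0 : closed_subspace V0 by exact: (scaling_space_closed GP tPhi).
have core F : ctest F -> (forall x, F x != 0 -> V x) -> V0 (ift F).
  by move=> tF FV; exact: (ift_scaling_space dL uP GP erefl tPhi pPhi PhiV tF FV).
have GB g h : G g -> G h -> G (g - h).
  rewrite GP => -[m _ <-] [m' _ <-]; exists (m - m') => //.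
  by rewrite map_mxB mulmxBr.
have GL g k : G g -> dual_lattice G k -> dotp g k \is a Num.int.
  by move=> Gg Lk; rewrite dotpC; exact: Lk.
have V0L : lspan G (fun y => translate y (scaling Phi)) `<=` L2.
  apply: lspan_sub => [||g Gg]; [exact: L2_0|exact: L2_linear|].
  exact: L2_translate_scaling.
have V0phi g : G g -> V0 (translate g (scaling Phi)).
  by move=> Gg; apply: sub_L2closure => //; exact: lspan_id.
(* By closure it suffices to treat the generators. The transform of a dilated translate is a
   multiple of [Phi (A^T x)] times a character, and [PhiB] puts its support in [V] for every lattice
   vector [g]. *)
have V0A f : V0 f -> V0 (fun x => f (invmx A *m x)).
  apply: L2closure_comp => //; first by rewrite unitmx_inv.
  apply: (lspan_sub (V := [set f | V0 (fun x => f (invmx A *m x))])).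
  - exact: closed_subspace0 cV0.
  - move=> a f1 f2; exact: (Defs.closed_subspaceP cV0 a).
  - move=> g Gg /=; rewrite translate_scaling.
    have tg : ctest (fun x => scaling_symbol Phi x * ez (- g) x) by exact: ctest_scaling_ez.
    have uAT : A^T \in unitmx by rewrite unitmx_tr.
    have E x := ift_lscale x (_ : invmx A \in unitmx) tg.
    under eq_fun do rewrite E ?unitmx_inv// trmx_inv invmxK.
    apply: closed_subspaceZ => //; apply: core; first exact: (ctest_mulmx uAT tg).
    move=> x; rewrite mulf_eq0 negb_or => /andP[+ _] => Sx; apply: PhiB.
    by apply: contra_neq Sx; rewrite /scaling_symbol => ->; rewrite mulr0.
(* Dilating contracts the spectrum: [m] is chosen so that the [m]-th inverse power of [A^T] maps the
   ball of radius [r], outside which [F] vanishes, into the ball of radius [d / 2], hence into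
   [V]. *)
have V0ift F : ctest F -> exists m : nat, V0 (fun x => ift F (A ^- m *m x)).
  move=> tF; have [[_ [r1 F1]] [_ [r2 F2]]] := tF.
  pose r := `|r1| + `|r2| + 1; have r0 : 0 < r by rewrite ltr_wpDl// addr_ge0.
  have e0 : 0 < d / (2 * r) by rewrite divr_gt0// mulr_gt0.
  have [m Hm] := expansive_uniform eB e0; exists m.
  have um : A ^- m \in unitmx by rewrite unitrV unitrX.
  have E x := ift_lscale x um tF.
  have BE : invmx (A ^- m)^T = A^T ^+ m.
    by rewrite trmx_inv invmxK; elim: (m) => [|k IHk];
      rewrite ?trmx1// exprS -mulmxE trmx_mul IHk mulmxE -exprSr.
  under eq_fun do rewrite E BE.
  have uBm : A^T ^+ m \in unitmx by rewrite unitrX// unitmx_tr.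
  apply: closed_subspaceZ => //; apply: core; first exact: (ctest_mulmx uBm tF).
  move=> x Fx; apply: dV; rewrite -[x](mulKmx uBm).
  apply: le_lt_trans (Hm _) _.
  have Br : `|A^T ^+ m *m x| <= r.
    rewrite leNgt; apply: contra_neqN Fx => rx; apply: complexP => /=.
      by apply: F1; apply: lt_trans rx; rewrite /r; have := ler_norm r1; have := normr_ge0 r2; lra.
    by apply: F2; apply: lt_trans rx; rewrite /r; have := ler_norm r2; have := normr_ge0 r1; lra.
  apply: (@le_lt_trans _ _ (d / (2 * r) * r)); first by rewrite ler_pM2l.
  rewrite (_ : _ * _ = d / 2); last by field; rewrite lt0r_neq0.
  by rewrite ltr_pdivrMr// ltr_pMr// ltr1n.
have sV0 : scaling_function G V0 (scaling Phi).
  have E : translate 0 (scaling Phi) = scaling Phi.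
    by apply/funext => x; rewrite /translate subr0.
  split; first by rewrite -E; apply: V0phi; exact: (lattice0 GP).
  split=> // g h; exact: (scaling_orthonormal dL GB GL tPhi pPhi).
exists (dilates A V0), (scaling Phi).
have tS := ctest_scaling tPhi.
have FE : fourier (scaling Phi) = (fun xi : 'cV[R]_n.+1 => @fconst R n.+1 * scaling_symbol Phi xi).
  by apply: funext => xi; exact: fourier_ift.
have [[CF bF] [CF' bF']] : ctest (fourier (scaling Phi)) by rewrite FE; exact: ctestZ.
split.
- apply: MRA_dilates => //; last by exists (scaling Phi).
  exact: scaling_space_local.
- by rewrite dilates0.
- by apply: schwartz_ift; exact: rtestZ.
- by split; exact: Cinf_smooth.
- apply: ctest_compactly_supported; rewrite FE.
  by case: tPhi.2 => r Pr; exists r => x xr; rewrite /scaling_symbol Pr// mulr0 mulr0.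
Qed.
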